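(* Let $n\ge 2$ and let $\alpha\in\left(\frac1n,\,1+\frac1n\right)$. Let $\Sigma\subset\mathbb{R}^{n+1}$ be a closed strictly convex smooth hypersurface, given by a smooth immersion $F:M^n\to\mathbb{R}^{n+1}$ with $F(M^n)=\Sigma$, such that $$K^{\alpha}(p)=-\langle F(p),\vec n(p)\rangle\qquad\text{for all } p\in M^n .$$ Then $\Sigma$ is the unit $n$-sphere $\{x\in\mathbb{R}^{n+1}:|x|=1\}$. Moreover, the unit $n$-sphere satisfies this equation; that is, it is the unique closed strictly convex smooth solution.
   Context: $M^n$ is a closed $n$-dimensional manifold. $K(p)$ is the Gauss curvature (the product of the principal curvatures) of $\Sigma$ at $F(p)$, and $\vec n(p)$ is the interior (inward-pointing) unit normal vector of $\Sigma$ at $F(p)$. The second fundamental form is $h_{ij}=\langle\nabla_i\nabla_j F,\vec n\rangle$, and strictly convex means that $\{h_{ij}\}$ is positive definite everywhere, i.e. all principal curvatures are positive. Here $\langle\cdot,\cdot\rangle$ is the Euclidean inner product on $\mathbb{R}^{n+1}$. *)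

(* Defs.v *)
From HB Require Import structures.
From mathcomp Require Import all_boot all_order all_algebra.
From mathcomp Require Import all_classical all_reals all_analysis.

Set Implicit Arguments.
Unset Strict Implicit.
Unset Printing Implicit Defensive.

Import Order.TTheory GRing.Theory Num.Theory.
Import numFieldNormedType.Exports.

Local Open Scope classical_set_scope.
Local Open Scope ring_scope.

(* The library norm `|x| on 'rV[R]_n is the sup norm: it gives the usual
   topology and differential calculus, but the Euclidean geometry of R^n must
   go through [dotv] and [enorm]. *)
Definition dotv (R : realType) (n : nat) (u v : 'rV[R]_n) : R :=
  \sum_i u 0 i * v 0 i.

Definition enorm (R : realType) (n : nat) (u : 'rV[R]_n) : R :=
  Num.sqrt (dotv u u).

Definition unit_sphere (R : realType) (n : nat) : set 'rV[R]_n :=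
  [set x | enorm x = 1].
Arguments unit_sphere R n : clear implicits.

Definition basis_vec (R : realType) (n : nat) (i : 'I_n) : 'rV[R]_n :=
  delta_mx 0 i.

Definition pos_def (R : realType) (n : nat) (A : 'M[R]_n) : Prop :=
  forall v : 'rV[R]_n, v != 0 -> 0 < (v *m A *m v^T) 0 0.

(* [U] is meant to be open; values of [f] outside [U] are irrelevant. *)
Fixpoint Ck_on (R : realType) (V W : normedModType R) (k : nat)
    (U : set V) (f : V -> W) : Prop :=
  match k with
  | 0 => forall x, U x -> {for x, continuous f}
  | k'.+1 => (forall x, U x -> differentiable f x) /\
             (forall v : V, Ck_on k' U ('D_v f))
  end.

Definition smooth_on (R : realType) (V W : normedModType R)
    (U : set V) (f : V -> W) : Prop :=
  forall k : nat, Ck_on k U f.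

(* A chart is a homeomorphism from the open set [chart_dom] onto the open set
   [chart_map @` chart_dom], with inverse [chart_inv]; both maps are total
   functions, with arbitrary values elsewhere. *)
Record chart (R : realType) (n : nat) (M : topologicalType) := Chart {
  chart_dom : set M;
  chart_map : M -> 'rV[R]_n;
  chart_inv : 'rV[R]_n -> M;
  chart_dom_open : open chart_dom;
  chart_cod_open : open (chart_map @` chart_dom);
  chart_mapK : forall p, chart_dom p -> chart_inv (chart_map p) = p;
  chart_map_continuous : forall p, chart_dom p ->
    {for p, continuous chart_map};
  chart_inv_continuous : forall x, (chart_map @` chart_dom) x ->
    {for x, continuous chart_inv}
}.

Definition chart_cod (R : realType) (n : nat) (M : topologicalType)
    (c : chart R n M) : set 'rV[R]_n := chart_map c @` chart_dom c.

(* Second countability is automatic for a compact locally Euclidean space.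
   Connectedness is not required. *)
Record closed_manifold (R : realType) (n : nat) := ClosedManifold {
  manifold_space :> topologicalType;
  atlas : set (chart R n manifold_space);
  atlas_cover : forall p : manifold_space, exists2 c, atlas c & chart_dom c p;
  atlas_compatible : forall c d, atlas c -> atlas d ->
    smooth_on (chart_map c @` (chart_dom c `&` chart_dom d))
              (chart_map d \o chart_inv c);
  manifold_hausdorff : hausdorff_space manifold_space;
  manifold_compact : compact [set: manifold_space];
  manifold_nonempty : [set: manifold_space] !=set0
}.

Definition smooth_map (R : realType) (n m : nat) (M : closed_manifold R n)
    (F : M -> 'rV[R]_m) : Prop :=
  forall c, atlas c -> smooth_on (chart_cod c) (F \o chart_inv c).

Definition immersion (R : realType) (n m : nat) (M : closed_manifold R n)
    (F : M -> 'rV[R]_m) : Prop :=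
  forall c p, atlas c -> chart_dom c p ->
    injective ('d (F \o chart_inv c) (chart_map c p)).

Definition enclosed_by (R : realType) (m : nat) (S : set 'rV[R]_m)
    (x : 'rV[R]_m) : Prop :=
  ~ S x /\ bounded_set (connected_component (~` S) x).

Definition interior_unit_normal (R : realType) (n : nat)
    (M : closed_manifold R n) (F nu : M -> 'rV[R]_n.+1) : Prop :=
  forall p : M,
    [/\ enorm (nu p) = 1,
        forall c, atlas c -> chart_dom c p -> forall v : 'rV[R]_n,
          dotv ('D_v (F \o chart_inv c) (chart_map c p)) (nu p) = 0
      & \forall t \near 0^'+, enclosed_by (range F) (F p + t *: nu p)].

Definition first_fundamental_form (R : realType) (n m : nat)
    (M : closed_manifold R n) (F : M -> 'rV[R]_m)
    (c : chart R n M) (p : M) : 'M[R]_n :=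
  \matrix_(i, j)
    dotv ('D_(basis_vec R i) (F \o chart_inv c) (chart_map c p))
         ('D_(basis_vec R j) (F \o chart_inv c) (chart_map c p)).

(* h_ij = <nabla_i nabla_j F, nu>; the Christoffel part of
   nabla_i nabla_j F = d_i d_j F - Gamma^k_ij d_k F is tangential and drops. *)
Definition second_fundamental_form (R : realType) (n m : nat)
    (M : closed_manifold R n) (F nu : M -> 'rV[R]_m)
    (c : chart R n M) (p : M) : 'M[R]_n :=
  \matrix_(i, j)
    dotv ('D_(basis_vec R i) ('D_(basis_vec R j) (F \o chart_inv c))
            (chart_map c p)) (nu p).

(* Row-vector convention: v |-> v *m shape_operator is the Weingarten map in
   the coordinates of c. *)
Definition shape_operator (R : realType) (n m : nat)
    (M : closed_manifold R n) (F nu : M -> 'rV[R]_m)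
    (c : chart R n M) (p : M) : 'M[R]_n :=
  second_fundamental_form F nu c p *m invmx (first_fundamental_form F c p).

(* The eigenvalues of the shape operator, listed with multiplicity. The shape
   operator of an immersion is self-adjoint for the first fundamental form, so
   its characteristic polynomial splits over R and the default [::] is not
   used; the list is determined up to order and independent of the chart c
   around p. *)
Definition principal_curvatures (R : realType) (n m : nat)
    (M : closed_manifold R n) (F nu : M -> 'rV[R]_m)
    (c : chart R n M) (p : M) : seq R :=
  xget [::] [set s : seq R |
    char_poly (shape_operator F nu c p) = \prod_(k <- s) ('X - k%:P)].

Definition gauss_curvature (R : realType) (n m : nat)
    (M : closed_manifold R n) (F nu : M -> 'rV[R]_m)
    (c : chart R n M) (p : M) : R :=
  \prod_(k <- principal_curvatures F nu c p) k.

Definition strictly_convex (R : realType) (n m : nat)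
    (M : closed_manifold R n) (F nu : M -> 'rV[R]_m) : Prop :=
  forall c p, atlas c -> chart_dom c p ->
    pos_def (second_fundamental_form F nu c p).

Definition strictly_convex_hypersurface (R : realType) (n : nat)
    (M : closed_manifold R n) (F nu : M -> 'rV[R]_n.+1) : Prop :=
  [/\ smooth_map F, immersion F, interior_unit_normal F nu
    & strictly_convex F nu].

Definition gauss_soliton (R : realType) (n : nat) (alpha : R)
    (M : closed_manifold R n) (F nu : M -> 'rV[R]_n.+1) : Prop :=
  forall c p, atlas c -> chart_dom c p ->
    gauss_curvature F nu c p `^ alpha = - dotv (F p) (nu p).

(* Main.v *)
(* Put beta = 1/alpha, q = 1 - beta/n, u = - <F,nu> = K^alpha and
   E_w = w + (q/2)|F|^2. On a nonempty open and closed part C of the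
   hypersurface take the least w for which u g <= E_w h holds between the two
   fundamental forms; equality occurs in some direction at some point p. In the
   gnomonic chart X of the Gauss map centred at p the equation is of
   Monge-Ampere type, det D^2 U = U^(-beta) (1 + |X|^2)^(-(n+2-beta)/2) with U
   the homogeneous support function, and the second order conditions at p,
   evaluated on the vector field e_k + X_k y for a suitable constant y, force
   all principal curvatures at p to coincide, that is, ln E_w - q ln u vanishes
   at p. Under u g <= E_w h the gradient of this nonnegative defect is bounded
   by the defect itself, so by Gronwall it vanishes near p, and u g = E_w h near
   p. Differentiating this identity gives F = -nu, whence w = 1 - q/2. Then the
   same argument with w = 1 - q/2 shows that the interior of {F = -nu} is open
   and closed, and the complement cannot contain a point p as above. *)

Require Import Defs.
From HB Require Import structures.
From mathcomp Require Import all_boot all_order all_algebra.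
From mathcomp Require Import all_classical all_reals all_analysis.
From mathcomp Require Import ring lra.

Set Implicit Arguments.
Unset Strict Implicit.
Unset Printing Implicit Defensive.

Import Order.TTheory GRing.Theory Num.Theory.
Import numFieldNormedType.Exports.

Local Open Scope classical_set_scope.
Local Open Scope ring_scope.

(** * Smooth maps *)

(** The form of E_w is forced by umbilic points: if all principal curvatures equal d, then d^n =
    u^beta gives d = u^(1-q), so contact u = E_w d means E_w = u^q, and there the gradient of u^q is
    q<F, dF>, which is the gradient of (q/2)|F|^2. The least principal curvature need not be
    differentiable where it is multiple; an inequality between quadratic forms avoids this, at the
    price of testing it on a moving vector field, whose constant y supplies a sign that the constant
    field e_k would not give. The normal comes without any regularity: continuity of h and
    differentiability of u^2 have to be derived from F. Hence the gnomonic coordinates are built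
    from first derivatives of F alone, derivatives with respect to them are taken through the
    inverse Jacobian instead of a new chart, and u is reached through u^2 = U^2/(1 + |X|^2). M may
    have several components, and the least w might a priori depend on the part considered; since it
    turns out to be 1 - q/2, one inequality with a known constant holds on all of M, and contact can
    then be restarted at any limit point. *)

Section NormedCalculus.
Variables (R : realType) (V W : normedModType R).
Implicit Types (U : set V) (f g : V -> W).

(** [g - f] vanishes near [x], so it is a little-o of the increment and has differential 0 there;
    then [g = f + (g - f)]. *)
Lemma near_eq_differentiable f g (x : V) :
  (\forall y \near x, f y = g y) -> differentiable f x -> differentiable g x.
Proof.
move=> fg df.
have -> : g = f + (g - f) by apply/funext => y; rewrite !fctE addrC subrK.
apply: differentiableD; first exact: df.
have fgx := nbhs_singleton fg.
have E : (g - f) \o shift x = cst ((g - f) x) + \0 +o_ 0 id.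
  apply: eqaddoE.
  pose k : V -> W := (g - f) \o shift x.
  have ko : [o_ 0 (id : V -> V) of k] = k.
    apply: littleoE => _/posnumP[e].
    have : \forall h \near 0, f (h + x) = g (h + x).
      by move: fg; rewrite (near_shift 0) subr0.
    apply: filterS => h fgh.
    by rewrite /k /= !fctE /= fgh subrr normr0 mulr_ge0.
  rewrite -/k -[k in LHS]ko.
  rewrite (_ : cst _ + _ = 0) ?add0r //.
  by apply/funext => y; rewrite !fctE /= fgx subrr addr0.
have c0 : continuous (\0 : V -> W) by exact: cst_continuous.
by apply/diff_locallyP; rewrite (diff_unique c0 E).
Qed.

Lemma open_nearP U (P : V -> Prop) x :
  open U -> U x -> (forall y, U y -> P y) -> \forall y \near x, P y.
Proof. by move=> Uo Ux UP; apply: filterS UP _; apply: open_nbhs_nbhs. Qed.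

Lemma open_eq_derive U f g x v :
  open U -> (forall y, U y -> f y = g y) -> U x -> 'D_v f x = 'D_v g x.
Proof. by move=> Uo fg Ux; apply: near_eq_derive; apply: open_nearP fg. Qed.

(** [Ck_on] speaks of total functions, while derivative formulas hold only on [U]. Each later
    induction on [k] uses this lemma to replace ['D_v f] by its formula; openness of [U] makes
    agreement on [U] an agreement near each of its points. *)
Lemma Ck_on_eq k U f g : open U -> (forall x, U x -> f x = g x) ->
  Ck_on k U f -> Ck_on k U g.
Proof.
move=> Uo; elim: k f g => [|k IH] f g fg /=.
  move=> fc x Ux.
  have fgx : \forall y \near x, f y = g y by exact: open_nearP fg.
  have -> : {for x, continuous g} = (g @ x --> g x) by [].
  rewrite -(fg _ Ux); apply: cvg_trans (fc x Ux).
  exact: near_eq_cvg.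
case=> fd fD; split=> [x Ux|v].
  apply: near_eq_differentiable (fd x Ux); exact: open_nearP fg.
apply: IH (fD v) => x Ux; exact: open_eq_derive fg Ux.
Qed.

Lemma Ck_on_sub k U U' f : U' `<=` U -> Ck_on k U f -> Ck_on k U' f.
Proof.
move=> UU; elim: k f => [|k IH] f /=; first by move=> fc x /UU; exact: fc.
by case=> fd fD; split=> [x /UU|v]; [exact: fd|exact/IH/fD].
Qed.

Lemma Ck_onS k U f : Ck_on k.+1 U f -> Ck_on k U f.
Proof.
elim: k f => [|k IH] f /=.
  by case=> fd _ x Ux; apply: differentiable_continuous; exact: fd.
by case=> fd fD; split=> // v; apply: IH; exact: fD.
Qed.

Lemma smooth_on_sub U U' f : U' `<=` U -> smooth_on U f -> smooth_on U' f.
Proof. by move=> UU fs k; apply: Ck_on_sub UU _; exact: fs. Qed.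

Lemma smooth_on_eq U f g : open U -> (forall x, U x -> f x = g x) ->
  smooth_on U f -> smooth_on U g.
Proof. by move=> Uo fg fs k; apply: Ck_on_eq fg (fs k). Qed.

Lemma smooth_on_differentiable U f x :
  smooth_on U f -> U x -> differentiable f x.
Proof. by move=> fs Ux; case: (fs 1) => fd _; exact: fd. Qed.

Lemma smooth_on_continuous U f x :
  smooth_on U f -> U x -> {for x, continuous f}.
Proof. by move=> fs; exact: (fs 0). Qed.

Lemma smooth_on_derivable U f x v :
  smooth_on U f -> U x -> derivable f x v.
Proof.
by move=> fs Ux; apply: diff_derivable; exact: smooth_on_differentiable fs Ux.
Qed.

Lemma smooth_on_derive U f v : smooth_on U f -> smooth_on U ('D_v f).
Proof. by move=> fs k; case: (fs k.+1) => _; exact. Qed.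

Lemma Ck_on_cst k U (w : W) : open U -> Ck_on k U (fun=> w : W).
Proof.
move=> Uo; elim: k w => [|k IH] w /=; first by move=> x _; exact: cst_continuous.
split=> [x _|v]; first exact: differentiable_cst.
apply: Ck_on_eq (IH 0) => // x _; by rewrite derive_cst.
Qed.

Lemma smooth_on_cst U (w : W) : open U -> smooth_on U (fun=> w : W).
Proof. by move=> Uo k; exact: Ck_on_cst. Qed.

Lemma Ck_onD k U f g : open U -> Ck_on k U f -> Ck_on k U g ->
  Ck_on k U (fun x => f x + g x).
Proof.
move=> Uo; elim: k f g => [|k IH] f g /=.
  by move=> fc gc x Ux; apply: continuousD; [exact: fc|exact: gc].
case=> fd fD [gd gD]; split=> [x Ux|v].
  by apply: (@differentiableD _ _ _ f g); [exact: fd|exact: gd].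
apply: Ck_on_eq (IH _ _ (fD v) (gD v)) => // x Ux.
by rewrite (@deriveD _ _ _ f g) //; apply: diff_derivable; [exact: fd|exact: gd].
Qed.

Lemma smooth_onD U f g : open U -> smooth_on U f -> smooth_on U g ->
  smooth_on U (fun x => f x + g x).
Proof. by move=> Uo fs gs k; exact: Ck_onD. Qed.

Lemma smooth_on_sum (I : Type) (r : seq I) (P : pred I) U (F : I -> V -> W) :
  open U -> (forall i, smooth_on U (F i)) ->
  smooth_on U (fun x => \sum_(i <- r | P i) F i x).
Proof.
move=> Uo Fs; elim: r => [|i r IH].
  apply: (@smooth_on_eq U (fun=> 0)) => //; last exact: smooth_on_cst.
  by move=> x _; rewrite big_nil.
apply: (@smooth_on_eq U
  (fun x => (if P i then F i x else 0) + \sum_(i <- r | P i) F i x)) => //.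
  by move=> x _; rewrite big_cons; case: ifP => //; rewrite add0r.
apply: smooth_onD => //; case: (P i) => //; exact: smooth_on_cst.
Qed.

End NormedCalculus.

(** * Composition with continuous linear maps *)

Section LinearPost.
Variables (R : realType) (V W W' : normedModType R).

Lemma derive_linear (L : {linear W -> W'}) (f : V -> W) x v :
  continuous L -> derivable f x v -> 'D_v (fun y => L (f y)) x = L ('D_v f x).
Proof.
move=> Lc fd; rewrite /derive.
apply/cvg_lim => //=.
have -> : (fun h => h^-1 *: (L (f (h *: v + x)) - L (f x))) =
  L \o (fun h => h^-1 *: (f (h *: v + x) - f x)).
  by apply/funext => h /=; rewrite linearZZ (raddfB L).
apply: cvg_comp; first exact: fd.
exact: Lc.
Qed.

Lemma smooth_on_linear (L : {linear W -> W'}) (U : set V) (f : V -> W) :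
  open U -> continuous L -> smooth_on U f -> smooth_on U (fun y => L (f y)).
Proof.
move=> Uo Lc fs k; elim: k f fs => [|k IH] f fs /=.
  move=> x Ux; apply: continuous_comp; first exact: (fs 0).
  exact: Lc.
split=> [x Ux|v].
  apply: (@differentiable_comp _ _ _ _ f L).
    exact: smooth_on_differentiable fs Ux.
  exact: linear_differentiable.
apply: Ck_on_eq (IH _ (smooth_on_derive v fs)) => // x Ux.
rewrite derive_linear //; exact: smooth_on_derivable fs Ux.
Qed.
End LinearPost.

(** * Products, inverses, determinants and logarithms of smooth scalar functions *)

Section ScalarCalculus.
Variables (R : realType) (V : normedModType R).
Implicit Types (U : set V) (f g : V -> R).

Lemma Ck_onM k U f g : open U -> Ck_on k U f -> Ck_on k U g ->
  Ck_on k U (fun x => f x * g x).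
Proof.
move=> Uo; elim: k f g => [|k IH] f g.
  by move=> fc gc x Ux; apply: continuousM; [exact: fc|exact: gc].
move=> fk gk; have [fd fD] := fk; have [gd gD] := gk; split=> [x Ux|v].
  by apply: (@differentiableM _ _ f g); [exact: fd|exact: gd].
apply: (@Ck_on_eq _ _ _ k U (fun x => f x * 'D_v g x + g x * 'D_v f x)) => //.
  move=> x Ux; rewrite (@deriveM _ _ f g) //.
    by apply: diff_derivable; exact: fd.
  by apply: diff_derivable; exact: gd.
by apply: (Ck_onD Uo); apply: IH; (apply: gD || apply: fD || (apply: Ck_onS; assumption)).
Qed.

Lemma smooth_onM U f g : open U -> smooth_on U f -> smooth_on U g ->
  smooth_on U (fun x => f x * g x).
Proof. by move=> Uo fs gs k; exact: Ck_onM. Qed.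

Lemma smooth_onN U f : open U -> smooth_on U f -> smooth_on U (fun x => - f x).
Proof.
move=> Uo fs; apply: (@smooth_on_eq _ _ _ U (fun x => (-1) * f x)) => //.
  by move=> x _; rewrite mulN1r.
by apply: smooth_onM => //; exact: smooth_on_cst.
Qed.

(** The derivative of [1/f] is [-(1/f)^2] times that of [f], so the induction on the order only
    needs [1/f] itself at the previous order. *)
Lemma smooth_onV U f : open U -> (forall x, U x -> f x != 0) ->
  smooth_on U f -> smooth_on U (fun x => (f x)^-1).
Proof.
move=> Uo f0 fs k; elim: k => [|k IH].
  move=> x Ux; apply: continuousV; first exact: f0.
  exact: (fs 0).
split=> [x Ux|v].
  by apply: (@differentiableV _ _ f); [exact: smooth_on_differentiable fs Ux|exact: f0].
apply: (@Ck_on_eq _ _ _ k U (fun x => (-1 * ((f x)^-1 * (f x)^-1)) * 'D_v f x)) => //.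
  move=> x Ux; rewrite (@deriveV _ _ f) ?f0 //.
    by rewrite /GRing.scale /= mulN1r -expr2 exprVn.
  exact: smooth_on_derivable fs Ux.
apply: Ck_onM => //; last exact: smooth_on_derive.
by do ?apply: Ck_onM => //; exact: Ck_on_cst.
Qed.

Lemma smooth_on_prod (I : Type) (r : seq I) (P : pred I) U (F : I -> V -> R) :
  open U -> (forall i, smooth_on U (F i)) ->
  smooth_on U (fun x => \prod_(i <- r | P i) F i x).
Proof.
move=> Uo Fs; elim: r => [|i r IH].
  apply: (@smooth_on_eq _ V R U (fun=> 1)) => //; last exact: smooth_on_cst.
  by move=> x _; rewrite big_nil.
apply: (@smooth_on_eq _ _ _ U
  (fun x => (if P i then F i x else 1) * \prod_(i <- r | P i) F i x)) => //.
  by move=> x _; rewrite big_cons; case: ifP => //; rewrite mul1r.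
apply: smooth_onM => //; case: (P i) => //; exact: smooth_on_cst.
Qed.

Lemma smooth_on_det n U (A : V -> 'M[R]_n) :
  open U -> (forall i j, smooth_on U (fun x => A x i j)) ->
  smooth_on U (fun x => \det (A x)).
Proof.
move=> Uo As; rewrite /determinant.
apply: smooth_on_sum => // s; apply: smooth_onM => //; first exact: smooth_on_cst.
by apply: smooth_on_prod.
Qed.

(** Where the determinant vanishes [invmx] returns its argument; on [U] the cofactor formula applies
    and shows smoothness entry by entry. *)
Lemma smooth_on_invmx n U (A : V -> 'M[R]_n) i j :
  open U -> (forall i j, smooth_on U (fun x => A x i j)) ->
  (forall x, U x -> \det (A x) != 0) ->
  smooth_on U (fun x => invmx (A x) i j).
Proof.
move=> Uo As A0.
apply: (@smooth_on_eq _ _ _ U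
  (fun x => (\det (A x))^-1 *
     ((-1) ^+ (j + i) * \det (row' j (col' i (A x)))))) => //.
  by move=> x Ux; rewrite /invmx unitmxE unitfE A0 // !mxE.
apply: smooth_onM => //; first by apply: smooth_onV => //; exact: smooth_on_det.
apply: smooth_onM => //; first exact: smooth_on_cst.
apply: smooth_on_det => // k l.
by apply: (@smooth_on_eq _ _ _ U (fun x => A x (lift j k) (lift i l))) => // x; rewrite !mxE.
Qed.

Lemma smooth_derivD U f g x v : smooth_on U f -> smooth_on U g -> U x ->
  'D_v (fun y => f y + g y) x = 'D_v f x + 'D_v g x.
Proof.
move=> fs gs Ux; apply: (@deriveD _ _ _ f g).
  exact: smooth_on_derivable fs Ux.
exact: smooth_on_derivable gs Ux.
Qed.

Lemma smooth_derivM U f g x v : smooth_on U f -> smooth_on U g -> U x ->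
  'D_v (fun y => f y * g y) x = 'D_v f x * g x + f x * 'D_v g x.
Proof.
move=> fs gs Ux; rewrite (@deriveM _ _ f g) //.
- by rewrite /GRing.scale /= addrC [g x * _]mulrC.
- exact: smooth_on_derivable fs Ux.
- exact: smooth_on_derivable gs Ux.
Qed.

Lemma derive_ln f x v : 0 < f x -> differentiable f x ->
  'D_v (fun y => ln (f y)) x = 'D_v f x / f x.
Proof.
move=> f0 fd.
have lnd : differentiable (@ln R) (f x).
  by apply/derivable1_diffP; case: (is_derive1_ln f0).
rewrite (_ : (fun y => ln (f y)) = @ln R \o f) //.
rewrite deriveE; last exact: differentiable_comp.
have lnE w : 'D_w (@ln R) (f x) = w * (f x)^-1.
  have -> : (f x)^-1 = 'D_1 (@ln R) (f x) by case: (is_derive1_ln f0).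
  rewrite !deriveE //.
  have {1}-> : w = w *: (1 : R) by rewrite /GRing.scale /= mulr1.
  by rewrite [LHS]linearZ.
by rewrite diff_comp //= -!deriveE.
Qed.

Lemma differentiable_ln f x : 0 < f x -> differentiable f x ->
  differentiable (fun y => ln (f y)) x.
Proof.
move=> f0 fd; apply: (@differentiable_comp _ _ _ _ f (@ln R)) => //.
by apply/derivable1_diffP; case: (is_derive1_ln f0).
Qed.

Lemma smooth_on_ln U f : open U -> (forall x, U x -> 0 < f x) ->
  smooth_on U f -> smooth_on U (fun x => ln (f x)).
Proof.
move=> Uo f0 fs.
have fd x : U x -> differentiable f x by exact: smooth_on_differentiable.
have ld x : U x -> differentiable (fun y => ln (f y)) x.
  by move=> Ux; apply: differentiable_ln; [exact: f0|exact: fd].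
case=> [|k].
  by move=> x Ux; apply: differentiable_continuous; exact: ld.
split=> // v.
apply: (@Ck_on_eq _ _ _ k U (fun x => 'D_v f x * (f x)^-1)) => //.
  by move=> x Ux; rewrite derive_ln //; [exact: f0|exact: fd].
apply: smooth_onM => //; first exact: smooth_on_derive.
by apply: smooth_onV => // x Ux; rewrite gt_eqF // f0.
Qed.

End ScalarCalculus.

(** * Mean values along segments: symmetry of second derivatives and local minima *)

Section Lines.
Variables (R : realType) (V : normedModType R).
Implicit Types (U : set V) (f : V -> R).

Lemma is_derive_line f (x v : V) (t : R) : derivable f (t *: v + x) v ->
  is_derive t 1 (fun s : R => f (s *: v + x)) ('D_v f (t *: v + x)).
Proof.
move=> fd.
have E : (fun h : R => h^-1 *: ((fun s : R => f (s *: v + x)) (h *: (1 : R) + t)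
           - f (t *: v + x))) =
         (fun h : R => h^-1 *: (f (h *: v + (t *: v + x)) - f (t *: v + x))).
  apply/funext => h; congr (_ *: (f _ - _)).
  by rewrite addrA -scalerDl /GRing.scale /= mulr1.
by split; rewrite /derivable /derive /= E.
Qed.

Lemma line_MVT f (x v : V) :
  (forall t : R, 0 <= t <= 1 -> differentiable f (t *: v + x)) ->
  exists2 t : R, 0 < t < 1 & f (v + x) - f x = 'D_v f (t *: v + x).
Proof.
move=> fd.
have dl (t : R) : 0 <= t <= 1 ->
    is_derive t 1 (fun s : R => f (s *: v + x)) ('D_v f (t *: v + x)).
  by move=> t01; apply: is_derive_line; apply: diff_derivable; exact: fd.
have [||c c01] := @MVT R (fun s : R => f (s *: v + x)) (fun t : R => 'D_v f (t *: v + x)) 0 1 ltr01.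
- by move=> t; rewrite in_itv /= => /andP[t0 t1]; apply: dl; rewrite !ltW.
- apply: derivable_within_continuous => t; rewrite in_itv /= => t01.
  by case: (dl t t01).
rewrite scale1r scale0r add0r subr0 mulr1 => E; exists c => //.
Qed.

Lemma scale_derive f (x v : V) (h : R) : differentiable f x ->
  'D_(h *: v) f x = h * 'D_v f x.
Proof. by move=> fd; rewrite !deriveE // linearZ. Qed.

(** A small parallelogram at [x] with sides along [v] and [w] fits into [B]. The [+ 1] in the step
    size covers [v = w = 0]. *)
Lemma near_small_comb (x v w : V) (B : set V) : nbhs x B ->
  exists2 h : R, 0 < h & forall s t : R, 0 <= s <= 1 -> 0 <= t <= 1 ->
    B (s *: (h *: v) + (t *: (h *: w) + x)).
Proof.
move=> /nbhs_ballP[e /= e0 eB].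
have [k k0 ek] : exists2 k, 0 < k & e = k * (`|v| + `|w| + 1).
  by exists (e / (`|v| + `|w| + 1)); [exact: divr_gt0|rewrite divfK // gt_eqF].
exists k => // s t /andP[s0 s1] /andP[t0 t1]; apply: eB.
rewrite -ball_normE /= distrC addrA addrK.
apply: le_lt_trans (ler_normD _ _) _.
rewrite !normrZ (ger0_norm s0) (ger0_norm t0).
rewrite (gtr0_norm k0) ek.
have kv : 0 <= k * `|v| by rewrite mulr_ge0 // ltW.
have kw : 0 <= k * `|w| by rewrite mulr_ge0 // ltW.
by nra.
Qed.

(** Two mean values, along [v] for the increment [f (w + y) - f y] and then along [w], turn the
    second difference over a parallelogram into a mixed derivative at one of its points. The
    difference itself is symmetric in [v] and [w]. *)
Lemma mixed_difference U f (x v w : V) : open U -> Ck_on 2 U f ->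
  (forall s t : R, 0 <= s <= 1 -> 0 <= t <= 1 -> U (s *: v + (t *: w + x))) ->
  exists s t : R, [/\ 0 <= s <= 1, 0 <= t <= 1 &
   f (v + (w + x)) - f (v + x) - (f (w + x) - f x) =
     'D_w ('D_v f) (s *: v + (t *: w + x))].
Proof.
move=> Uo [fd fD] UU.
pose p (y : V) := f (w + y) - f y.
have r01 : (0 : R) <= (0 : R) <= (1 : R) by apply/andP; split; [exact: lexx|exact: ler01].
have r11 : (0 : R) <= (1 : R) <= (1 : R) by apply/andP; split; [exact: ler01|exact: lexx].
have Uw (t : R) : 0 <= t <= 1 -> U (w + (t *: v + x)).
  move=> t01; have := UU t 1 t01 r11; rewrite scale1r.
  by rewrite addrCA.
have Uv (t : R) : 0 <= t <= 1 -> U (t *: v + x).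
  by move=> t01; have := UU t 0 t01 r01; rewrite scale0r add0r.
have shd y : U (w + y) -> differentiable (fun y => f (w + y)) y.
  move=> Uy; have : differentiable (f \o (fun y : V => w + y)) y.
    apply: differentiable_comp; last exact: fd.
    by apply: (@differentiableD _ _ _ (cst w) id).
  by [].
have [|t t01 Et] := @line_MVT p x v.
  move=> t t01; apply: (@differentiableB _ _ _ (fun y => f (w + y)) f).
    by apply: shd; exact: Uw.
  by apply: fd; exact: Uv.
have t01' : 0 <= t <= 1 by case/andP: t01 => /ltW-> /ltW->.
have [|s s01 Es] := @line_MVT ('D_v f) (t *: v + x) w.
  move=> s s01; case: (fD v) => fvd _; apply: fvd.
  by rewrite addrCA; apply: UU.
have s01' : 0 <= s <= 1 by case/andP: s01 => /ltW-> /ltW->.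
exists t, s; split; [exact: t01'|exact: s01'|].
rewrite [RHS](_ : _ = 'D_w ('D_v f) (s *: w + (t *: v + x))); last by rewrite addrCA.
rewrite -Es.
have Dsh : 'D_v (fun y => f (w + y)) (t *: v + x) = 'D_v f (w + (t *: v + x)).
  have E : (fun h : R => h^-1 *: (f (w + (h *: v + (t *: v + x)))
              - f (w + (t *: v + x)))) =
      (fun h : R => h^-1 *: (f (h *: v + (w + (t *: v + x))) - f (w + (t *: v + x)))).
    by apply/funext => h; congr (_ *: (f _ - _)); rewrite addrCA.
  by rewrite /derive /= E.
have d1 : derivable (fun y => f (w + y)) (t *: v + x) v.
  by apply: diff_derivable; apply: shd; exact: Uw.
have d2 : derivable f (t *: v + x) v.
  by apply: diff_derivable; apply: fd; exact: Uv.
rewrite -Dsh -(deriveB d1 d2).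
by rewrite -[RHS]Et /p opprB [w + (v + x)]addrCA; ring.
Qed.

Lemma scale2_derive U f (h : R) (v w y : V) : open U -> smooth_on U f -> U y ->
  'D_(h *: w) ('D_(h *: v) f) y = h * h * 'D_w ('D_v f) y.
Proof.
move=> Uo fs Uy.
have fvd : differentiable ('D_v f) y.
  exact: smooth_on_differentiable (smooth_on_derive v fs) Uy.
have fvw : derivable ('D_v f) y (h *: w) by exact: diff_derivable.
have E z : U z -> 'D_(h *: v) f z = h * 'D_v f z.
  by move=> Uz; apply: scale_derive; exact: smooth_on_differentiable fs Uz.
rewrite (open_eq_derive (h *: w) Uo E Uy) (@deriveZ _ _ _ ('D_v f) h y (h *: w) fvw) (scale_derive w h fvd).
exact: mulrA.
Qed.

Lemma dist_half (a b c e : R) : `|a - c| < e / 2 -> `|b - c| < e / 2 -> `|a - b| <= e.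
Proof.
move=> ac bc; apply: le_trans (ler_distD c _ _) _.
by rewrite [leRHS]splitr; apply: lerD; [exact: ltW|rewrite distrC; exact: ltW].
Qed.

(** Both mixed derivatives, each at some point of the same small parallelogram, equal the second
    difference divided by [h * h]; as the parallelogram shrinks, continuity gives equality at
    [x]. *)
Lemma derive_comm U f (x v w : V) : open U -> smooth_on U f -> U x ->
  'D_w ('D_v f) x = 'D_v ('D_w f) x.
Proof.
move=> Uo fs Ux.
apply/eqP; rewrite -subr_eq0 -normr_eq0; apply/eqP.
apply/le_anti; rewrite normr_ge0 andbT; apply/ler_addgt0Pl => e e0; rewrite addr0.
have c1 := smooth_on_continuous (smooth_on_derive w (smooth_on_derive v fs)) Ux.
have c2 := smooth_on_continuous (smooth_on_derive v (smooth_on_derive w fs)) Ux.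
have e2 : 0 < e / 2 by rewrite divr_gt0.
pose B := [set y | U y /\ (`|'D_w ('D_v f) x - 'D_w ('D_v f) y| < e / 2 /\
   `|'D_v ('D_w f) x - 'D_v ('D_w f) y| < e / 2)].
have Bx : nbhs x B.
  apply: filterI; first exact: open_nbhs_nbhs.
  apply: filterI.
    by move/cvgrPdist_lt : c1 => /(_ _ e2).
  by move/cvgrPdist_lt : c2 => /(_ _ e2).
have [h h0 hB] := near_small_comb v w Bx.
have UU1 (s t : R) : 0 <= s <= 1 -> 0 <= t <= 1 -> U (s *: (h *: v) + (t *: (h *: w) + x)).
  by move=> s01 t01; case: (hB s t s01 t01).
have UU2 (s t : R) : 0 <= s <= 1 -> 0 <= t <= 1 -> U (s *: (h *: w) + (t *: (h *: v) + x)).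
  by move=> s01 t01; rewrite addrCA; exact: UU1.
have [s1 [t1 [s101 t101 E1]]] := mixed_difference Uo (fs 2) UU1.
have [s2 [t2 [s201 t201 E2]]] := mixed_difference Uo (fs 2) UU2.
have EE : 'D_(h *: w) ('D_(h *: v) f) (s1 *: (h *: v) + (t1 *: (h *: w) + x)) =
          'D_(h *: v) ('D_(h *: w) f) (s2 *: (h *: w) + (t2 *: (h *: v) + x)).
  by rewrite -E1 -E2 [h *: w + (h *: v + x)]addrCA; ring.
have hh : h * h != 0 := mulf_neq0 (lt0r_neq0 h0) (lt0r_neq0 h0).
have B1 := hB _ _ s101 t101.
have B2 := hB _ _ t201 s201.
rewrite addrCA in B2.
rewrite (scale2_derive h v w Uo fs B1.1) (scale2_derive h w v Uo fs B2.1) in EE.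
move/(mulfI hh) : EE => EE.
have [_ [b1 _]] := B1; have [_ [_ b2]] := B2.
rewrite -EE in b2.
exact: dist_half b1 b2.
Qed.

Lemma ge0_of_frequently (c : V -> R) x : {for x, continuous c} ->
  (forall B, nbhs x B -> exists2 y, B y & 0 <= c y) -> 0 <= c x.
Proof.
move=> cc freq; rewrite leNgt; apply/negP => cx.
have cx2 : 0 < - c x by rewrite oppr_gt0.
move/cvgrPdist_lt : cc => /(_ _ cx2) /freq[y /=].
by rewrite ltr_norml => /andP[cy _] c0; lra.
Qed.

(** Replaces a Taylor expansion: on a short segment from a minimum the mean value theorem yields a
    point, as near as desired, where the derivative is nonnegative. The whole segment is kept inside
    [U] and [B] so that a second mean value can be taken between [x] and that point. *)
Lemma local_min_near_ge0 U f x v : open U -> smooth_on U f -> U x ->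
  (\forall y \near x, f x <= f y) ->
  forall B, nbhs x B -> exists2 h : R, 0 < h &
    exists2 t : R, 0 < t < 1 & 0 <= 'D_v f (t *: (h *: v) + x) /\
     (forall s : R, 0 <= s <= 1 -> U (s *: (h *: v) + x) /\ B (s *: (h *: v) + x)).
Proof.
move=> Uo fs Ux xmin B xB.
have : nbhs x [set y | U y /\ (f x <= f y /\ B y)].
  by apply: filterI; [exact: open_nbhs_nbhs|exact: filterI].
move=> /(near_small_comb v v)[h h0 hB]; exists h => //.
have r01 : (0 : R) <= (0 : R) <= (1 : R) by apply/andP; split; [exact: lexx|exact: ler01].
have hB' (s : R) : 0 <= s <= 1 -> U (s *: (h *: v) + x) /\ f x <= f (s *: (h *: v) + x)
    /\ B (s *: (h *: v) + x).
  by move=> s01; have := hB s 0 s01 r01; rewrite scale0r add0r.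
have [|t t01 E] := @line_MVT f x (h *: v).
  by move=> t /hB'[Ut _]; exact: smooth_on_differentiable fs Ut.
exists t => //; split; last by move=> s /hB'[? []].
have t01' : 0 <= t <= 1 by case/andP: t01 => /ltW-> /ltW->.
have [Ut _] := hB' _ t01'.
move: E; rewrite scale_derive; last exact: smooth_on_differentiable fs Ut.
have r11 : (0 : R) <= (1 : R) <= (1 : R) by apply/andP; split; [exact: ler01|exact: lexx].
have [_ []] := hB' _ r11; rewrite scale1r -subr_ge0 => + _ E; rewrite E.
by rewrite pmulr_rge0.
Qed.

Lemma derive_local_min U f x v : open U -> smooth_on U f -> U x ->
  (\forall y \near x, f x <= f y) -> 'D_v f x = 0.
Proof.
move=> Uo fs Ux xmin.
have ge0 w : 0 <= 'D_w f x.
  apply: (@ge0_of_frequently ('D_w f) x).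
    exact: smooth_on_continuous (smooth_on_derive w fs) Ux.
  move=> B /(local_min_near_ge0 w Uo fs Ux xmin)[h h0 [t t01 [fw UB]]].
  exists (t *: (h *: w) + x) => //; apply: (UB t _).2.
  by case/andP: t01 => /ltW-> /ltW->.
apply/le_anti; rewrite ge0 andbT -oppr_ge0.
have -> : - 'D_v f x = 'D_((-1) *: v) f x; last exact: ge0.
by rewrite scale_derive ?mulN1r //; exact: smooth_on_differentiable fs Ux.
Qed.

(** ['D_v f] vanishes at [x] and is nonnegative at a nearby point of the ray, so its own mean value
    gives a point between them with nonnegative second derivative; continuity passes this to [x]. *)
Lemma derive2_local_min U f x v : open U -> smooth_on U f -> U x ->
  (\forall y \near x, f x <= f y) -> 0 <= 'D_v ('D_v f) x.
Proof.
move=> Uo fs Ux xmin.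
apply: (@ge0_of_frequently ('D_v ('D_v f)) x).
  exact: smooth_on_continuous (smooth_on_derive v (smooth_on_derive v fs)) Ux.
move=> B /(local_min_near_ge0 v Uo fs Ux xmin)[h h0 [t /andP[t0 t1] [fw UB]]].
have UB' (s : R) : 0 <= s <= 1 -> U (s *: ((t * h) *: v) + x) /\ B (s *: ((t * h) *: v) + x).
  move=> /andP[s0 s1]; have := UB (s * t); rewrite -!scalerA; apply.
  by rewrite mulr_ge0 ?(ltW t0) //= mulr_ile1 // ltW.
have fvs := smooth_on_derive v fs.
have [|s /andP[s0 s1] E] := @line_MVT ('D_v f) x ((t * h) *: v).
  by move=> s /UB'[Us _]; exact: smooth_on_differentiable fvs Us.
have s01 : 0 <= s <= 1 by rewrite !ltW.
have [Us Bs] := UB' _ s01.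
exists (s *: ((t * h) *: v) + x) => //.
move: E; rewrite scale_derive; last exact: smooth_on_differentiable fvs Us.
rewrite (derive_local_min v Uo fs Ux xmin) subr0 -scalerA => E.
by move: fw; rewrite E scalerA pmulr_rge0 // mulr_gt0.
Qed.

End Lines.

(** * Linear algebra *)

Lemma continuous_at_sum (T : topologicalType) (R : realType) (I : Type) (r : seq I)
    (F : I -> T -> R) (x : T) : (forall i, {for x, continuous (F i)}) ->
  {for x, continuous (fun y => \sum_(i <- r) F i y)}.
Proof.
move=> Fc; elim: r => [|i r IH].
  rewrite (_ : (fun y => _) = cst 0); first exact: cst_continuous.
  by apply/funext => y; rewrite big_nil.
rewrite (_ : (fun y => _) = (fun y => F i y + \sum_(i <- r) F i y)).
  by apply: continuousD.
by apply/funext => y; rewrite big_cons.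
Qed.

(** * The Euclidean inner product *)

Section DotProduct.
Variables (R : realType).

Lemma dotvE n (u v : 'rV[R]_n) : dotv u v = \sum_i u 0 i * v 0 i.
Proof. by []. Qed.

Lemma dotv_mx n (u v : 'rV[R]_n) : dotv u v = (u *m v^T) 0 0.
Proof. by rewrite !mxE; apply: eq_bigr => i _; rewrite !mxE. Qed.

Lemma dotvC n (u v : 'rV[R]_n) : dotv u v = dotv v u.
Proof. by apply: eq_bigr => i _; rewrite mulrC. Qed.

Lemma dotvDl n (u v w : 'rV[R]_n) : dotv (u + v) w = dotv u w + dotv v w.
Proof. by rewrite !dotv_mx mulmxDl mxE. Qed.

Lemma dotvZl n a (u w : 'rV[R]_n) : dotv (a *: u) w = a * dotv u w.
Proof. by rewrite !dotv_mx -scalemxAl mxE. Qed.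

Lemma dotvNl n (u w : 'rV[R]_n) : dotv (- u) w = - dotv u w.
Proof. by rewrite !dotv_mx mulNmx mxE. Qed.

Lemma dotvBl n (u v w : 'rV[R]_n) : dotv (u - v) w = dotv u w - dotv v w.
Proof. by rewrite dotvDl dotvNl. Qed.

Lemma dotv0l n (w : 'rV[R]_n) : dotv 0 w = 0.
Proof. by rewrite dotv_mx mul0mx mxE. Qed.

Lemma dotvDr n (u v w : 'rV[R]_n) : dotv w (u + v) = dotv w u + dotv w v.
Proof. by rewrite !(dotvC w) dotvDl. Qed.

Lemma dotvZr n a (u w : 'rV[R]_n) : dotv w (a *: u) = a * dotv w u.
Proof. by rewrite !(dotvC w) dotvZl. Qed.

Lemma dotvNr n (u w : 'rV[R]_n) : dotv w (- u) = - dotv w u.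
Proof. by rewrite !(dotvC w) dotvNl. Qed.

Lemma dotvBr n (u v w : 'rV[R]_n) : dotv w (u - v) = dotv w u - dotv w v.
Proof. by rewrite dotvDr dotvNr. Qed.

Lemma dotv0r n (w : 'rV[R]_n) : dotv w 0 = 0.
Proof. by rewrite dotvC dotv0l. Qed.

Lemma dotv_suml n (I : finType) (F : I -> 'rV[R]_n) w :
  dotv (\sum_i F i) w = \sum_i dotv (F i) w.
Proof. by rewrite dotv_mx mulmx_suml summxE; apply: eq_bigr => i _; rewrite dotv_mx. Qed.

Lemma dotvv_ge0 n (u : 'rV[R]_n) : 0 <= dotv u u.
Proof. by apply: sumr_ge0 => i _; rewrite -expr2 sqr_ge0. Qed.

Lemma dotvv_eq0 n (u : 'rV[R]_n) : (dotv u u == 0) = (u == 0).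
Proof.
apply/idP/eqP => [|->]; last by rewrite dotv0l.
rewrite psumr_eq0 => [/allP u0|i _]; last by rewrite -expr2 sqr_ge0.
apply/rowP => i; rewrite mxE; have := u0 i (mem_index_enum _).
by rewrite -expr2 sqrf_eq0 => /eqP.
Qed.

Lemma dotvv_gt0 n (u : 'rV[R]_n) : u != 0 -> 0 < dotv u u.
Proof. by move=> u0; rewrite lt_neqAle dotvv_ge0 eq_sym dotvv_eq0 u0. Qed.

Lemma cauchy_schwarz n (u v : 'rV[R]_n) :
  dotv u v * dotv u v <= dotv u u * dotv v v.
Proof.
have [->|v0] := eqVneq v 0; first by rewrite !dotv0r !mulr0.
have vv := dotvv_gt0 v0.
have := dotvv_ge0 (dotv v v *: u - dotv u v *: v).
rewrite !(dotvBl, dotvBr, dotvZl, dotvZr) (dotvC v u) => H.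
rewrite -subr_ge0 -(pmulr_rge0 _ vv); nra.
Qed.

Lemma dotv_basis n (u : 'rV[R]_n) i : dotv u (basis_vec R i) = u 0 i.
Proof.
rewrite /dotv (bigD1 i) //= big1 ?addr0 ?mxE ?eqxx ?mulr1 // => j ji.
by rewrite mxE (negbTE ji) andbF mulr0.
Qed.

Lemma rV_basis n (u : 'rV[R]_n) : u = \sum_i u 0 i *: basis_vec R i.
Proof. by rewrite [LHS]row_sum_delta. Qed.

Lemma dotv_mulmxl m n (u : 'rV[R]_m) (A : 'M[R]_(m, n)) (w : 'rV[R]_n) :
  dotv (u *m A) w = dotv u (w *m A^T).
Proof. by rewrite !dotv_mx trmx_mul trmxK mulmxA. Qed.

End DotProduct.

(** * Spectral theorem for symmetric matrices *)

Section Spectral.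
Variable R : realType.

(** With [w = v *m B], the form at [v + t *: w] is [2 t |w|^2 + t^2 <w B, w>], which would be
    negative for small negative [t] if [w] were nonzero. *)
Lemma semidefinite_kernel n (B : 'M[R]_n) (v : 'rV[R]_n) : B^T = B ->
  (forall w : 'rV[R]_n, 0 <= dotv (w *m B) w) -> dotv (v *m B) v = 0 -> v *m B = 0.
Proof.
move=> Bs B0 vB; apply/eqP; rewrite -dotvv_eq0; apply/eqP.
set w := v *m B.
have Q t : 0 <= 2 * t * dotv w w + t * t * dotv (w *m B) w.
  have := B0 (v + t *: w).
  rewrite mulmxDl -scalemxAl !(dotvDl, dotvDr, dotvZl, dotvZr) vB -/w.
  have -> : dotv (w *m B) v = dotv w w by rewrite dotv_mulmxl Bs.
  by move=> h; apply: le_trans h _; rewrite le_eqVlt; apply/orP; left; apply/eqP; ring.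
have ww := dotvv_ge0 w.
have c0 := B0 w; set c := dotv (w *m B) w in Q c0.
apply/eqP; rewrite eq_le ww andbT leNgt; apply/negP => ww0.
have c1 : 0 < c + 1 by rewrite ltr_wpDl.
(* With [k = |w|^2 / (c + 1)] the value of the form at [t = -k] is [-k^2 (c + 2)]; the [+ 1] keeps
   the denominator positive when [c = 0]. *)
have := Q (- (dotv w w / (c + 1))).
set k := dotv w w / (c + 1).
have kE : dotv w w = k * (c + 1) by rewrite /k divfK // gt_eqF.
rewrite kE; nra.
Qed.

Lemma dotv_sqr_continuous n : continuous (fun v : 'rV[R]_n => dotv v v : R).
Proof.
move=> v; rewrite /dotv; apply: continuous_at_sum => i.
by apply: continuousM; exact: coord_continuous.
Qed.

Lemma dotv_le1_norm n (v : 'rV[R]_n) : dotv v v <= 1 -> `|v| <= 1.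
Proof.
move=> v1; rewrite [leLHS]/Num.norm /= mx_normrE.
apply: bigmax_le => // -[i j] _ /=; rewrite (ord1 i).
have h : v 0 j * v 0 j <= 1.
  apply: le_trans v1; rewrite [leRHS](bigD1 j) //= lerDl; apply: sumr_ge0 => l _.
  by rewrite -expr2 sqr_ge0.
by rewrite -(expr_le1 (n := 2)) // expr2 -normrM ger0_norm // -expr2 sqr_ge0.
Qed.

Lemma unit_sphere_compact n : compact [set v : 'rV[R]_n | dotv v v = 1].
Proof.
apply: bounded_closed_compact.
  exists 1; split => // M M1 v /= v1.
  by apply: le_trans (ltW M1); apply: dotv_le1_norm; rewrite v1.
have -> : [set v : 'rV[R]_n | dotv v v = 1] = (fun v => dotv v v) @^-1` [set 1] by [].
by apply: closed_comp => [v _|]; [exact: dotv_sqr_continuous|exact: closed_eq].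
Qed.

Lemma dotv_quad_continuous n (A : 'M[R]_n) : continuous (fun v : 'rV[R]_n => dotv (v *m A) v).
Proof.
move=> v; rewrite /dotv; apply: continuous_at_sum => i.
apply: continuousM; last exact: coord_continuous.
rewrite (_ : (fun x => _) = (fun x : 'rV[R]_n => \sum_j x 0 j * A j i)); last by apply/funext => x; rewrite mxE.
apply: continuous_at_sum => j; apply: continuousM; first exact: coord_continuous.
exact: cst_continuous.
Qed.

(** The Rayleigh quotient attains its maximum [l] on the compact unit sphere. Then [l - A] is
    semidefinite and its form vanishes at the maximizer, which therefore lies in its kernel. *)
Lemma symmetric_eigenvector n (A : 'M[R]_n.+1) : A^T = A ->
  exists (v : 'rV[R]_n.+1) (l : R), dotv v v = 1 /\ v *m A = l *: v.
Proof.
move=> As.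
have [] := @EVT_max_rV R n.+1 (fun v => dotv (v *m A) v) [set v | dotv v v = 1] _ _ _.
- exists (basis_vec R ord0) => /=; by rewrite dotv_basis mxE !eqxx.
- exact: unit_sphere_compact.
- by apply: continuous_subspaceT; exact: dotv_quad_continuous.
move=> v v1 vmax; exists v, (dotv (v *m A) v).
have vv : dotv v v = 1 by rewrite inE in v1.
split=> //; set l := dotv (v *m A) v.
have Bw (w : 'rV[R]_n.+1) : w *m (l%:M - A) = l *: w - w *m A.
  by rewrite mulmxBr mul_mx_scalar.
have : v *m (l%:M - A) = 0.
  apply: semidefinite_kernel.
  - by rewrite linearB /= tr_scalar_mx As.
  - move=> w; rewrite Bw dotvBl dotvZl.
    have [->|w0] := eqVneq w 0; first by rewrite mul0mx !dotv0l mulr0 subrr.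
    have ww := dotvv_gt0 w0.
    pose c := (Num.sqrt (dotv w w))^-1.
    have cc : c * c * dotv w w = 1.
      rewrite -expr2 exprVn sqr_sqrtr ?ltW // mulVf //; exact: lt0r_neq0.
    have := vmax (c *: w); rewrite inE /= dotvZl dotvZr mulrA cc => /(_ erefl).
    rewrite -scalemxAl dotvZl dotvZr -/l => le_l.
    have : c * c * dotv (w *m A) w <= c * c * (l * dotv w w).
      by rewrite -mulrA (le_trans le_l) // mulrCA cc mulr1.
    rewrite subr_ge0 ler_pM2l //.
    have c0 : 0 < c by rewrite invr_gt0 sqrtr_gt0.
    exact: mulr_gt0.
  - by rewrite Bw dotvBl dotvZl vv mulr1 subrr.
by rewrite Bw => /eqP; rewrite subr_eq0 => /eqP.
Qed.

(** The reflection in the hyperplane orthogonal to [v - e] exchanges the unit vectors [e] and [v];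
    it is a symmetric involution, so it is orthogonal. It degenerates only for [v = e], where the
    identity serves. *)
Lemma householder n (v : 'rV[R]_n.+1) : dotv v v = 1 ->
  exists Q : 'M[R]_n.+1, Q *m Q^T = 1%:M /\ row 0 Q = v.
Proof.
move=> vv; set e : 'rV[R]_n.+1 := basis_vec R 0.
have ee : dotv e e = 1 by rewrite dotv_basis mxE !eqxx.
have [->|v0] := eqVneq v e.
  exists 1%:M; rewrite mul1mx tr_scalar_mx; split => //.
  by rewrite rowE mulmx1.
set k := v - e.
have k0 : k != 0 by rewrite subr_eq0.
have kk0 := dotvv_gt0 k0.
have kk : dotv k k = 2 - 2 * dotv v e.
  by rewrite /k !(dotvBl, dotvBr) vv ee (dotvC e v); ring.
have ek : dotv e k = dotv v e - 1 by rewrite /k dotvBr ee dotvC.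
pose c := 2 / dotv k k.
have ck : c * dotv k k = 2 by rewrite /c divfK // gt_eqF.
pose Q : 'M[R]_n.+1 := 1%:M - c *: (k^T *m k).
have Qt : Q^T = Q by rewrite /Q linearB /= tr_scalar_mx linearZ /= trmx_mul trmxK.
exists Q; rewrite Qt; split.
  rewrite /Q mulmxBr mulmx1 mulmxBl mul1mx -scalemxAl -scalemxAr.
  rewrite mulmxA -[k^T *m k *m k^T]mulmxA.
  have -> : k *m k^T = (dotv k k)%:M by rewrite [LHS]mx11_scalar dotv_mx.
  rewrite mul_mx_scalar -scalemxAl !scalerA.
  apply/matrixP => i j; rewrite !mxE.
  by rewrite ck; ring.
have wQ (w : 'rV[R]_n.+1) : w *m Q = w - (c * dotv w k) *: k.
  rewrite /Q mulmxBr mulmx1 -scalemxAr mulmxA.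
  by rewrite [w *m k^T]mx11_scalar -dotv_mx mul_scalar_mx scalerA.
rewrite rowE -[delta_mx 0 0]/e wQ ek.
have -> : c * (dotv v e - 1) = -1.
  apply: (mulIf (lt0r_neq0 kk0)); rewrite mulrAC ck kk; ring.
by rewrite scaleN1r opprK /k addrCA subrr addr0.
Qed.

(** In an orthogonal basis starting with an eigenvector the first row is a multiple of the first
    basis vector, and by symmetry so is the first column; the induction applies to the remaining
    block. *)
Lemma symmetric_diagonalization n (A : 'M[R]_n) : A^T = A ->
  exists (Q : 'M[R]_n) (d : 'rV[R]_n), Q *m Q^T = 1%:M /\ Q *m A *m Q^T = diag_mx d.
Proof.
elim: n A => [|n IH] A As.
  by exists 1%:M, 0; split; apply/matrixP => -[].
have [v [l [vv vA]]] := symmetric_eigenvector As.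
have [Q [QQ Qv]] := householder vv.
have [B BQ] : exists B, B = Q *m A *m Q^T by eexists.
have Bs : B^T = B by rewrite BQ !trmx_mul trmxK As mulmxA.
have B0 : row 0 B = l *: delta_mx 0 0.
  by rewrite BQ !row_mul Qv vA -scalemxAl -Qv -row_mul QQ rowE mulmx1.
have B0j j : B 0 j = l * (j == 0)%:R.
  by have := congr1 (fun r : 'rV[R]_n.+1 => r 0 j) B0; rewrite !mxE eqxx.
have Bi0 i : B i 0 = l * (i == 0)%:R by rewrite -B0j -[in LHS]Bs mxE.
pose D : 'M[R]_n := \matrix_(i, j) B (lift 0 i) (lift 0 j).
have Ds : D^T = D by apply/matrixP => i j; rewrite !mxE -[in LHS]Bs mxE.
have [P [d [PP PA]]] := IH D Ds.
pose P1 : 'M[R]_(1 + n) := block_mx 1%:M 0 0 P.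
have BE : (B : 'M[R]_(1 + n)) = block_mx (l%:M) 0 0 D.
  apply/matrixP => i j; rewrite !mxE; case: (split_ordP i) => i' ->; rewrite ?mxE;
  case: (split_ordP j) => j' ->; rewrite !mxE.
  - rewrite (ord1 i') (ord1 j') !eqxx.
    by rewrite (_ : lshift n 0 = 0) ?B0j ?eqxx ?mulr1 //; exact: val_inj.
  - rewrite (_ : lshift n i' = 0) ?B0j; last by rewrite (ord1 i'); exact: val_inj.
    by rewrite (_ : rshift 1 j' == 0 = false) ?mulr0.
  - rewrite (_ : lshift n j' = 0) ?Bi0; last by rewrite (ord1 j'); exact: val_inj.
    by rewrite (_ : rshift 1 i' == 0 = false) ?mulr0.
  - by rewrite !rshift1.
exists ((P1 : 'M[R]_n.+1) *m Q), (row_mx l%:M d : 'rV[R]_(1 + n)).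
have PPT : P1 *m P1^T = 1%:M.
  rewrite /P1 tr_block_mx !trmx0 tr_scalar_mx mulmx_block.
  by rewrite !mulmx0 !mul0mx mulmx1 !add0r !addr0 PP -scalar_mx_block.
have PBP : P1 *m (B : 'M[R]_(1 + n)) *m P1^T = diag_mx (row_mx l%:M d).
  rewrite BE /P1 tr_block_mx !trmx0 tr_scalar_mx !mulmx_block.
  rewrite !mulmx0 !mul0mx !mulmx1 !mul1mx !add0r !addr0 PA diag_mx_row.
  congr block_mx; last exact: mul0mx.
  by apply/matrixP => i j; rewrite !mxE !ord1 !mulr1n.
split.
  by rewrite trmx_mul mulmxA -[_ *m Q *m Q^T]mulmxA QQ mulmx1.
rewrite trmx_mul !mulmxA -[(P1 : 'M[R]_n.+1) *m Q *m A]mulmxA -[_ *m (Q *m A) *m Q^T]mulmxA -BQ.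
exact: PBP.
Qed.

(** Rescaling an eigenbasis of [g] turns [g] into the identity, and an orthogonal change of basis
    then diagonalizes [h]. For the two fundamental forms the rows of [L] are orthonormal principal
    directions and [d] lists the principal curvatures. *)
Lemma simultaneous_diagonalization n (g h : 'M[R]_n) : g^T = g -> h^T = h ->
  pos_def g -> exists (L : 'M[R]_n) (d : 'rV[R]_n),
    L *m g *m L^T = 1%:M /\ L *m h *m L^T = diag_mx d.
Proof.
move=> gs hs gp.
have [Q [d [QQ Qg]]] := symmetric_diagonalization gs.
have d0 i : 0 < d 0 i.
  have -> : d 0 i = (row i Q *m g *m (row i Q)^T) 0 0.
    rewrite -row_mul.
    have := congr1 (fun M : 'M[R]_n => M i i) Qg; rewrite !mxE eqxx mulr1n => <-.
    by apply: eq_bigr => j _; rewrite !mxE.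
  apply: gp; apply/eqP => r0; have := congr1 (fun M : 'M[R]_n => M i i) QQ.
  rewrite !mxE eqxx; under eq_bigr => j _.
    have := congr1 (fun r : 'rV[R]_n => r 0 j) r0; rewrite !mxE => ->.
    rewrite mul0r; over.
  by rewrite sumr_const mul0rn => /eqP; rewrite eq_sym oner_eq0.
pose s : 'rV[R]_n := \row_i (Num.sqrt (d 0 i))^-1.
pose S := diag_mx s *m Q.
have Sg : S *m g *m S^T = 1%:M.
  rewrite /S trmx_mul tr_diag_mx !mulmxA -[_ *m Q *m g]mulmxA -[_ *m (Q *m g) *m _]mulmxA Qg.
  rewrite !mulmx_diag; apply/matrixP => i j; rewrite !mxE; congr (_ *+ _).
  by rewrite mulrAC -expr2 exprVn sqr_sqrtr ?ltW // mulVf // gt_eqF.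
clearbody S.
have h's : (S *m h *m S^T)^T = S *m h *m S^T by rewrite !trmx_mul trmxK hs mulmxA.
have [P [l [PP Ph]]] := symmetric_diagonalization h's.
exists (P *m S), l; split.
  by rewrite trmx_mul !mulmxA -[P *m S *m g]mulmxA -[_ *m (S *m g) *m _]mulmxA Sg mulmx1.
by rewrite trmx_mul !mulmxA -[P *m S *m h]mulmxA -[_ *m (S *m h) *m _]mulmxA.
Qed.

End Spectral.

(** * Determinant identities and the derivative of a determinant *)

Section Determinants.
Variable R : realType.

(** The block matrices [M *m N] and [N *m M] have the same determinant; both are block lower
    triangular, one showing the left side and the other the right side. *)
Lemma det_1_plus_outer n (u : 'rV[R]_n) : \det (1%:M + u^T *m u) = 1 + dotv u u.
Proof.
pose M := block_mx (1%:M : 'M[R]_1) (- u) u^T (1%:M : 'M[R]_n).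
pose N := block_mx (1%:M : 'M[R]_1) u 0 (1%:M : 'M[R]_n).
have detN : \det N = 1 by rewrite /N det_ublock !det1 mulr1.
have MN : M *m N = block_mx 1%:M 0 u^T (1%:M + u^T *m u).
  by rewrite /M /N mulmx_block !mulmx0 !mulmx1 !mul1mx !addr0 subrr addrC.
have NM : N *m M = block_mx (1%:M + u *m u^T) 0 u^T 1%:M.
  by rewrite /M /N mulmx_block !mul0mx !mulmx1 !mul1mx !add0r addNr.
have := congr1 (fun B => \det B) MN; rewrite det_mulmx detN mulr1 det_lblock det1 mul1r => <-.
have := congr1 (fun B => \det B) NM; rewrite det_mulmx detN mul1r det_lblock det1 mulr1 => ->.
by rewrite [_ + _]mx11_scalar det_scalar1 !mxE eqxx; congr (_ + _); apply: eq_bigr => i _; rewrite !mxE.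
Qed.

Lemma smooth_deriv_prod (V : normedModType R) (I : eqType) (r : seq I) (U : set V)
    (F : I -> V -> R) (x v : V) : open U -> (forall i, smooth_on U (F i)) -> U x -> uniq r ->
  'D_v (fun y => \prod_(i <- r) F i y) x =
  \sum_(k <- r) 'D_v (F k) x * \prod_(i <- r | i != k) F i x.
Proof.
move=> Uo Fs Ux; elim: r => [|i r IH] /=.
  move=> _; rewrite big_nil (_ : (fun y => _) = cst 1) ?derive_cst //.
  by apply/funext => y; rewrite big_nil.
move=> /andP[ir ur].
rewrite (_ : (fun y => _) = (fun y => F i y * \prod_(i <- r) F i y)); last first.
  by apply/funext => y; rewrite big_cons.
rewrite (smooth_derivM v (Fs i) (smooth_on_prod r xpredT Uo Fs) Ux) IH //.
rewrite !big_cons eqxx /=; congr (_ * _ + _).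
  rewrite big_seq [RHS]big_seq_cond; apply: eq_bigl => j.
  by case: eqVneq => [->|]; rewrite ?(negbTE ir) ?andbT.
rewrite mulr_sumr [LHS]big_seq [RHS]big_seq; apply: eq_bigr => k kr.
rewrite big_cons.
have -> : i != k by apply: contraNneq ir => ->.
by rewrite mulrCA.
Qed.

Lemma smooth_deriv_sum (V : normedModType R) (I : Type) (r : seq I) (U : set V)
    (F : I -> V -> R) (x v : V) : open U -> (forall i, smooth_on U (F i)) -> U x ->
  'D_v (fun y => \sum_(i <- r) F i y) x = \sum_(k <- r) 'D_v (F k) x.
Proof.
move=> Uo Fs Ux; elim: r => [|i r IH] /=.
  rewrite big_nil (_ : (fun y => _) = cst 0) ?derive_cst //.
  by apply/funext => y; rewrite big_nil.
rewrite (_ : (fun y => _) = (fun y => F i y + \sum_(i <- r) F i y)); last first.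
  by apply/funext => y; rewrite big_cons.
by rewrite (smooth_derivD v (Fs i) (smooth_on_sum r xpredT Uo Fs) Ux) IH // big_cons.
Qed.

Lemma derive_det (V : normedModType R) n (U : set V) (A : V -> 'M[R]_n) (x v : V) :
  open U -> (forall i j, smooth_on U (fun y => A y i j)) -> U x ->
  'D_v (fun y => \det (A y)) x =
  \sum_i \sum_j 'D_v (fun y => A y i j) x * cofactor (A x) i j.
Proof.
move=> Uo As Ux; rewrite /determinant.
rewrite (smooth_deriv_sum _ _ Uo) //; last first.
  by move=> s; apply: smooth_onM => //; [exact: smooth_on_cst|exact: smooth_on_prod].
(* Only row [k] is differentiated. The product rule makes the derivative the sum of the
   [\det (B k)], and along row [k] the cofactors of [B k] are those of [A x]. *)
pose B (k : 'I_n) : 'M[R]_n := \matrix_(i, j) if i == k then 'D_v (fun y => A y i j) x else A x i j.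
transitivity (\sum_k \det (B k)).
  rewrite exchange_big /=; apply: eq_bigr => s _.
  rewrite (smooth_derivM _ (smooth_on_cst _ Uo) (smooth_on_prod _ _ Uo _) Ux) //.
  rewrite derive_cst mul0r add0r (smooth_deriv_prod _ Uo) ?index_enum_uniq //.
  rewrite mulr_sumr; apply: eq_bigr => k _; congr (_ * _).
  rewrite [RHS](bigD1 k) //= !mxE eqxx; congr (_ * _).
  by apply: eq_bigr => i ik; rewrite !mxE (negbTE ik).
apply: eq_bigr => k _; rewrite (expand_det_row _ k); apply: eq_bigr => j _.
rewrite !mxE eqxx; congr (_ * _); rewrite /cofactor; congr (_ * \det _).
by apply/matrixP => a b; rewrite !mxE eq_sym (negbTE (neq_lift _ _)).
Qed.

Lemma derive_det_inv (V : normedModType R) n (U : set V) (A : V -> 'M[R]_n) (x v : V) :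
  open U -> (forall i j, smooth_on U (fun y => A y i j)) -> U x -> \det (A x) != 0 ->
  'D_v (fun y => \det (A y)) x =
  \det (A x) * \sum_i \sum_j invmx (A x) j i * 'D_v (fun y => A y i j) x.
Proof.
move=> Uo As Ux A0; rewrite (derive_det _ Uo As Ux) mulr_sumr.
apply: eq_bigr => i _; rewrite mulr_sumr; apply: eq_bigr => j _.
have -> : invmx (A x) j i = (\det (A x))^-1 * cofactor (A x) i j.
  by rewrite /invmx unitmxE unitfE A0 !mxE.
by rewrite [RHS]mulrA [X in _ = X * _]mulrA mulfV // mul1r mulrC.
Qed.

End Determinants.

(** * The Gauss curvature as a quotient of determinants *)

Section Curvature.
Variable R : realType.

Lemma prod_XsubC_det n (A : 'M[R]_n) (s : seq R) :
  char_poly A = \prod_(k <- s) ('X - k%:P) -> \prod_(k <- s) k = \det A.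
Proof.
move=> As.
have ss : size s = n.
  have := congr1 (fun p : {poly R} => size p) As.
  by rewrite size_char_poly size_prod_XsubC => -[].
have := char_poly_det A; rewrite As coef0_prod_XsubC ss.
by move/mulfI; apply; rewrite signr_eq0.
Qed.

Lemma char_poly_conj n (P A : 'M[R]_n) : P \in unitmx ->
  char_poly (invmx P *m A *m P) = char_poly A.
Proof.
move=> Pu; rewrite /char_poly /char_poly_mx.
have -> : 'X%:M - map_mx polyC (invmx P *m A *m P) =
    map_mx polyC (invmx P) *m ('X%:M - map_mx polyC A) *m map_mx polyC P.
  rewrite mulmxBr mulmxBl scalar_mxC -['X%:M *m _ *m _]mulmxA.
  by rewrite -!map_mxM mulVmx // map_mx1 mulmx1.
by rewrite !det_mulmx mulrAC -det_mulmx -map_mxM mulVmx // map_mx1 det1 mul1r.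
Qed.

Lemma char_poly_diag n (d : 'rV[R]_n) : char_poly (diag_mx d) = \prod_i ('X - (d 0 i)%:P).
Proof.
rewrite /char_poly (_ : char_poly_mx _ = diag_mx (\row_i ('X - (d 0 i)%:P))).
  by rewrite det_diag; apply: eq_bigr => i _; rewrite mxE.
apply/matrixP => i j; rewrite !mxE; case: eqVneq => [->|ij] /=; first by rewrite !mulr1n.
by rewrite !mulr0n subr0.
Qed.

(** The list picked by [xget] is irrelevant: any list of roots has the determinant of the shape
    operator as product. What needs proof is that some list exists, so that the default [[::]] is
    not taken; the shape operator is conjugate to [diag_mx d]. *)
Lemma gauss_curvatureE n m (M : closed_manifold R n) (F nu : M -> 'rV[R]_m)
    (c : chart R n M) (p : M) :
  let g := first_fundamental_form F c p in let h := second_fundamental_form F nu c p in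
  g^T = g -> h^T = h -> pos_def g -> gauss_curvature F nu c p = \det h / \det g.
Proof.
move=> g h gs hs gp.
have [L [d [Lg Lh]]] := simultaneous_diagonalization gs hs gp.
have Lu : L \in unitmx.
  by case/mulmx1_unit: (etrans (mulmxA _ _ _) Lg).
have LTu : L^T \in unitmx by rewrite unitmx_tr.
have gi : invmx g = L^T *m L.
  have gE : g = invmx L *m invmx L^T.
    have Lgi : L *m g = invmx L^T by rewrite -[LHS](mulmxK LTu) Lg mul1mx.
    by rewrite -Lgi mulKmx.
  have : (L^T *m L) *m g = 1%:M.
    by rewrite gE !mulmxA mulmxK // mulmxV.
  move=> E; have gu : g \in unitmx by case/mulmx1_unit: E.
  by rewrite -[LHS]mul1mx -E mulmxK.
have hE : shape_operator F nu c p = invmx L *m diag_mx d *m L.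
  rewrite /shape_operator -/g -/h gi -Lh !mulmxA mulVmx // mul1mx.
  by [].
have ex : exists s : seq R, char_poly (shape_operator F nu c p) = \prod_(k <- s) ('X - k%:P).
  exists [seq d 0 i | i <- index_enum 'I_n]; rewrite big_map.
  by rewrite hE char_poly_conj // char_poly_diag.
have := xgetPex [::] ex; rewrite -/(principal_curvatures F nu c p) => /= /prod_XsubC_det.
rewrite /gauss_curvature => ->.
by rewrite /shape_operator det_mulmx det_inv.
Qed.

Lemma pos_def_det n (A : 'M[R]_n) : A^T = A -> pos_def A -> 0 < \det A.
Proof.
move=> As Ap; have [L [d [LA _]]] := simultaneous_diagonalization As As Ap.
have := congr1 (fun B : 'M[R]_n => \det B) LA; rewrite !det_mulmx det_tr det1 => E.
have L0 : \det L != 0.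
  by apply/eqP => L0; move: E; rewrite L0 !mul0r => /eqP; rewrite eq_sym oner_eq0.
rewrite -(pmulr_rgt0 _ (_ : 0 < \det L * \det L)) -?expr2 ?exprn_even_gt0 //.
by rewrite expr2 mulrAC E.
Qed.

End Curvature.

(** * Gnomonic coordinates and the touching argument *)

Section Partial.
Variables (R : realType) (n : nat).
Local Notation V := 'rV[R]_n.
Implicit Types (f g : V -> R) (x : V).

Lemma derive_basis f x v : differentiable f x ->
  'D_v f x = \sum_a v 0 a * 'D_(basis_vec R a) f x.
Proof.
move=> fd; rewrite deriveE // [v in LHS]rV_basis linear_sum /=.
by apply: eq_bigr => a _; rewrite linearZ deriveE.
Qed.

(** In the application [G] is the inverse Jacobian of the gnomonic coordinates, so this is the
    partial derivative with respect to the [i]-th of them. Working in the original chart avoids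
    inverting the Gauss map. *)
Definition frame_deriv (G : V -> 'M[R]_n) (i : 'I_n) f : V -> R :=
  fun x => \sum_a G x i a * 'D_(basis_vec R a) f x.

Section FrameCalculus.
Variables (W : set V) (G : V -> 'M[R]_n).
Hypotheses (Wo : open W) (Gs : forall i j, smooth_on W (fun x => G x i j)).
Local Notation D := (frame_deriv G).

Lemma frame_derivE i f x : smooth_on W f -> W x -> D i f x = 'D_(row i (G x)) f x.
Proof.
move=> fs Wx; rewrite derive_basis; last exact: smooth_on_differentiable fs Wx.
by apply: eq_bigr => a _; rewrite !mxE.
Qed.

Lemma frame_deriv_smooth i f : smooth_on W f -> smooth_on W (D i f).
Proof.
move=> fs; apply: smooth_on_sum => // a; apply: smooth_onM => //.
exact: smooth_on_derive.
Qed.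

Lemma frame_deriv_eq i f g x : (forall y, W y -> f y = g y) -> W x -> D i f x = D i g x.
Proof.
move=> fg Wx; apply: eq_bigr => a _; congr (_ * _).
exact: open_eq_derive Wo fg Wx.
Qed.

Lemma frame_deriv_cst i (c : R) x : D i (fun=> c) x = 0.
Proof. by rewrite /frame_deriv big1 // => a _; rewrite derive_cst mulr0. Qed.

Lemma frame_derivD i f g x : smooth_on W f -> smooth_on W g -> W x ->
  D i (fun y => f y + g y) x = D i f x + D i g x.
Proof.
move=> fs gs Wx; rewrite /frame_deriv -big_split /=; apply: eq_bigr => a _.
by rewrite (smooth_derivD _ fs gs Wx) mulrDr.
Qed.

Lemma frame_derivM i f g x : smooth_on W f -> smooth_on W g -> W x ->
  D i (fun y => f y * g y) x = D i f x * g x + f x * D i g x.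
Proof.
move=> fs gs Wx; rewrite /frame_deriv mulr_suml mulr_sumr -big_split /=.
apply: eq_bigr => a _; rewrite (smooth_derivM _ fs gs Wx); ring.
Qed.

Lemma frame_deriv_sum i (I : Type) (r : seq I) (F : I -> V -> R) x :
  (forall k, smooth_on W (F k)) -> W x ->
  D i (fun y => \sum_(k <- r) F k y) x = \sum_(k <- r) D i (F k) x.
Proof.
move=> Fs Wx; rewrite /frame_deriv exchange_big /=; apply: eq_bigr => a _.
by rewrite (smooth_deriv_sum _ _ Wo Fs Wx) mulr_sumr.
Qed.

Lemma frame_deriv2E i j f x : smooth_on W f -> W x ->
  D i (D j f) x = \sum_b D i (fun y => G y j b) x * 'D_(basis_vec R b) f x +
    \sum_a \sum_b G x i a * G x j b * 'D_(basis_vec R a) ('D_(basis_vec R b) f) x.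
Proof.
move=> fs Wx.
have fbs b : smooth_on W ('D_(basis_vec R b) f) by exact: smooth_on_derive.
rewrite [LHS](frame_deriv_sum _ _ (fun b => smooth_onM Wo (Gs j b) (fbs b)) Wx).
under eq_bigr => b _ do rewrite (frame_derivM _ (Gs j b) (fbs b) Wx).
rewrite big_split /= exchange_big /=; congr (_ + _); apply: eq_bigr => b _.
by rewrite /frame_deriv mulr_sumr; apply: eq_bigr => a _; ring.
Qed.

(** The derivatives of the coefficients [G] multiply first derivatives of [f], which vanish at the
    minimum; what is left is the pure second derivative along the row [i] of [G x]. *)
Lemma frame_deriv2_local_min i f x : smooth_on W f -> W x ->
  (\forall y \near x, f x <= f y) -> D i f x = 0 /\ 0 <= D i (D i f) x.
Proof.
move=> fs Wx xmin.
have f0 v : 'D_v f x = 0 by exact: derive_local_min Wo fs Wx xmin.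
split; first by rewrite /frame_deriv big1 // => a _; rewrite f0 mulr0.
rewrite frame_deriv2E // big1 ?add0r; last by move=> b _; rewrite f0 mulr0.
have := derive2_local_min (row i (G x)) Wo fs Wx xmin.
have fbs b : smooth_on W ('D_(basis_vec R b) f) by exact: smooth_on_derive.
have E y : W y -> 'D_(row i (G x)) f y = \sum_b row i (G x) 0 b * 'D_(basis_vec R b) f y.
  by move=> Wy; apply: derive_basis; exact: smooth_on_differentiable fs Wy.
rewrite (open_eq_derive (row i (G x)) Wo E Wx).
have cs b : smooth_on W (fun=> row i (G x) 0 b : R) by exact: smooth_on_cst.
rewrite (smooth_deriv_sum _ _ Wo (fun b => smooth_onM Wo (cs b) (fbs b)) Wx).
rewrite exchange_big /=; congr (_ <= _); apply: eq_bigr => b _.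
rewrite (smooth_derivM _ (cs b) (fbs b) Wx) derive_cst mul0r add0r derive_basis; last first.
  exact: smooth_on_differentiable (fbs b) Wx.
by rewrite mulr_sumr; apply: eq_bigr => a _; rewrite !mxE; ring.
Qed.

Section Coordinates.
Variable X : 'I_n -> V -> R.
Hypotheses (Xs : forall i, smooth_on W (X i))
  (DX : forall i j x, W x -> D i (X j) x = (i == j)%:R).

(** By symmetry of second derivatives the commutator is a first-order operator, with coefficients
    [c]. It annihilates every [X k], since the frame derivatives of [X k] are constant, and the
    Jacobian of [X] is invertible, so [c = 0]. *)
Lemma frame_comm i j f x : smooth_on W f -> W x -> D i (D j f) x = D j (D i f) x.
Proof.
move=> fs Wx.
have S f' : smooth_on W f' ->
   \sum_a \sum_b G x i a * G x j b * 'D_(basis_vec R a) ('D_(basis_vec R b) f') x =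
   \sum_a \sum_b G x j a * G x i b * 'D_(basis_vec R a) ('D_(basis_vec R b) f') x.
  move=> fs'; rewrite exchange_big /=; apply: eq_bigr => a _; apply: eq_bigr => b _.
  by rewrite (derive_comm (basis_vec R a) (basis_vec R b) Wo fs' Wx) [G x i b * _]mulrC.
pose c := \row_b (D i (fun y => G y j b) x - D j (fun y => G y i b) x).
have cE f' : smooth_on W f' ->
  D i (D j f') x - D j (D i f') x = \sum_b c 0 b * 'D_(basis_vec R b) f' x.
  move=> fs'; rewrite !frame_deriv2E // (S _ fs').
  have L (a b s : R) : a + s - (b + s) = a - b by ring.
  rewrite L -sumrB.
  by apply: eq_bigr => b _; rewrite mxE; ring.
pose J : 'M[R]_n := \matrix_(b, k) 'D_(basis_vec R b) (X k) x.
have GJ : G x *m J = 1%:M.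
  apply/matrixP => a k; rewrite !mxE -(DX a k Wx); apply: eq_bigr => b _.
  by rewrite mxE.
have cJ : c *m J = 0.
  apply/rowP => k; rewrite !mxE; under eq_bigr do rewrite [J _ _]mxE.
  rewrite -(cE _ (Xs k)).
  have D0 a b : D a (D b (X k)) x = 0.
    by rewrite (@frame_deriv_eq _ _ (fun=> (b == k)%:R)) ?frame_deriv_cst // => y; exact: DX.
  by rewrite !D0 subrr.
have c0 : c = 0 by rewrite -[c]mulmx1 -(mulmx1C GJ) mulmxA cJ mul0mx.
apply/eqP; rewrite -subr_eq0 (cE _ fs) c0 big1 // => b _.
by rewrite mxE mul0r.
Qed.

End Coordinates.

Variables (x0 : V) (Wx0 : W x0).

(** Second-order jets at [x0] along one frame direction. The sum and product rules for jets turn the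
    second-order test of a large expression into one polynomial identity. *)
Definition jet2 i f (a0 a1 a2 : R) : Prop :=
  [/\ smooth_on W f, f x0 = a0, D i f x0 = a1 & D i (D i f) x0 = a2].

Lemma jet2_intro i f : smooth_on W f -> jet2 i f (f x0) (D i f x0) (D i (D i f) x0).
Proof. by []. Qed.

Lemma jet2_eq i f a0 a1 a2 b0 b1 b2 : jet2 i f a0 a1 a2 ->
  a0 = b0 -> a1 = b1 -> a2 = b2 -> jet2 i f b0 b1 b2.
Proof. by move=> ? <- <- <-. Qed.

Lemma jet2_cst i (c : R) : jet2 i (fun=> c) c 0 0.
Proof.
split; rewrite ?frame_deriv_cst //; first exact: smooth_on_cst.
rewrite (@frame_deriv_eq _ _ (fun=> 0)) ?frame_deriv_cst // => y _.
exact: frame_deriv_cst.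
Qed.

Lemma jet2D i f g a0 a1 a2 b0 b1 b2 : jet2 i f a0 a1 a2 -> jet2 i g b0 b1 b2 ->
  jet2 i (fun x => f x + g x) (a0 + b0) (a1 + b1) (a2 + b2).
Proof.
case=> fs <- <- <- [gs <- <- <-]; split => //; first exact: smooth_onD.
  exact: frame_derivD.
rewrite (@frame_deriv_eq _ _ (fun y => D i f y + D i g y)) //.
  by apply: frame_derivD => //; exact: frame_deriv_smooth.
by move=> y Wy; exact: frame_derivD.
Qed.

Lemma jet2M i f g a0 a1 a2 b0 b1 b2 : jet2 i f a0 a1 a2 -> jet2 i g b0 b1 b2 ->
  jet2 i (fun x => f x * g x) (a0 * b0) (a1 * b0 + a0 * b1)
    (a2 * b0 + 2 * (a1 * b1) + a0 * b2).
Proof.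
case=> fs <- <- <- [gs <- <- <-]; split => //; first exact: smooth_onM.
  exact: frame_derivM.
rewrite (@frame_deriv_eq _ _ (fun y => D i f y * g y + f y * D i g y)) //; last first.
  by move=> y Wy; exact: frame_derivM.
have fs' := frame_deriv_smooth i fs; have gs' := frame_deriv_smooth i gs.
rewrite (frame_derivD _ (smooth_onM Wo fs' gs) (smooth_onM Wo fs gs') Wx0).
rewrite (frame_derivM i fs' gs Wx0) (frame_derivM i fs gs' Wx0).
have L (a b c d e h : R) : a * b + c * d + (c * d + e * h) = a * b + 2 * (c * d) + e * h.
  by ring.
exact: L.
Qed.

Lemma jet2B i f g a0 a1 a2 b0 b1 b2 : jet2 i f a0 a1 a2 -> jet2 i g b0 b1 b2 ->
  jet2 i (fun x => f x - g x) (a0 - b0) (a1 - b1) (a2 - b2).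
Proof.
move=> fj gj; have [s s0 s1 s2] := jet2D fj (jet2M (jet2_cst i (-1)) gj).
have E y : f y + -1 * g y = f y - g y by rewrite mulN1r.
split.
- by apply: smooth_on_eq s => // y _; exact: E.
- by rewrite -E s0; ring.
- rewrite -(@frame_deriv_eq _ _ _ _ (fun y _ => E y)) // s1; ring.
- rewrite -(@frame_deriv_eq _ (D i (fun x => f x + -1 * g x))) ?s2; [ring| |by []].
  by move=> y Wy; apply: frame_deriv_eq => // z _; exact: E.
Qed.

Lemma jet2_sum i (I : Type) (r : seq I) (F : I -> V -> R) (a0 a1 a2 : I -> R) :
  (forall k, jet2 i (F k) (a0 k) (a1 k) (a2 k)) ->
  jet2 i (fun x => \sum_(k <- r) F k x) (\sum_(k <- r) a0 k) (\sum_(k <- r) a1 k)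
    (\sum_(k <- r) a2 k).
Proof.
move=> Fj.
have Fs k : smooth_on W (F k) by case: (Fj k).
split; first exact: smooth_on_sum.
- by apply: eq_bigr => k _; case: (Fj k).
- by rewrite frame_deriv_sum //; apply: eq_bigr => k _; case: (Fj k).
rewrite (@frame_deriv_eq _ _ (fun y => \sum_(k <- r) D i (F k) y)) //.
  rewrite frame_deriv_sum // => [|k]; last exact: frame_deriv_smooth.
  by apply: eq_bigr => k _; case: (Fj k).
by move=> y Wy; exact: frame_deriv_sum.
Qed.

End FrameCalculus.
End Partial.

Arguments frame_derivE {R n W G} i {f x}.
Arguments frame_deriv_eq {R n W G} Wo i {f g x}.
Arguments frame_derivD {R n W G} i {f g x}.
Arguments frame_derivM {R n W G} i {f g x}.
Arguments frame_deriv_sum {R n W G} Wo i {I} r {F x}.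
Arguments frame_deriv_cst {R n G} i c x.
Arguments jet2_cst {R n W G} Wo {x0} Wx0 i c.
Arguments jet2_intro {R n W} G x0 i {f}.

(** * The algebraic inequality at a contact point *)

Section UmbilicAlgebra.
Variables (R : realType) (n : nat).

Lemma sum_sqr_ge (k : 'I_n) (z : 'I_n -> R) : (2 <= n)%N ->
  (\sum_(i | i != k) z i) * (\sum_(i | i != k) z i) <=
  (n%:R - 1) * \sum_(i | i != k) z i * z i.
Proof.
move=> n2.
have cardk : \sum_(i : 'I_n | i != k) (1 : R) = n%:R - 1.
  have := sumr_const 'I_n (1 : R); rewrite card_ord => <-.
  by rewrite [X in _ = X - 1](bigD1 k) //= addrAC subrr add0r.
have n1 : 0 < (n%:R - 1 : R) by rewrite subr_gt0 ltr1n.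
set s := \sum_(i | i != k) z i; set N := n%:R - 1 in cardk n1 *.
have : 0 <= \sum_(i | i != k) (N * z i - s) * (N * z i - s).
  by apply: sumr_ge0 => i _; rewrite -expr2 sqr_ge0.
have -> : \sum_(i | i != k) (N * z i - s) * (N * z i - s) =
   N * (N * (\sum_(i | i != k) z i * z i) - s * s).
  transitivity (\sum_(i | i != k) (N * N * (z i * z i) + (- (2 * N * s)) * z i + s * s * 1)).
    by apply: eq_bigr => i _; ring.
  by rewrite !big_split /= -!mulr_sumr cardk -/s; ring.
by rewrite pmulr_rge0 // subr_ge0.
Qed.

(** Keeps the diagonal and the row and column of [k], and drops the other nonnegative entries. In
    [umbilic_algebra] the kept entries are exactly those seen by the first-order conditions and by
    the trace relation. *)
Lemma sym_quad_ge (k : 'I_n) (c : 'I_n -> 'I_n -> R) :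
  (forall i j, 0 <= c i j) -> (forall i j, c i j = c j i) ->
  c k k + \sum_(i | i != k) (2 * c i k + c i i) <= \sum_i \sum_j c i j.
Proof.
move=> c0 cs; rewrite [leRHS](bigD1 k) //= [X in _ <= X + _](bigD1 k) //= -addrA lerD2l.
rewrite -big_split /=; apply: ler_sum => i ik.
rewrite (cs k i) [2 * _]mulr_natl mulr2n -addrA lerD2l.
rewrite (bigD1 k) //= lerD2l (bigD1 i) //= lerDl.
by apply: sumr_ge0.
Qed.

(** The [b i] are the principal radii, [b k] being the largest, [p] is the gradient of the support
    function, [C i j] the derivative of the Hessian entry [(i, j)] in direction [k], and [f4 i] a
    fourth derivative. Summing the second-order conditions with the weights [1 / b i] of the
    linearized operator and eliminating fourth derivatives by the differentiated equation leaves
    [q * \sum_i (b k - b i)] plus a quadratic form in [p], the total being at most 0. The form is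
    nonnegative, so every [b k - b i] vanishes. *)
Lemma umbilic_algebra (k : 'I_n) (u beta q : R) (b p y M f4 : 'I_n -> R)
    (C : 'I_n -> 'I_n -> R) :
  (2 <= n)%N -> 0 < u -> 0 < beta -> 0 < q -> n%:R * (1 - q) = beta ->
  (forall i, 0 < b i) -> (forall i, b i <= b k) ->
  (forall i, y i = if i == k then 0 else - p i / u) ->
  (forall i j, C i j = C j i) ->
  (forall i, q * (p i * b i) = p i * b k + u * C i k) ->
  \sum_i (b i)^-1 * C i i = - beta * p k / u ->
  \sum_i (b i)^-1 * M i = - beta / u * \sum_i p i * p i ->
  u * (\sum_i (b i)^-1 * f4 i - \sum_i \sum_j (b i)^-1 * (b j)^-1 * (C i j * C i j))
    + (\sum_i (b i)^-1 * C i i) * p k + beta * b k + (n%:R + 2 - beta) * u = 0 ->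
  (forall i, 0 <= q * (b i * b i + M i - u * b i)
    + (i == k)%:R * (2 * u * b k * \sum_j y j * y j)
    - (b i * b k + 2 * p i * C i k + u * (f4 i + (i == k)%:R *
         (4 * (\sum_j y j * C j k) + 2 * \sum_j y j * y j * b j)))
    - (i == k)%:R * (2 * u * b k)) ->
  forall i, b i = b k.
Proof.
move=> n2 u0 beta0 q0 nq b0 bk yE Cs Cik tr1 tr2 eq2 S0.
pose a i := (b i)^-1.
have ab i : a i * b i = 1 by rewrite mulVf // gt_eqF.
have a0 i : 0 < a i by rewrite invr_gt0.
have nR : 2 <= n%:R :> R by rewrite ler_nat.
have q1 : q < 1.
  rewrite -subr_gt0 -(pmulr_rgt0 (x := n%:R)) ?nq //; lra.
pose Y := \sum_j y j * y j; pose Z := \sum_j y j * C j k.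
pose B0 := \sum_j y j * y j * b j.
pose Q := \sum_i \sum_j a i * a j * (C i j * C i j).
have delta (F : 'I_n -> R) : \sum_i (i == k)%:R * F i = F k.
  rewrite (bigD1 k) //= eqxx mul1r big1 ?addr0 // => i ik.
  by rewrite (negbTE ik) mul0r.
(* The weight [a i = 1 / b i] is a diagonal entry of the inverse Hessian, as in the derivative of
   [ln \det]. *)
have tot : 0 <= q * (\sum_i b i + \sum_i a i * M i - n%:R * u) + 2 * u * Y
    - (n%:R * b k + 2 * \sum_i a i * (p i * C i k) + u * \sum_i a i * f4 i
    + u * a k * (4 * Z + 2 * B0)) - 2 * u.
  have : 0 <= \sum_i a i * (q * (b i * b i + M i - u * b i)
    + (i == k)%:R * (2 * u * b k * Y)
    - (b i * b k + 2 * p i * C i k + u * (f4 i + (i == k)%:R * (4 * Z + 2 * B0)))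
    - (i == k)%:R * (2 * u * b k)).
    by apply: sumr_ge0 => i _; rewrite mulr_ge0 ?S0 // ltW.
  congr (_ <= _).
  transitivity (\sum_i (q * (b i + a i * M i - u)
    + (i == k)%:R * (2 * u * Y)
    - (b k + 2 * (a i * (p i * C i k)) + u * (a i * f4 i) + (i == k)%:R * (u * a i * (4 * Z + 2 * B0)))
    - (i == k)%:R * (2 * u))).
    apply: eq_bigr => i _.
    have abi := ab i.
    case: eqVneq => [->|_]; rewrite ?mul1r ?mul0r ?addr0 ?subr0.
      have abk := ab k.
      transitivity (q * ((a k * b k) * b k + a k * M k - u * (a k * b k)) + 2 * u * (a k * b k) * Y
        - ((a k * b k) * b k + 2 * (a k * (p k * C k k)) + u * (a k * f4 k) + u * a k * (4 * Z + 2 * B0))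
        - 2 * u * (a k * b k)); first by ring.
      by rewrite abk; ring.
    transitivity (q * ((a i * b i) * b i + a i * M i - u * (a i * b i))
        - ((a i * b i) * b k + 2 * (a i * (p i * C i k)) + u * (a i * f4 i))); first by ring.
    by rewrite abi; ring.
  have nE (c : R) : \sum_(i < n) c = n%:R * c by rewrite sumr_const card_ord mulr_natl.
  rewrite !(sumrB, big_split) /= !delta -!mulr_sumr !(sumrB, big_split) /= !nE.
  rewrite /a; ring.
pose s := \sum_i (b k - b i).
have sE : s = n%:R * b k - \sum_i b i.
  by rewrite /s sumrB sumr_const card_ord mulr_natl.
(* [eq2] removes the fourth derivatives, [tr2] removes [M], and [nq] cancels the zeroth-order terms
   in [u]. *)
have br : q * s + (u * Q + beta * (p k * p k) / u + q * beta / u * (\sum_i p i * p i)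
   + 2 * \sum_i a i * (p i * C i k) + u * a k * (4 * Z + 2 * B0) - 2 * u * Y) <= 0.
  have f4E : u * \sum_i a i * f4 i = u * Q + beta * (p k * p k) / u - beta * b k
      - (n%:R + 2 - beta) * u.
    apply/eqP; rewrite -subr_eq0; apply/eqP; rewrite -[RHS]eq2 tr1 -/Q /a.
    by field; rewrite gt_eqF.
  move: tot; rewrite f4E tr2 sE -nq => tot.
  rewrite -oppr_ge0; apply: le_trans tot _; rewrite le_eqVlt; apply/orP; left; apply/eqP.
  by field; rewrite gt_eqF.
suff br0 : 0 <= u * Q + beta * (p k * p k) / u + q * beta / u * (\sum_i p i * p i)
   + 2 * \sum_i a i * (p i * C i k) + u * a k * (4 * Z + 2 * B0) - 2 * u * Y.
  have s0 : s <= 0.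
    rewrite -(pmulr_rle0 _ q0).
    by apply: le_trans br; rewrite lerDl.
  have s00 : s = 0.
    apply/le_anti; rewrite s0 /=; apply: sumr_ge0 => i _; by rewrite subr_ge0.
  have := psumr_eq0P (fun i _ => _) s00.
  move=> h i; apply/eqP; rewrite eq_sym -subr_eq0; apply/eqP; apply: h => //.
  by move=> j; rewrite subr_ge0.
have CE i : C i k = - (p i / u) * (b k - q * b i).
  have h := Cik i; apply: (mulfI (lt0r_neq0 u0)); rewrite -[LHS](addKr (p i * b k)) -h.
  by field; rewrite gt_eqF.
have Qge := @sym_quad_ge k (fun i j => a i * a j * (C i j * C i j)) _ _.
have {}Qge : a k * a k * (C k k * C k k) + \sum_(i | i != k)
    (2 * (a i * a k * (C i k * C i k)) + a i * a i * (C i i * C i i)) <= Q.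
  apply: Qge => i j; last by rewrite Cs [a i * a j]mulrC.
  apply: mulr_ge0; first by rewrite mulr_ge0 // ltW.
  by rewrite -expr2 sqr_ge0.
have offd : \sum_(i | i != k) a i * C i i = - (p k / u) * (beta - (1 - q)).
  have := tr1; rewrite (bigD1 k) //= -/(a k) CE => h.
  apply: (addrI (a k * (- (p k / u) * (b k - q * b k)))).
  rewrite [LHS]h.
  have -> : a k * (- (p k / u) * (b k - q * b k)) = - (p k / u) * (1 - q) * (a k * b k) by ring.
  by rewrite ab; field; rewrite gt_eqF.
have := @sum_sqr_ge k (fun i => a i * C i i) n2; rewrite offd.
set W := \sum_(i | _) _ => Wge.
have QW : a k * a k * (C k k * C k k) + \sum_(i | i != k) (2 * (a i * a k * (C i k * C i k))) + W <= Q.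
  apply: le_trans Qge; rewrite big_split /= -addrA lerD2l lerD2l le_eqVlt; apply/orP; left.
  by apply/eqP; apply: eq_bigr => i _; ring.
have YE : Y = \sum_(i | i != k) (p i / u) * (p i / u).
  rewrite /Y (bigD1 k) //= yE eqxx mul0r add0r; apply: eq_bigr => i ik.
  by rewrite yE (negbTE ik); ring.
have ZE : Z = \sum_(i | i != k) (p i / u) * (p i / u) * (b k - q * b i).
  rewrite /Z (bigD1 k) //= yE eqxx mul0r add0r; apply: eq_bigr => i ik.
  by rewrite yE (negbTE ik) CE; ring.
have B0E : B0 = \sum_(i | i != k) (p i / u) * (p i / u) * b i.
  rewrite /B0 (bigD1 k) //= yE eqxx !mul0r add0r; apply: eq_bigr => i ik.
  by rewrite yE (negbTE ik); ring.
pose r := p k / u.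
have ckk : a k * a k * (C k k * C k k) = r * r * ((1 - q) * (1 - q)).
  rewrite CE -/r; transitivity (r * r * ((1 - q) * (1 - q)) * (a k * b k) * (a k * b k)); first by ring.
  by rewrite ab; ring.
(* The form in [p] splits into the indices [i != k] and the index [k]. For [i != k], with
   [t = a k * b i], the coefficient without [y] would be [q beta - 2 q + 2 q^2 t], of no definite
   sign; [y] adds [2 - 4 q t + 2 t] and makes it positive. *)
have off0 : 0 <= \sum_(i | i != k) (u * (2 * (a i * a k * (C i k * C i k))) + q * beta / u * (p i * p i)
    + 2 * (a i * (p i * C i k)) + u * a k * (4 * ((p i / u) * (p i / u) * (b k - q * b i))
     + 2 * ((p i / u) * (p i / u) * b i)) - 2 * u * ((p i / u) * (p i / u))).
  apply: sumr_ge0 => i ik; rewrite CE; set ri := p i / u.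
  have pE : p i = u * ri by rewrite /ri mulrC divfK // gt_eqF.
  rewrite pE.
  have abi := ab i; have abk := ab k.
  have -> : u * (2 * (a i * a k * (- ri * (b k - q * b i) * (- ri * (b k - q * b i))))) +
     q * beta / u * (u * ri * (u * ri)) + 2 * (a i * (u * ri * (- ri * (b k - q * b i)))) +
     u * a k * (4 * (ri * ri * (b k - q * b i)) + 2 * (ri * ri * b i)) - 2 * u * (ri * ri)
     = u * (ri * ri) * (2 * ((a i * b k) * (a k * b k) - 2 * q * (a i * b i) * (a k * b k)
         + q * q * (a k * b i) * (a i * b i))
       + q * beta - 2 * (a i * b k - q * (a i * b i)) + 4 * (a k * b k - q * (a k * b i))
       + 2 * (a k * b i) - 2).
    by field; rewrite gt_eqF.
  rewrite abi abk.
  apply: mulr_ge0; first by rewrite mulr_ge0 ?(ltW u0) // -expr2 sqr_ge0.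
  have t0 : 0 < a k * b i by rewrite mulr_gt0.
  have -> : 2 * (a i * b k * 1 - 2 * q * 1 * 1 + q * q * (a k * b i) * 1) + q * beta
    - 2 * (a i * b k - q * 1) + 4 * (1 - q * (a k * b i)) + 2 * (a k * b i) - 2
    = q * beta + 2 * (1 - q) + 2 * (a k * b i) * ((1 - q) * (1 - q)) by ring.
  have qb : 0 < q * beta by rewrite mulr_gt0.
  have qq : 0 <= 2 * (a k * b i) * ((1 - q) * (1 - q)).
    by rewrite mulr_ge0 ?mulr_ge0 // ?ltW // subr_gt0.
  lra.
(* After the bound on [W] the coefficient of [r * r] is [2 beta - 2 (1 - q) = 2 (n - 1) (1 - q)]. *)
have main0 : 0 <= u * (r * r * ((1 - q) * (1 - q)) + W) + beta * (p k * p k) / u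
   + q * beta / u * (p k * p k) + 2 * (a k * (p k * C k k)).
  have pE : p k = u * r by rewrite /r mulrC divfK // gt_eqF.
  have W1 : (beta - (1 - q)) * (1 - q) * (r * r) <= W.
    have n1 : 0 < (n%:R - 1 : R) by lra.
    rewrite -(ler_pM2l n1); apply: le_trans Wge; rewrite le_eqVlt; apply/orP; left; apply/eqP.
    by rewrite -/r -nq; ring.
  rewrite CE -/r pE.
  have -> : u * (r * r * ((1 - q) * (1 - q)) + W) + beta * (u * r * (u * r)) / u +
     q * beta / u * (u * r * (u * r)) + 2 * (a k * (u * r * (- r * (b k - q * b k))))
     = u * (r * r * ((1 - q) * (1 - q)) + W + (beta + q * beta - 2 * (1 - q) * (a k * b k)) * (r * r)).
    by field; rewrite gt_eqF.
  rewrite ab; apply: mulr_ge0; first exact: ltW.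
  apply: (@le_trans _ _ (r * r * ((1 - q) * (1 - q)) + (beta - (1 - q)) * (1 - q) * (r * r) + (beta + q * beta - 2 * (1 - q) * 1) * (r * r))).
    have -> : r * r * ((1 - q) * (1 - q)) + (beta - (1 - q)) * (1 - q) * (r * r)
      + (beta + q * beta - 2 * (1 - q) * 1) * (r * r) = (2 * beta - 2 * (1 - q)) * (r * r) by ring.
    apply: mulr_ge0; last by rewrite -expr2 sqr_ge0.
    rewrite -nq; nra.
  by rewrite lerD2r lerD2l.
have uQ : u * (r * r * ((1 - q) * (1 - q)) + \sum_(i | i != k) (2 * (a i * a k * (C i k * C i k))) + W) <= u * Q.
  by rewrite ler_pM2l // -ckk.
have := addr_ge0 off0 main0.
rewrite YE ZE B0E [\sum_i p i * p i](bigD1 k) //= [\sum_i a i * (p i * C i k)](bigD1 k) //=.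
move=> h.
apply: le_trans h _.
rewrite !(sumrB, big_split) /= -!mulr_sumr !big_split /= -!mulr_sumr.
set s1 := \sum_(i | _) a i * a k * _; set s2 := \sum_(i | _) p i * p i.
set s3 := \sum_(i | _) a i * (p i * _); set s4 := \sum_(i | _) _ * (b k - _).
set s5 := \sum_(i | _) _ * b i; set s6 := \sum_(i | _) _.
rewrite -mulr_sumr -/s1 in uQ.
by lra.
Qed.

End UmbilicAlgebra.

(** * The soliton equation in gnomonic coordinates *)

Section Gnomonic.
Variables (R : realType) (n : nat).
Local Notation V := 'rV[R]_n.
Variables (W : set V) (G : V -> 'M[R]_n) (X P : 'I_n -> V -> R) (U : V -> R) (beta : R).
Local Notation D := (frame_deriv G).

Definition gnomonic_hessian (x : V) : 'M[R]_n := \matrix_(i, j) D i (P j) x.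
Local Notation H := gnomonic_hessian.

Definition sqr_radius (x : V) : R := \sum_i X i x * X i x.

(* In the gnomonic chart [X] of the Gauss map, [U] is the restriction of the
   support function, extended with homogeneity 1, to the tangent hyperplane;
   [P] is its gradient, and the last equation is the soliton equation. *)
Record gnomonic : Prop := Gnomonic {
  gn_open : open W;
  gn_frame : forall i j, smooth_on W (fun x => G x i j);
  gn_smoothX : forall i, smooth_on W (X i);
  gn_smoothP : forall i, smooth_on W (P i);
  gn_smoothU : smooth_on W U;
  gn_DX : forall i j x, W x -> D i (X j) x = (i == j)%:R;
  gn_DU : forall i x, W x -> D i U x = P i x;
  gn_U0 : forall x, W x -> 0 < U x;
  gn_H0 : forall x, W x -> 0 < \det (H x);
  gn_eq : forall x, W x -> ln (\det (H x)) =
    - beta * ln (U x) + - ((n%:R + 2 - beta) / 2) * ln (1 + sqr_radius x)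
}.

Hypothesis gn : gnomonic.
Let Wo := gn_open gn.
Let Gs := gn_frame gn.
Let Xs := gn_smoothX gn.
Let Ps := gn_smoothP gn.
Let Us := gn_smoothU gn.
Let DX := gn_DX gn.
Let DU := gn_DU gn.

Let cs (c : R) : smooth_on W (fun=> c).
Proof. exact: smooth_on_cst. Qed.

Let Ds i f : smooth_on W f -> smooth_on W (D i f).
Proof. exact: (frame_deriv_smooth Wo Gs). Qed.

Let Dcomm i j f x : smooth_on W f -> W x -> D i (D j f) x = D j (D i f) x.
Proof. exact: (frame_comm Wo Gs Xs DX). Qed.

Let Deq i f g x : (forall y, W y -> f y = g y) -> W x -> D i f x = D i g x.
Proof. exact: (frame_deriv_eq Wo). Qed.

Lemma gnomonic_hessian_smooth i j : smooth_on W (fun x => H x i j).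
Proof.
apply: (smooth_on_eq Wo _ (Ds i (Ps j))) => x _; by rewrite mxE.
Qed.
Let Hs := gnomonic_hessian_smooth.

Lemma DP_sym i j x : W x -> D i (P j) x = D j (P i) x.
Proof.
move=> Wx.
rewrite -(@Deq i _ _ _ (fun y Wy => DU j Wy) Wx).
rewrite -(@Deq j _ _ _ (fun y Wy => DU i Wy) Wx).
exact: Dcomm.
Qed.

Lemma gnomonic_hessian_sym x : W x -> (H x)^T = H x.
Proof. by move=> Wx; apply/matrixP => i j; rewrite !mxE DP_sym. Qed.

Lemma DH_sym12 i j k x : W x -> D i (fun y => H y j k) x = D j (fun y => H y i k) x.
Proof.
move=> Wx.
have E a : (fun y => H y a k) = D a (P k) by apply/funext => y; rewrite mxE.
by rewrite !E; exact: Dcomm.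
Qed.

Lemma DH_sym23 i j k x : W x -> D i (fun y => H y j k) x = D i (fun y => H y k j) x.
Proof.
move=> Wx; apply: Deq Wx => y Wy.
by rewrite !mxE DP_sym.
Qed.

(** Both sides are the same fourth derivative of [U]. This converts the derivatives of the single
    entry [H k k], which the test produces, into derivatives in direction [k] of the diagonal, which
    the equation controls. *)
Lemma DDH_sym i k x : W x ->
  D i (D i (fun y => H y k k)) x = D k (D k (fun y => H y i i)) x.
Proof.
move=> Wx.
have S1 y : W y -> D i (fun z => H z k k) y = D k (fun z => H z i k) y.
  by move=> Wy; exact: DH_sym12.
rewrite (@Deq i _ _ _ S1 Wx) (Dcomm i k (Hs i k) Wx).
apply: Deq Wx => y Wy.
by rewrite (DH_sym23 i i k Wy) (DH_sym12 i k i Wy).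
Qed.

Lemma D_ln i (f : V -> R) (x : V) : smooth_on W f -> W x -> 0 < f x ->
  D i (fun y => ln (f y)) x = D i f x / f x.
Proof.
move=> fs Wx f0; rewrite /frame_deriv mulr_suml; apply: eq_bigr => a _.
rewrite (derive_ln _ f0 (smooth_on_differentiable fs Wx)); exact: mulrA.
Qed.

Lemma sqr_radius_smooth : smooth_on W sqr_radius.
Proof. by apply: (smooth_on_sum _ _ Wo) => i; exact: smooth_onM Wo (Xs i) (Xs i). Qed.

Lemma sqr_radius1_gt0 x : 0 < 1 + sqr_radius x.
Proof.
by rewrite ltr_pwDl // sumr_ge0 // => i _; rewrite -expr2 sqr_ge0.
Qed.

Lemma D_sqr_radius i x : W x -> D i (fun y => 1 + sqr_radius y) x = 2 * X i x.
Proof.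
move=> Wx.
rewrite (frame_derivD i (cs 1) sqr_radius_smooth Wx) frame_deriv_cst add0r.
rewrite (frame_deriv_sum Wo i _ (fun j => smooth_onM Wo (Xs j) (Xs j)) Wx).
rewrite (bigD1 i) //= big1 ?addr0.
  rewrite (frame_derivM i (Xs i) (Xs i) Wx) (DX i i Wx) eqxx mul1r mulr1 mulr_natl; exact/esym/mulr2n.
move=> j ji; rewrite (frame_derivM i (Xs j) (Xs j) Wx) (DX i j Wx) eq_sym (negbTE ji) mul0r mulr0; exact: addr0.
Qed.

Let A x := invmx (H x).
Let As i j : smooth_on W (fun x => A x i j).
Proof.
by apply: (smooth_on_invmx _ _ Wo Hs) => x Wx; rewrite gt_eqF ?(gn_H0 gn Wx).
Qed.

Let gam : R := n%:R + 2 - beta.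

(** The logarithmic derivative of the equation, multiplied by [U (1 + |X|^2)]: without denominators
    it can be differentiated once more by the product rule alone. *)
Lemma trace_identity l x : W x ->
  (\sum_i \sum_j A x j i * D l (fun y => H y i j) x) * U x * (1 + sqr_radius x)
   + beta * P l x * (1 + sqr_radius x) + gam * X l x * U x = 0.
Proof.
move=> Wx.
have H0 := gn_H0 gn Wx; have U0 := gn_U0 gn Wx; have r0 := sqr_radius1_gt0 x.
have dets : smooth_on W (fun y => \det (H y)) by exact: smooth_on_det Wo Hs.
have rs : smooth_on W (fun y => 1 + sqr_radius y).
  exact: smooth_onD Wo (cs 1) sqr_radius_smooth.
have lds : smooth_on W (fun y => ln (\det (H y))).
  exact: smooth_on_ln Wo (gn_H0 gn) dets.
have lUs : smooth_on W (fun y => ln (U y)) by exact: smooth_on_ln Wo (gn_U0 gn) Us.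
have lrs : smooth_on W (fun y => ln (1 + sqr_radius y)).
  exact: smooth_on_ln Wo (fun y _ => sqr_radius1_gt0 y) rs.
have := @Deq l _ _ x (gn_eq gn) Wx.
rewrite (D_ln l dets Wx H0) (frame_derivD l (smooth_onM Wo (cs _) lUs) (smooth_onM Wo (cs _) lrs) Wx).
rewrite (frame_derivM l (cs _) lUs Wx) (frame_derivM l (cs _) lrs Wx) !frame_deriv_cst.
rewrite (D_ln l Us Wx U0) (D_ln l rs Wx r0) (D_sqr_radius l Wx) (DU l Wx) !mul0r !add0r.
have -> : D l (fun y => \det (H y)) x =
    \det (H x) * \sum_i \sum_j A x j i * D l (fun y => H y i j) x.
  rewrite (frame_derivE l dets Wx) (derive_det_inv _ Wo Hs Wx (lt0r_neq0 H0)).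
  congr (_ * _); apply: eq_bigr => i _; apply: eq_bigr => j _; congr (_ * _).
  by rewrite (frame_derivE l (Hs i j) Wx).
rewrite [X in X / _]mulrC (mulfK (lt0r_neq0 H0)) => ->.
rewrite /gam; move: (P l x) (X l x) (U x) U0 (1 + sqr_radius x) r0 => a b u u0 r r0'.
by field; rewrite !gt_eqF.
Qed.

Section AtPoint.
Variables (x0 : V) (b : 'I_n -> R).
Hypotheses (Wx0 : W x0) (X0 : forall i, X i x0 = 0)
  (H0 : forall i j, H x0 i j = (i == j)%:R * b i) (b0 : forall i, 0 < b i).

Let u := U x0.
Let p i := P i x0.
Let t i j l := D i (fun y => H y j l) x0.
Local Notation J2 := (jet2 W G x0).

Lemma inv_hessian0 i j : A x0 i j = (i == j)%:R * (b i)^-1.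
Proof.
have HE : H x0 = diag_mx (\row_i b i).
  apply/matrixP => k l; rewrite H0 !mxE.
  by case: eqVneq => [->|_]; rewrite ?mul1r ?mulr1n // mul0r mulr0n.
have AE : A x0 = diag_mx (\row_i (b i)^-1).
  have : H x0 *m diag_mx (\row_i (b i)^-1) = 1%:M.
    rewrite HE mulmx_diag; apply/matrixP => k l; rewrite !mxE; congr (_ *+ _).
    by rewrite mulfV // gt_eqF.
  move=> E; have Hu : H x0 \in unitmx by case/mulmx1_unit: E.
  by rewrite /A -[RHS](mulKmx Hu) E mulmx1.
rewrite AE !mxE; case: eqVneq => [->|_]; first by rewrite mul1r mulr1n.
by rewrite mul0r mulr0n.
Qed.

(** Differentiating [A H = 1], where both factors are diagonal at [x0]. *)
Lemma D_inv_hessian0 l i j : D l (fun y => A y i j) x0 = - ((b i)^-1 * (b j)^-1 * t l i j).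
Proof.
have E y : W y -> \sum_k A y i k * H y k j = (i == j)%:R.
  move=> Wy; have Hu : H y \in unitmx by rewrite unitmxE unitfE gt_eqF // (gn_H0 gn).
  by have := congr1 (fun M : 'M[R]_n => M i j) (mulVmx Hu); rewrite !mxE.
have := @Deq l _ _ x0 E Wx0; rewrite frame_deriv_cst.
rewrite (frame_deriv_sum Wo l _ (fun k => smooth_onM Wo (As i k) (Hs k j)) Wx0).
under eq_bigr => k _ do rewrite (frame_derivM l (As i k) (Hs k j) Wx0) H0 inv_hessian0.
rewrite big_split /= (bigD1 j) //= eqxx mul1r big1 ?addr0; last first.
  by move=> k kj; rewrite (negbTE kj) mul0r mulr0.
rewrite (bigD1 i) //= eqxx mul1r big1 ?addr0; last first.
  by move=> k ki; rewrite eq_sym (negbTE ki) !mul0r.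
rewrite -/(t l i j) => h.
apply: (mulIf (lt0r_neq0 (b0 j))).
have -> : - ((b i)^-1 * (b j)^-1 * t l i j) * b j = - ((b i)^-1 * t l i j) * ((b j)^-1 * b j) by ring.
by rewrite mulVf ?gt_eqF // mulr1; apply/eqP; rewrite -addr_eq0; apply/eqP.
Qed.

Lemma trace1 l : \sum_i (b i)^-1 * t l i i = - beta * p l / u.
Proof.
have := trace_identity l Wx0.
have -> : sqr_radius x0 = 0 by rewrite /sqr_radius big1 // => i _; rewrite X0 mulr0.
rewrite X0 mulr0 mul0r !addr0 !mulr1.
have -> : \sum_i \sum_j A x0 j i * D l (fun y => H y i j) x0 = \sum_i (b i)^-1 * t l i i.
  apply: eq_bigr => i _; rewrite (bigD1 i) //= big1 ?addr0; last first.
    by move=> j ji; rewrite inv_hessian0 (negbTE ji) !mul0r.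
  by rewrite inv_hessian0 eqxx mul1r.
rewrite -/u -/(p l) => /eqP; rewrite addr_eq0 => /eqP h.
have u0 : 0 < u by exact: gn_U0.
by apply: (mulIf (lt0r_neq0 u0)); rewrite h divfK ?gt_eqF // mulNr.
Qed.

(** The derivative of [trace_identity] in direction [k] at the centre. The inverse Hessian
    contributes the negative quadratic term, [D k (P k)] gives [beta * b k], and [D k (X k) = 1]
    gives the last term. *)
Lemma trace2 k :
  u * (\sum_i (b i)^-1 * D k (D k (fun y => H y i i)) x0 -
       \sum_i \sum_j (b i)^-1 * (b j)^-1 * (t k i j * t k i j))
  + (\sum_i (b i)^-1 * t k i i) * p k + beta * b k + (n%:R + 2 - beta) * u = 0.
Proof.
pose S y := \sum_i \sum_j A y j i * D k (fun y => H y i j) y.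
have AD i j : smooth_on W (fun y => A y j i * D k (fun y => H y i j) y).
  exact: smooth_onM Wo (As j i) (Ds k (Hs i j)).
have Ss : smooth_on W S by do 2!(apply: (smooth_on_sum _ _ Wo) => ?); exact: AD.
have DkS : D k S x0 = \sum_i (b i)^-1 * D k (D k (fun y => H y i i)) x0 -
       \sum_i \sum_j (b i)^-1 * (b j)^-1 * (t k i j * t k i j).
  rewrite (frame_deriv_sum Wo k _ (fun i => smooth_on_sum _ xpredT Wo (AD i)) Wx0).
  rewrite -sumrB; apply: eq_bigr => i _.
  rewrite (frame_deriv_sum Wo k _ (AD i) Wx0).
  under eq_bigr => j _ do rewrite (frame_derivM k (As j i) (Ds k (Hs i j)) Wx0)
     D_inv_hessian0 inv_hessian0.
  rewrite big_split /= addrC; congr (_ + _).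
    rewrite (bigD1 i) //= eqxx mul1r big1 ?addr0 // => j ji.
    by rewrite (negbTE ji) !mul0r.
  rewrite -sumrN; apply: eq_bigr => j _.
  have -> : t k j i = t k i j by exact: DH_sym23.
  rewrite -/(t k i j); ring.
have rs : smooth_on W (fun y => 1 + sqr_radius y).
  exact: smooth_onD Wo (cs 1) sqr_radius_smooth.
have := @Deq k _ _ x0 (@trace_identity k) Wx0; rewrite frame_deriv_cst.
have s1 := smooth_onM Wo (smooth_onM Wo Ss Us) rs.
have s2 := smooth_onM Wo (smooth_onM Wo (cs beta) (Ps k)) rs.
have s3 := smooth_onM Wo (smooth_onM Wo (cs gam) (Xs k)) Us.
rewrite (frame_derivD k (smooth_onD Wo s1 s2) s3 Wx0) (frame_derivD k s1 s2 Wx0).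
rewrite (frame_derivM k (smooth_onM Wo Ss Us) rs Wx0) (frame_derivM k Ss Us Wx0) DkS.
rewrite (frame_derivM k (smooth_onM Wo (cs beta) (Ps k)) rs Wx0) (frame_derivM k (cs beta) (Ps k) Wx0).
rewrite (frame_derivM k (smooth_onM Wo (cs gam) (Xs k)) Us Wx0) (frame_derivM k (cs gam) (Xs k) Wx0).
rewrite !frame_deriv_cst !(D_sqr_radius k Wx0) (DX k k Wx0) (DU k Wx0) eqxx X0 (_ : true%:R = 1 :> R) //.
have -> : D k (P k) x0 = b k by have := H0 k k; rewrite mxE eqxx mul1r.
have -> : sqr_radius x0 = 0 by rewrite /sqr_radius big1 // => i _; rewrite X0 mulr0.
have -> : S x0 = \sum_i (b i)^-1 * t k i i.
  apply: eq_bigr => i _; rewrite (bigD1 i) //= big1 ?addr0; last first.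
    by move=> j ji; rewrite inv_hessian0 (negbTE ji) !mul0r.
  by rewrite inv_hessian0 eqxx mul1r.
move=> h; rewrite -[RHS]h /gam /u /p.
set c1 := \sum_i _; set c2 := \sum_i _; set c3 := \sum_i _.
move: c1 c2 c3 (U x0) (P k x0) (b k) => c1 c2 c3 u' p' b'.
ring.
Qed.

Variables (w q : R) (k : 'I_n).

(** The function E_w of the overview: the [P j] are the tangential components of the position
    relative to the centre, and [U - \sum_j X j * P j] is its component along the outward normal
    there, so the bracket is |F|^2. *)
Definition barrier (x : V) : R :=
  w + q / 2 * (\sum_j P j x * P j x +
    (U x - \sum_j X j x * P j x) * (U x - \sum_j X j x * P j x)).
Local Notation E := barrier.

Let jD := @jet2D _ _ _ _ Wo Gs _ Wx0.
Let jM := @jet2M _ _ _ _ Wo Gs _ Wx0.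
Let jB := @jet2B _ _ _ _ Wo Gs _ Wx0.
Let jc := @jet2_cst _ _ W G Wo _ Wx0.
Let jS i := @jet2_sum _ _ _ _ Wo Gs _ Wx0 i _ (index_enum 'I_n).

Let delta i (F : 'I_n -> R) : \sum_j (i == j)%:R * F j = F i.
Proof.
rewrite (bigD1 i) //= eqxx mul1r big1 ?addr0 // => j ji.
by rewrite eq_sym (negbTE ji) mul0r.
Qed.

Lemma DP0 i j : D i (P j) x0 = (i == j)%:R * b i.
Proof. by have := H0 i j; rewrite mxE. Qed.

Lemma jet2U i : J2 i U u (p i) (b i).
Proof.
split; [exact: Us|by []|exact: DU|].
rewrite (@Deq i _ _ _ (fun y Wy => DU i Wy) Wx0) DP0 eqxx mul1r //.
Qed.

Lemma jet2P i j : J2 i (P j) (p j) ((i == j)%:R * b i) (t i i j).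
Proof.
split; [exact: Ps|by []|exact: DP0|].
by rewrite /t (_ : (fun y => H y i j) = D i (P j)) //; apply/funext => y; rewrite mxE.
Qed.

Lemma jet2X i j : J2 i (X j) 0 (i == j)%:R 0.
Proof.
split; [exact: Xs|exact: X0|exact: DX|].
by rewrite (@Deq i _ _ _ (fun y Wy => DX i j Wy) Wx0) frame_deriv_cst.
Qed.

Lemma jet2H i j l : J2 i (fun x => H x j l) ((j == l)%:R * b j) (t i j l)
  (D i (D i (fun x => H x j l)) x0).
Proof. by split; [exact: Hs|exact: H0|by []|by []]. Qed.

Lemma jet2_barrier i : J2 i E (E x0) (q * (p i * b i))
  (q * (b i * b i + \sum_j p j * t i i j - u * b i)).
Proof.
have jPP : J2 i (fun x => \sum_j P j x * P j x) (\sum_j p j * p j) (2 * (p i * b i))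
    (2 * (b i * b i) + 2 * \sum_j p j * t i i j).
  apply: (jet2_eq (jS (fun j => jM (jet2P i j) (jet2P i j)))) => //.
    rewrite -(delta i (fun j => 2 * (p j * b i))); apply: eq_bigr => j _; ring.
  rewrite -(delta i (fun j => 2 * (b i * b i))) mulr_sumr -big_split /=.
  apply: eq_bigr => j _; case: eqVneq => _ /=; ring.
have jXP : J2 i (fun x => \sum_j X j x * P j x) 0 (p i) (2 * b i).
  apply: (jet2_eq (jS (fun j => jM (jet2X i j) (jet2P i j)))).
  - by rewrite big1 // => j _; rewrite mul0r.
  - by rewrite -(delta i p); apply: eq_bigr => j _; ring.
  - rewrite -(delta i (fun j => 2 * b i)); apply: eq_bigr => j _.
    case: eqVneq => _ /=; ring.
have jQ := jB (jet2U i) jXP.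
have jE : J2 i E _ _ _ := jD (jc i w) (jM (jc i (q / 2)) (jD jPP (jM jQ jQ))).
apply: (jet2_eq jE); first by case: jE.
  by field.
set s := \sum_j _; by field.
Qed.

Let jr i : J2 i (fun x => 1 + sqr_radius x) 1 0 2.
Proof.
apply: (jet2_eq (jD (jc i 1) (jS (fun j => jM (jet2X i j) (jet2X i j))))).
- by rewrite big1 ?addr0 // => j _; rewrite mul0r.
- by rewrite big1 ?addr0 // => j _; ring.
- rewrite add0r -[RHS](delta i (fun j => 2)); apply: eq_bigr => j _.
  case: eqVneq => _ /=; ring.
Qed.

(* The first derivatives of the third-order tensor D_l H_ij vanish for distinct
   indices by the off-diagonal equations, hence by symmetry for l <> i = j. *)
Theorem gnomonic_umbilic_gradient : (2 <= n)%N -> q < 1 ->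
  (forall x i j, W x -> (1 + sqr_radius x) * U x * H x i j =
    E x * ((i == j)%:R * (1 + sqr_radius x) - X i x * X j x)) ->
  forall l, P l x0 = 0.
Proof.
move=> n2 q1 umb l.
have u0 : 0 < u by exact: gn_U0.
have Dumb a i j : p a * ((i == j)%:R * b i) + u * t a i j = q * (p a * b a) * (i == j)%:R.
  have [sl _ l1 _] := jM (jM (jr a) (jet2U a)) (jet2H a i j).
  have [sr _ r1 _] := jM (jet2_barrier a)
    (jB (jM (jc a (i == j)%:R) (jr a)) (jM (jet2X a i) (jet2X a j))).
  have := @Deq a _ _ _ (fun x Wx => umb x i j Wx) Wx0.
  rewrite l1 r1; move: (p a) (t a i j) (E x0) (b a) (b i) (u) => ? ? ? ? ? ? ee.
  move/eqP: ee; rewrite -subr_eq0 => /eqP ee; apply/eqP; rewrite -subr_eq0 -ee; apply/eqP; ring.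
have ub i : u * b i = E x0.
  have := umb x0 i i Wx0; rewrite H0 eqxx mul1r X0 mul0r subr0 mul1r.
  have -> : sqr_radius x0 = 0 by rewrite /sqr_radius big1 // => j _; rewrite X0 mulr0.
  by rewrite addr0 mul1r mulr1.
have [i il] : exists i : 'I_n, i != l.
  have [l0|l0] := eqVneq (val l) 0%N.
    by exists (Ordinal n2); rewrite -val_eqE /= l0.
  by exists (Ordinal (ltnW n2)); rewrite -val_eqE /= eq_sym.
have tlii : t l i i = 0.
  have -> : t l i i = t i i l by rewrite /t (DH_sym12 l i i Wx0); exact: DH_sym23.
  have := Dumb i i l; rewrite (negbTE il) mul0r !mulr0 add0r => /eqP.
  by rewrite mulf_eq0 gt_eqF //= => /eqP.
have := Dumb l i i; rewrite eqxx mul1r mulr1 tlii mulr0 addr0.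
have -> : b l = b i by apply: (mulfI (lt0r_neq0 u0)); rewrite !ub.
move=> h; have : p l * b i * (1 - q) = 0 by rewrite mulrBr mulr1 [X in X - _]h; ring.
move/eqP; rewrite !mulf_eq0 (gt_eqF (b0 i)) orbF subr_eq0 => /orP[/eqP //|/eqP qq].
by move: q1; rewrite -qq ltxx.
Qed.

(** Differentiate the relation in direction [i] at the centre: [X] and the derivative of [1 + |X|^2]
    vanish there, leaving [D i (P i) = U]. *)
Theorem gnomonic_radial : (forall x i, W x -> (1 + sqr_radius x) * P i x = U x * X i x) ->
  forall i, b i = U x0.
Proof.
move=> rad i.
have [_ _ l1 _] := jM (jr i) (jet2P i i).
have [_ _ r1 _] := jM (jet2U i) (jet2X i i).
have := @Deq i _ _ _ (fun x Wx => rad x i Wx) Wx0.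
by rewrite l1 r1 eqxx !(mul0r, mulr0, mul1r, mulr1, add0r, addr0) => ->.
Qed.

(** At the centre the equation reads [n ln u = - beta ln u], and [n + beta] is positive. *)
Lemma gnomonic_eq0 : (forall i, b i = U x0) -> 0 < beta -> U x0 = 1.
Proof.
move=> bu beta0; have u0 : 0 < u by exact: gn_U0.
have := gn_eq gn Wx0.
have -> : \det (H x0) = u ^+ n.
  have -> : H x0 = u%:M.
    by apply/matrixP => i j; rewrite H0 bu !mxE mulr_natl.
  exact: det_scalar.
have -> : sqr_radius x0 = 0 by rewrite /sqr_radius big1 // => j _; rewrite X0 mulr0.
rewrite addr0 ln1 mulr0 addr0 lnXn // -/u -mulr_natl => h.
have : (n%:R + beta) * ln u = 0 by rewrite mulrDl h; ring.
move/eqP; rewrite mulf_eq0 gt_eqF ?ltr_wpDl //= ln_eq0 // => /eqP //.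
Qed.

Section Competitor.
Variable y : 'I_n -> R.
Hypothesis yk : y k = 0.

Let Y := \sum_j y j * y j.
Let A1 x := \sum_j y j * H x j k.
Let B1 x := \sum_j \sum_l y j * (y l * H x j l).
Let Z1 x := \sum_j y j * X j x.

(* The value of the quadratic form of the barrier inequality at the vector
   field e_k + X_k y. *)
Let Psi x := (1 + sqr_radius x) * (E x * (1 + X k x * X k x * Y) -
    U x * (H x k k + 2 * (X k x * A1 x) + X k x * X k x * B1 x))
  - E x * (X k x * X k x * ((1 + Z1 x) * (1 + Z1 x))).

Hypothesis Ek : E x0 = u * b k.

(** At [x0] the factor [X k] vanishes, and so does [A1], because [H x0] is diagonal and [y k = 0].
    Hence [y] affects neither the value nor the first derivatives of [Psi], and the second
    derivative only in direction [k]. *)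
Lemma jet2_competitor i : J2 i Psi 0
  (q * (p i * b i) - (p i * b k + u * t i k k))
  (q * (b i * b i + \sum_j p j * t i i j - u * b i)
    + (i == k)%:R * (2 * u * b k * Y)
    - (b i * b k + 2 * p i * t i k k + u * (D i (D i (fun x => H x k k)) x0
       + (i == k)%:R * (4 * (\sum_j y j * t k j k) + 2 * \sum_j y j * y j * b j)))
    - (i == k)%:R * (2 * u * b k)).
Proof.
have jXk := jM (jet2X i k) (jet2X i k).
have jA : J2 i A1 0 (\sum_j y j * t i j k) (D i (D i A1) x0).
  have jA := jS (fun j => jM (jc i (y j)) (jet2H i j k)).
  have [s _ _ _] := jA.
  apply: (jet2_eq (jet2_intro G x0 i (s : smooth_on W A1))) => //.
    rewrite /A1 big1 // => j _; rewrite H0; case: eqVneq => [->|_]; rewrite ?yk mul0r ?mulr0 //.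
  by case: jA => _ _ -> _; apply: eq_bigr => j _; ring.
have jB1 : J2 i B1 (\sum_j y j * y j * b j) (D i B1 x0) (D i (D i B1) x0).
  have [s sE _ _] := jS (fun j => jS (fun l => jM (jc i (y j)) (jM (jc i (y l)) (jet2H i j l)))).
  apply: (jet2_eq (jet2_intro G x0 i (s : smooth_on W B1))) => //.
  rewrite [LHS]sE; apply: eq_bigr => j _; rewrite -[RHS](delta j (fun l => y j * y l * b j)).
  by apply: eq_bigr => l _; ring.
have jZ : J2 i Z1 0 (D i Z1 x0) (D i (D i Z1) x0).
  have [s sE _ _] := jS (fun j => jM (jc i (y j)) (jet2X i j)).
  apply: (jet2_eq (jet2_intro G x0 i (s : smooth_on W Z1))) => //.
  by rewrite [LHS]sE big1 // => j _; rewrite mulr0.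
have jZ1 := jD (jc i 1) jZ.
have jE := jet2_barrier i.
have jH := jet2H i k k.
have jPsi : J2 i Psi _ _ _ :=
  jB (jM (jr i) (jB (jM jE (jD (jc i 1) (jM jXk (jc i Y))))
     (jM (jet2U i) (jD (jD jH (jM (jc i 2) (jM (jet2X i k) jA))) (jM jXk jB1)))))
   (jM jE (jM jXk (jM jZ1 jZ1))).
have tE : (i == k)%:R * (\sum_j y j * t i j k) = (i == k)%:R * (\sum_j y j * t k j k).
  by case: eqVneq => [->|]; rewrite ?mul0r.
apply: (jet2_eq jPsi); rewrite Ek eqxx (_ : true%:R = 1 :> R) //.
- by ring.
- move: (D i B1 x0) (D i Z1 x0) (t i k k) (Y) (u) (p i) (b i) (b k) (q) (\sum_j y j * t i j k).
  move: (\sum_j y j * y j * b j) => ? ? ? ? ? ? ? ? ? ? ?.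
  by case: (i == k) => /=; ring.
- move: tE; move: (D i (D i (fun x => H x k k)) x0) (\sum_j y j * t i j k) (\sum_j y j * t k j k)
    (\sum_j p j * t i i j) (\sum_j y j * y j * b j) (D i (D i A1) x0) (D i B1 x0)
    (D i (D i B1) x0) (D i Z1 x0) (D i (D i Z1) x0) (t i k k) (Y) (u) (p i) (b i) (b k) (q).
  move=> ? s1 s2 ? ? ? ? ? ? ? ? ? ? ? ? ? ?.
  by case: (i == k) => /= s12; [rewrite !mul1r in s12; rewrite s12|]; ring.
Qed.

Hypothesis barrier_ineq : forall x (v : 'I_n -> R), W x ->
  (1 + sqr_radius x) * U x * \sum_i \sum_j v i * (v j * H x i j) <=
  E x * ((\sum_i v i * v i) * (1 + sqr_radius x) - (\sum_i X i x * v i) * (\sum_i X i x * v i)).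

Lemma competitor_ge0 x : W x -> 0 <= Psi x.
Proof.
move=> Wx; pose v j : R := (k == j)%:R + X k x * y j.
have := barrier_ineq v Wx; rewrite -subr_ge0.
have -> : \sum_j v j * v j = 1 + X k x * X k x * Y.
  transitivity (\sum_j ((k == j)%:R * (1 + 2 * X k x * y j) + X k x * X k x * (y j * y j))).
    by apply: eq_bigr => j _; rewrite /v; case: eqVneq => _ /=; ring.
  by rewrite big_split /= delta yk -mulr_sumr /Y; ring.
have -> : \sum_j X j x * v j = X k x * (1 + Z1 x).
  transitivity (\sum_j ((k == j)%:R * X j x + X k x * (y j * X j x))).
    by apply: eq_bigr => j _; rewrite /v; ring.
  by rewrite big_split /= delta -mulr_sumr /Z1; ring.
have -> : \sum_i \sum_j v i * (v j * H x i j) =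
    H x k k + 2 * (X k x * A1 x) + X k x * X k x * B1 x.
  transitivity (\sum_i ((k == i)%:R * (H x i k + X k x * \sum_j y j * H x i j)
    + (X k x * (y i * H x i k) + X k x * X k x * \sum_j y i * (y j * H x i j)))).
    apply: eq_bigr => i _.
    transitivity (\sum_j ((k == j)%:R * (v i * H x i j) + (v i * X k x) * (y j * H x i j))).
      by apply: eq_bigr => j _; rewrite {2}/v; ring.
    rewrite big_split /= delta -mulr_sumr.
    have -> : \sum_j y i * (y j * H x i j) = y i * \sum_j y j * H x i j by rewrite mulr_sumr.
    by rewrite /v; ring.
  rewrite big_split /= delta big_split /= -!mulr_sumr.
  have -> : \sum_j y j * H x k j = A1 x.
    apply: eq_bigr => j _; congr (_ * _).
    by have := congr1 (fun M : 'M[R]_n => M k j) (gnomonic_hessian_sym Wx); rewrite mxE.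
  by rewrite /A1 /B1; ring.
by congr (_ <= _); rewrite /Psi; ring.
Qed.

Lemma competitor_test i :
  q * (p i * b i) = p i * b k + u * t i k k /\
  0 <= q * (b i * b i + \sum_j p j * t i i j - u * b i)
    + (i == k)%:R * (2 * u * b k * Y)
    - (b i * b k + 2 * p i * t i k k + u * (D i (D i (fun x => H x k k)) x0
       + (i == k)%:R * (4 * (\sum_j y j * t k j k) + 2 * \sum_j y j * y j * b j)))
    - (i == k)%:R * (2 * u * b k).
Proof.
have [Ps_ P0 P1 P2] := jet2_competitor i.
have Pmin : \forall z \near x0, Psi x0 <= Psi z.
  by apply: open_nearP Wo Wx0 _ => z Wz; rewrite P0 competitor_ge0.
have [D0 D2] := frame_deriv2_local_min Wo Gs i Ps_ Wx0 Pmin.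
split; last by rewrite -P2.
by apply/eqP; rewrite -subr_eq0 -P1 D0.
Qed.

End Competitor.

Theorem gnomonic_umbilic : (2 <= n)%N -> 0 < beta -> 0 < q -> n%:R * (1 - q) = beta ->
  (forall i, b i <= b k) -> E x0 = u * b k ->
  (forall x (v : 'I_n -> R), W x ->
    (1 + sqr_radius x) * U x * \sum_i \sum_j v i * (v j * H x i j) <=
    E x * ((\sum_i v i * v i) * (1 + sqr_radius x) - (\sum_i X i x * v i) * (\sum_i X i x * v i))) ->
  forall i, b i = b k.
Proof.
move=> n2 beta0 q0 nq bk Ek ineq.
(* Minus the gradient of [ln U] at the centre, without its component [k], which must vanish for the
   jet computation. *)
pose y i : R := if i == k then 0 else - p i / u.
have yk : y k = 0 by rewrite /y eqxx.
have test i := competitor_test yk Ek ineq i.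
have tk1 i j : t k i j = t k j i by exact: DH_sym23.
have tk2 i : t i k k = t k i k by exact: DH_sym12.
have ti j : \sum_i (b i)^-1 * t i i j = - beta * p j / u.
  rewrite -trace1; apply: eq_bigr => i _; congr (_ * _).
  by rewrite /t (DH_sym23 i i j Wx0) (DH_sym12 i j i Wx0).
have u0 : 0 < u by exact: gn_U0.
apply: (@umbilic_algebra R n k u beta q b p y (fun i => \sum_j p j * t i i j)
  (fun i => D k (D k (fun x => H x i i)) x0) (fun i j => t k i j)) => //.
- by move=> i; rewrite -tk2; case: (test i).
- exact: trace1.
- transitivity (\sum_j p j * \sum_i (b i)^-1 * t i i j).
    under eq_bigr do rewrite mulr_sumr.
    rewrite exchange_big /=; apply: eq_bigr => j _; rewrite mulr_sumr.
    by apply: eq_bigr => i _; rewrite mulrCA.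
  by rewrite mulr_sumr; apply: eq_bigr => j _; rewrite ti; field; rewrite gt_eqF.
- exact: trace2.
- move=> i; have [_] := test i; rewrite tk2 (DDH_sym i k Wx0); apply.
Qed.

End AtPoint.
End Gnomonic.

(** * Solitons in a coordinate patch *)

Section DotCalculus.
Variables (R : realType) (m : nat) (V : normedModType R).
Implicit Types (f : V -> 'rV[R]_m) (w : 'rV[R]_m).

(** A named function of the first argument, so that it can carry the linear structure used to
    differentiate under the product. *)
Definition dotv_right w (u : 'rV[R]_m) : R := dotv u w.

Lemma dotv_right_linear w : linear (dotv_right w).
Proof. by move=> a u v; rewrite /dotv_right dotvDl dotvZl. Qed.

HB.instance Definition _ w :=
  GRing.isLinear.Build R 'rV[R]_m R _ (dotv_right w) (dotv_right_linear w).

Lemma dotv_right_continuous w : continuous (dotv_right w).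
Proof.
move=> u; rewrite /dotv_right /dotv; apply: continuous_at_sum => i.
by apply: continuousM; [exact: coord_continuous|exact: cst_continuous].
Qed.

Lemma derive_dotv f w x v : derivable f x v ->
  'D_v (fun y => dotv (f y) w) x = dotv ('D_v f x) w.
Proof. exact: (derive_linear (@dotv_right_continuous w)). Qed.

Lemma smooth_dotv (U : set V) f w : open U -> smooth_on U f ->
  smooth_on U (fun y => dotv (f y) w).
Proof. by move=> Uo fs; exact: (smooth_on_linear Uo (@dotv_right_continuous w) fs). Qed.

Section DotProduct.
Variables (U : set V) (f g : V -> 'rV[R]_m).
Hypotheses (Uo : open U) (fs : smooth_on U f) (gs : smooth_on U g).

Let f_ i : smooth_on U (fun x => dotv (f x) (basis_vec R i)).
Proof. exact: smooth_dotv. Qed.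

Let g_ i : smooth_on U (fun x => dotv (g x) (basis_vec R i)).
Proof. exact: smooth_dotv. Qed.

Let dotvfgE x : \sum_i dotv (f x) (basis_vec R i) * dotv (g x) (basis_vec R i) =
  dotv (f x) (g x).
Proof. by rewrite [RHS]dotvE; apply: eq_bigr => i _; rewrite !dotv_basis. Qed.

Lemma smooth_dotv_dotv : smooth_on U (fun x => dotv (f x) (g x)).
Proof.
apply: (smooth_on_eq Uo (fun x _ => dotvfgE x)).
exact: (smooth_on_sum _ _ Uo (fun i => smooth_onM Uo (f_ i) (g_ i))).
Qed.

Lemma smooth_derive_dotv x v : U x ->
  'D_v (fun x => dotv (f x) (g x)) x = dotv ('D_v f x) (g x) + dotv (f x) ('D_v g x).
Proof.
move=> Ux; rewrite -(open_eq_derive v Uo (fun x _ => dotvfgE x) Ux).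
rewrite (smooth_deriv_sum _ _ Uo (fun i => smooth_onM Uo (f_ i) (g_ i)) Ux).
rewrite !dotvE -big_split /=; apply: eq_bigr => i _.
rewrite (smooth_derivM v (f_ i) (g_ i) Ux).
rewrite !derive_dotv ?dotv_basis //; exact: smooth_on_derivable Ux.
Qed.

End DotProduct.

End DotCalculus.

Local Opaque derive dotv basis_vec.

Section OpenPos.
Variables (R : realType) (T : topologicalType).
Lemma open_pos (W : set T) (f : T -> R) : open W ->
  (forall x, W x -> {for x, continuous f}) -> open [set x | W x /\ 0 < f x].
Proof.
move=> Wo fc; rewrite openE => x [Wx f0].
have : nbhs x (f @^-1` [set y | 0 < y]).
  by apply: (fc x Wx); apply: open_nbhs_nbhs; split=> //; exact: open_gt.
by move=> h; apply: filterI => //; exact: open_nbhs_nbhs.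
Qed.
End OpenPos.

(** * Fundamental forms and the soliton equation on an open set of coordinates *)

Section Patch.
Variables (R : realType) (n : nat).
Local Notation V := 'rV[R]_n.
Local Notation E_ := 'rV[R]_n.+1.
Local Notation e_ a := (basis_vec R a).
Implicit Types (f eta : V -> E_) (x v : V).

Definition metric f x : 'M[R]_n := \matrix_(i, j) dotv ('D_(e_ i) f x) ('D_(e_ j) f x).
Definition second_form f eta x : 'M[R]_n :=
  \matrix_(i, j) dotv ('D_(e_ i) ('D_(e_ j) f) x) (eta x).

Section Forms.
Variables (W : set V) (f eta : V -> E_).
Hypotheses (Wo : open W) (fs : smooth_on W f).
Local Notation g := (metric f).
Local Notation h := (second_form f eta).

Let fd x v : W x -> derivable f x v.
Proof. by move=> Wx; exact: smooth_on_derivable fs Wx. Qed.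

Let fDs v : smooth_on W ('D_v f).
Proof. exact: smooth_on_derive. Qed.

Lemma smooth_derive_basis x v : W x -> 'D_v f x = \sum_a v 0 a *: 'D_(e_ a) f x.
Proof.
move=> Wx; have fdx : differentiable f x by exact: smooth_on_differentiable fs Wx.
rewrite deriveE // [v in LHS]rV_basis linear_sum /=.
by apply: eq_bigr => a _; rewrite linearZ deriveE.
Qed.

Lemma metric_sym x : (g x)^T = g x.
Proof. by apply/matrixP => i j; rewrite !mxE; exact: dotvC. Qed.

Lemma smooth_metricE x v : W x -> dotv (v *m g x) v = dotv ('D_v f x) ('D_v f x).
Proof.
move=> Wx; rewrite [in RHS](smooth_derive_basis v Wx) dotv_suml.
transitivity (\sum_i \sum_j v 0 i * (v 0 j * dotv ('D_(e_ i) f x) ('D_(e_ j) f x))).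
  rewrite dotvE exchange_big /=; apply: eq_bigr => j _.
  by rewrite mxE mulr_suml; apply: eq_bigr => i _; rewrite !mxE; ring.
apply: eq_bigr => i _; rewrite dotvZl -mulr_sumr; congr (_ * _).
rewrite dotvC dotv_suml; apply: eq_bigr => j _.
exact: (etrans (congr1 _ (dotvC _ _)) (esym (dotvZl _ _ _))).
Qed.

Lemma smooth_metric_pos_def x : W x -> (forall v, v != 0 -> 'D_v f x != 0) -> pos_def (g x).
Proof.
move=> Wx imm v v0; rewrite -dotv_mx smooth_metricE //.
exact/dotvv_gt0/imm.
Qed.

(** With the normal frozen at its value in [x], the entries are second derivatives of one scalar
    function, the height in that direction. *)
Lemma smooth_second_form_sym x : W x -> (h x)^T = h x.
Proof.
move=> Wx; apply/matrixP => i j; rewrite !mxE.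
have fw w : smooth_on W (fun y => dotv (f y) w) by exact: smooth_dotv Wo fs.
have D2 a b : dotv ('D_(e_ a) ('D_(e_ b) f) x) (eta x) =
    'D_(e_ a) ('D_(e_ b) (fun z => dotv (f z) (eta x))) x.
  rewrite -(derive_dotv _ (@smooth_on_derivable _ _ _ _ _ x (e_ a) (fDs (e_ b)) Wx)).
  apply: (open_eq_derive _ Wo _ Wx) => y Wy.
  by rewrite (derive_dotv _ (@fd _ _ Wy)).
exact: (etrans (D2 j i) (etrans (derive_comm (e_ i) (e_ j) Wo (fw (eta x)) Wx) (esym (D2 i j)))).
Qed.

End Forms.

(** Smoothness is recorded for [f] only; [eta] is a pointwise unit normal. The last field is the
    logarithm of K = u^beta. *)
Record soliton_patch (beta : R) (W : set V) f eta : Prop := SolitonPatch {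
  sp_open : open W;
  sp_smooth : smooth_on W f;
  sp_unit : forall x, W x -> dotv (eta x) (eta x) = 1;
  sp_normal : forall x v, W x -> dotv ('D_v f x) (eta x) = 0;
  sp_immersion : forall x v, W x -> v != 0 -> 'D_v f x != 0;
  sp_convex : forall x, W x -> pos_def (second_form f eta x);
  sp_support : forall x, W x -> 0 < - dotv (f x) (eta x);
  sp_eq : forall x, W x -> ln (\det (second_form f eta x) / \det (metric f x)) =
    beta * ln (- dotv (f x) (eta x))
}.

Variables (beta : R) (W : set V) (f eta : V -> E_).
Hypothesis sp : soliton_patch beta W f eta.
Local Notation g := (metric f).
Local Notation h := (second_form f eta).
Let Wo := sp_open sp.
Let fs := sp_smooth sp.

Let fd x v : W x -> derivable f x v.
Proof. by move=> Wx; exact: smooth_on_derivable fs Wx. Qed.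

Let fDs v : smooth_on W ('D_v f).
Proof. exact: smooth_on_derive. Qed.

Lemma patch_derive x v : W x -> 'D_v f x = \sum_a v 0 a *: 'D_(e_ a) f x.
Proof. exact: smooth_derive_basis. Qed.

Lemma metricE x v : W x -> dotv (v *m g x) v = dotv ('D_v f x) ('D_v f x).
Proof. exact: smooth_metricE. Qed.

Lemma metric_pos_def x : W x -> pos_def (g x).
Proof. by move=> Wx; apply: (smooth_metric_pos_def fs Wx) => v; exact: (sp_immersion sp). Qed.

Lemma second_form_sym x : W x -> (h x)^T = h x.
Proof. exact: smooth_second_form_sym. Qed.

Lemma patch_diagonalization x : W x -> exists (L : 'M[R]_n) (d : 'rV[R]_n),
  L *m g x *m L^T = 1%:M /\ L *m h x *m L^T = diag_mx d.
Proof.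
move=> Wx.
exact: (simultaneous_diagonalization (metric_sym f x) (second_form_sym Wx) (metric_pos_def Wx)).
Qed.

(** * The gnomonic chart of the Gauss map centred at a point *)

Section Frame.
Variables (x0 : V) (L : 'M[R]_n) (d : 'rV[R]_n).
Hypotheses (Wx0 : W x0) (Lg : L *m g x0 *m L^T = 1%:M) (Lh : L *m h x0 *m L^T = diag_mx d).

Let N0 : E_ := - eta x0.
Let tau i : E_ := 'D_(row i L) f x0.

(** The orthonormal principal directions [tau i] and the outward normal [N0] at the centre form an
    orthonormal basis of the ambient space. *)
Lemma frame_parseval (a b : E_) :
  dotv a b = (\sum_i dotv a (tau i) * dotv b (tau i)) + dotv a N0 * dotv b N0.
Proof.
have tt (i j : 'I_n) : dotv (tau i) (tau j) = (i == j)%:R.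
  have -> : dotv (tau i) (tau j) = (L *m g x0 *m L^T) i j; last by rewrite Lg mxE.
  rewrite /tau !(patch_derive _ Wx0) dotv_suml.
  transitivity (\sum_k \sum_l L i k * (L j l * dotv ('D_(e_ k) f x0) ('D_(e_ l) f x0))).
    apply: eq_bigr => k _; rewrite dotvZl -mulr_sumr mxE; congr (_ * _).
    rewrite dotvC dotv_suml; apply: eq_bigr => l _.
    rewrite [row j L 0 l]mxE; exact: (etrans (dotvZl _ _ _) (congr1 _ (dotvC _ _))).
  rewrite mxE exchange_big /=; apply: eq_bigr => l _.
  by rewrite mxE mulr_suml; apply: eq_bigr => k _; rewrite !mxE; ring.
have tN i : dotv (tau i) N0 = 0 by rewrite dotvNr (sp_normal sp) // oppr0.
have NN : dotv N0 N0 = 1 by rewrite dotvNr dotvNl opprK (sp_unit sp).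
pose O : 'M[R]_(1 + n, n.+1) := col_mx N0 (\matrix_i tau i).
have OO : O *m O^T = 1%:M.
  rewrite /O tr_col_mx mul_col_row scalar_mx_block; congr block_mx.
  - by rewrite [LHS]mx11_scalar -dotv_mx NN.
  - apply/matrixP => i j; rewrite !mxE (ord1 i).
    transitivity (dotv N0 (tau j)); last by rewrite dotvC tN.
    by rewrite dotvE; apply: eq_bigr => l _; rewrite !mxE.
  - apply/matrixP => i j; rewrite !mxE (ord1 j).
    transitivity (dotv (tau i) N0); last by rewrite tN.
    by rewrite dotvE; apply: eq_bigr => l _; rewrite !mxE.
  - apply/matrixP => i j; rewrite !mxE -tt dotvE.
    by apply: eq_bigr => l _; rewrite !mxE.
have OtO : O^T *m O = 1%:M := mulmx1C (OO : (O : 'M[R]_n.+1) *m (O^T : 'M[R]_n.+1) = 1%:M).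
have aO c : c *m O^T = row_mx (dotv c N0)%:M (\row_i dotv c (tau i)).
  rewrite /O tr_col_mx mul_mx_row; congr row_mx.
    by rewrite [LHS]mx11_scalar -dotv_mx.
  by apply/rowP => i; rewrite !mxE dotvE; apply: eq_bigr => l _; rewrite !mxE.
have -> : dotv a b = dotv (a *m O^T) (b *m O^T).
  by rewrite dotv_mulmxl trmxK -mulmxA OtO mulmx1.
rewrite !aO dotv_mx tr_row_mx mul_row_col mxE addrC; congr (_ + _).
  by rewrite !mxE; apply: eq_bigr => i _; rewrite !mxE.
by rewrite tr_scalar_mx -scalar_mxM !mxE eqxx.
Qed.

(** Over the tangent space at [x0] the hypersurface is a graph of height [f0] in the coordinates
    [P], whose Jacobian is [T]. [X] is minus the slope of this graph, so the normal is proportional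
    to [N0 + \sum_i X i *: tau i]: [X] is the gnomonic image of the Gauss map, obtained from first
    derivatives of [f] only. [U] is the support function at that unnormalized vector, a Legendre
    transform of the height. *)
Let P i x : R := dotv (f x) (tau i).
Let f0 x : R := dotv (f x) N0.
Let T x : 'M[R]_n := \matrix_(a, i) dotv ('D_(e_ a) f x) (tau i).
Let X i x : R := - \sum_a invmx (T x) i a * 'D_(e_ a) f0 x.
Let U x : R := f0 x + \sum_i X i x * P i x.
Let J x : 'M[R]_n := \matrix_(a, k) 'D_(e_ a) (X k) x.
Let G x : 'M[R]_n := invmx (J x).
Let c x : R := dotv (eta x) N0.

Let W1 := [set x | W x /\ 0 < \det (T x) ^+ 2].
(** Since the support function equals [- c U], positivity of [U] keeps [- c] positive, that is, the
    normal stays in the open hemisphere around [eta x0]. *)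
Definition gnomonic_dom := [set x | W1 x /\ 0 < U x].
Let W2 := gnomonic_dom.

Let Ps i : smooth_on W (P i).
Proof. exact: smooth_dotv. Qed.

Let f0s : smooth_on W f0.
Proof. exact: smooth_dotv. Qed.

Let DP a i x : W x -> 'D_(e_ a) (P i) x = T x a i.
Proof. by move=> Wx; rewrite mxE derive_dotv //; exact: fd. Qed.

Let Ts a i : smooth_on W (fun x => T x a i).
Proof.
apply: (smooth_on_eq Wo _ (smooth_on_derive (e_ a) (Ps i))) => x Wx.
exact: DP.
Qed.

Let W1o : open W1.
Proof.
apply: open_pos => // x Wx; apply: (smooth_on_continuous _ Wx).
have dets : smooth_on W (fun x => \det (T x)) by exact: smooth_on_det.
exact: (smooth_onM Wo dets dets).
Qed.

Let W1W : W1 `<=` W. Proof. by move=> x []. Qed.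

Let Tu x : W1 x -> T x \in unitmx.
Proof.
by case=> _ d2; rewrite unitmxE unitfE; apply: contraTN d2 => /eqP->; rewrite expr0n ltxx.
Qed.

Let Xs i : smooth_on W1 (X i).
Proof.
apply: (smooth_onN W1o); apply: (smooth_on_sum _ _ W1o) => a.
apply: (smooth_onM W1o).
  apply: (smooth_on_invmx _ _ W1o) => [j k|x W1x].
    exact: smooth_on_sub W1W (Ts j k).
  by have := Tu W1x; rewrite unitmxE unitfE.
apply: smooth_on_derive; exact: smooth_on_sub W1W f0s.
Qed.

Let Us : smooth_on W1 U.
Proof.
apply: (smooth_onD W1o); first exact: smooth_on_sub W1W f0s.
apply: (smooth_on_sum _ _ W1o) => i; apply: (smooth_onM W1o); first exact: Xs.
exact: smooth_on_sub W1W (Ps i).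
Qed.

Let W2o : open W2.
Proof. by apply: open_pos => // x Wx; exact: smooth_on_continuous Us Wx. Qed.

Let W21 : W2 `<=` W1. Proof. by move=> x []. Qed.

Let TX a x : W1 x -> \sum_i T x a i * X i x = - 'D_(e_ a) f0 x.
Proof.
move=> W1x.
pose F := \col_a 'D_(e_ a) f0 x.
have XE : (\col_i X i x) = - (invmx (T x) *m F).
  by apply/colP => i; rewrite !mxE; congr (- _); apply: eq_bigr => b _; rewrite !mxE.
have := congr1 (fun M : 'cV[R]_n => M a 0) (congr1 (mulmx (T x)) XE).
rewrite mulmxN mulKVmx ?Tu // !mxE => <-.
by apply: eq_bigr => i _; rewrite !mxE.
Qed.

(** As in every Legendre transform, the differential of [f0] cancels against [\sum_i X i * dP i]. *)
Let DU a x : W1 x -> 'D_(e_ a) U x = \sum_i J x a i * P i x.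
Proof.
move=> W1x; have Wx := W1W W1x.
have P1 i : smooth_on W1 (P i) by exact: smooth_on_sub W1W (Ps i).
have XP i : smooth_on W1 (fun x => X i x * P i x) by exact: smooth_onM.
rewrite (smooth_derivD _ (smooth_on_sub W1W f0s) (smooth_on_sum _ xpredT W1o XP) W1x).
rewrite (smooth_deriv_sum _ _ W1o XP W1x).
under eq_bigr => i _ do rewrite (smooth_derivM _ (Xs i) (P1 i) W1x) DP //.
rewrite big_split /= addrCA.
have -> : \sum_i X i x * T x a i = - 'D_(e_ a) f0 x.
  by rewrite -(TX a W1x); apply: eq_bigr => i _; rewrite mulrC.
rewrite subrr addr0; apply: eq_bigr => i _; by rewrite [J _ _ _]mxE.
Qed.

(** The column [y] measures how far [eta] is from [c] times [N0 + \sum_i X i *: tau i].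
    Orthogonality of [eta] to the coordinate derivatives of [f] says [T y = 0], and [T] is
    invertible. *)
Let eta_tau i x : W1 x -> dotv (eta x) (tau i) = c x * X i x.
Proof.
move=> W1x; have Wx := W1W W1x.
pose y := \col_i (dotv (eta x) (tau i) - c x * X i x).
have Ty : T x *m y = 0.
  apply/colP => a; rewrite !mxE.
  have := sp_normal sp (e_ a) Wx; rewrite frame_parseval => h0.
  transitivity (\sum_i dotv ('D_(e_ a) f x) (tau i) * dotv (eta x) (tau i)
      - c x * \sum_i T x a i * X i x).
    rewrite mulr_sumr -sumrB; apply: eq_bigr => k _; rewrite !mxE; ring.
  rewrite (TX a W1x) derive_dotv; last exact: fd.
  by rewrite mulrN opprK [c x * _]mulrC.
have : y = 0 by rewrite -[y](mulKmx (Tu W1x)) Ty mulmx0.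
move/(congr1 (fun M : 'cV[R]_n => M i 0)); rewrite !mxE => /eqP.
by rewrite subr_eq0 => /eqP.
Qed.

Let cc x : W1 x -> c x * c x * (1 + sqr_radius X x) = 1.
Proof.
move=> W1x; rewrite -[RHS](sp_unit sp (W1W W1x)) frame_parseval -/(c x).
under [X in _ = X + _]eq_bigr do rewrite (eta_tau _ W1x).
rewrite mulrDr mulr1 addrC /sqr_radius mulr_sumr; congr (_ + _).
by apply: eq_bigr => i _; ring.
Qed.

Let uE x : W1 x -> - dotv (f x) (eta x) = - c x * U x.
Proof.
move=> W1x; rewrite frame_parseval -/(c x) -/(f0 x).
under eq_bigr do rewrite (eta_tau _ W1x).
have -> : \sum_i dotv (f x) (tau i) * (c x * X i x) = c x * \sum_i X i x * P i x.
  by rewrite mulr_sumr; apply: eq_bigr => i _; rewrite mulrC -mulrA.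
by rewrite /U; move: (c x) (f0 x) (\sum_i _) => ? ? ?; ring.
Qed.

(** Obtained by differentiating the slope relation [TX]; expanding [h] in the basis at the centre,
    the terms with derivatives of [T] cancel. *)
Let hE x : W1 x -> h x = (- c x) *: (J x *m (T x)^T).
Proof.
move=> W1x; have Wx := W1W W1x; apply/matrixP => a b; rewrite !mxE.
have T1 i : smooth_on W1 (fun y => T y b i) by exact: smooth_on_sub W1W (Ts b i).
have TXs i : smooth_on W1 (fun y => T y b i * X i y) by exact: smooth_onM.
have := open_eq_derive (e_ a) W1o (@TX b) W1x.
rewrite (smooth_deriv_sum _ _ W1o TXs W1x).
under eq_bigr => i _ do rewrite (smooth_derivM _ (T1 i) (Xs i) W1x).
rewrite big_split /=.
have Dbs : smooth_on W ('D_(e_ b) f) by exact: fDs.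
have Df0 : 'D_(e_ a) (fun y => - 'D_(e_ b) f0 y) x = - dotv ('D_(e_ a) ('D_(e_ b) f) x) N0.
  rewrite (@deriveN _ _ _ ('D_(e_ b) f0)); last first.
    exact: smooth_on_derivable (smooth_on_derive _ f0s) Wx.
  congr (- _); rewrite -derive_dotv; last exact: smooth_on_derivable Dbs Wx.
  apply: (open_eq_derive _ Wo _ Wx) => y Wy.
  by rewrite derive_dotv //; exact: fd.
rewrite Df0 => E.
rewrite [LHS]frame_parseval -/(c x).
have DT i : 'D_(e_ a) (fun y => T y b i) x = dotv ('D_(e_ a) ('D_(e_ b) f) x) (tau i).
  rewrite -derive_dotv; last exact: smooth_on_derivable Dbs Wx.
  by apply: (open_eq_derive _ Wo _ Wx) => y Wy; rewrite mxE.
move: E; under eq_bigr do rewrite DT.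
set s1 := \sum_i _; set s2 := \sum_i _ => E.
have -> : \sum_j J x a j * (T x)^T j b = s2.
  by apply: eq_bigr => j _; rewrite [X in _ * X]mxE [J _ _ _]mxE mulrC.
have -> : dotv ('D_(e_ a) ('D_(e_ b) f) x) N0 = - (s1 + s2) by rewrite E opprK.
have -> : \sum_i dotv ('D_(e_ a) ('D_(e_ b) f) x) (tau i) * dotv (eta x) (tau i) = c x * s1.
  rewrite mulr_sumr; apply: eq_bigr => i _; rewrite (eta_tau _ W1x).
  exact: mulrCA.
by move: (c x) s1 s2 {E} => ? ? ?; ring.
Qed.

Let c0 x : W2 x -> 0 < - c x.
Proof.
case=> W1x U0; have := sp_support sp (W1W W1x); rewrite uE //.
by rewrite pmulr_lgt0.
Qed.

Let deth x : W1 x -> \det (h x) = (- c x) ^+ n * (\det (J x) * \det (T x)).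
Proof. by move=> W1x; rewrite hE // detZ det_mulmx det_tr. Qed.

Let deth0 x : W1 x -> 0 < \det (h x).
Proof.
move=> W1x; have Wx := W1W W1x.
by apply: pos_def_det; [exact: second_form_sym|exact: (sp_convex sp)].
Qed.

Let Ju x : W1 x -> J x \in unitmx.
Proof.
move=> W1x; have := deth0 W1x; rewrite deth // unitmxE unitfE.
by apply: contraTN => /eqP->; rewrite mul0r mulr0 ltxx.
Qed.

Local Notation D := (frame_deriv G).
Local Notation H := (gnomonic_hessian G P).

Let HE x : W1 x -> H x = G x *m T x.
Proof.
move=> W1x; apply/matrixP => i j; rewrite !mxE; apply: eq_bigr => a _.
by rewrite DP //; exact: W1W.
Qed.

Let gE x : W1 x -> g x = T x *m (1%:M + (\row_i X i x)^T *m \row_i X i x) *m (T x)^T.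
Proof.
move=> W1x; have Wx := W1W W1x.
pose F := \col_a 'D_(e_ a) f0 x.
have TXc : T x *m (\row_i X i x)^T = - F.
  apply/colP => a; rewrite !mxE -(TX a W1x).
  by apply: eq_bigr => i _; rewrite !mxE.
have -> : T x *m (1%:M + (\row_i X i x)^T *m \row_i X i x) *m (T x)^T
   = T x *m (T x)^T + F *m F^T.
  rewrite mulmxDr mulmx1 mulmxDl; congr (_ + _).
  rewrite !mulmxA TXc -mulmxA -[\row_i X i x]trmxK -trmx_mul TXc.
  by rewrite linearN /= mulmxN mulNmx opprK.
apply/matrixP => a b; rewrite !mxE frame_parseval; congr (_ + _).
  by apply: eq_bigr => i _; rewrite !mxE.
rewrite big_ord_recl big_ord0 addr0 !mxE.
by rewrite !derive_dotv //; exact: fd.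
Qed.

Let detg x : W1 x -> \det (g x) = \det (T x) * \det (T x) * (1 + sqr_radius X x).
Proof.
move=> W1x; rewrite gE // !det_mulmx det_tr det_1_plus_outer mulrAC; congr (_ * (_ + _)).
by rewrite dotvE; apply: eq_bigr => i _; rewrite !mxE.
Qed.

Let detH x : W2 x -> 0 < \det (H x) /\
  \det (h x) / \det (g x) = (- c x) ^+ n / (\det (H x) * (1 + sqr_radius X x)).
Proof.
move=> W2x; have W1x := W21 W2x.
have d0 := deth0 W1x; rewrite deth // pmulr_rgt0 in d0; last exact: exprn_gt0 (c0 W2x).
have dT : \det (T x) != 0 by have := Tu W1x; rewrite unitmxE unitfE.
have dJ : \det (J x) != 0 by have := Ju W1x; rewrite unitmxE unitfE.
have r0 := sqr_radius1_gt0 X x.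
have HD : \det (H x) = \det (T x) / \det (J x).
  by rewrite HE // det_mulmx det_inv mulrC.
split.
  have -> : \det (H x) = (\det (J x) * \det (T x)) / \det (J x) ^+ 2.
    by rewrite HD; move: (\det (T x)) (\det (J x)) dJ => ? ? dJ; field.
  by rewrite divr_gt0 // exprn_even_gt0.
rewrite deth // detg // HD; move: (sqr_radius X x) r0 => r r0.
by field; rewrite dT dJ gt_eqF.
Qed.

(** The equation comes from K = [(- c)^n / (\det H (1 + |X|^2))], u = [- c U] and
    [c^2 (1 + |X|^2) = 1]: the factor [1 + |X|^2] acts as two more powers of [- c], whence the
    exponent [n + 2 - beta], halved. *)
Lemma patch_gnomonic : gnomonic gnomonic_dom G X P U beta.
Proof.
have J2s a k : smooth_on W2 (fun x => J x a k).
  apply: (smooth_on_eq W2o _ (smooth_on_derive (e_ a) (smooth_on_sub W21 (Xs k)))) => x _.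
  by rewrite mxE.
split.
- exact: W2o.
- move=> i j; apply: (smooth_on_invmx _ _ W2o J2s) => x W2x.
  by have := Ju (W21 W2x); rewrite unitmxE unitfE.
- by move=> i; exact: smooth_on_sub W21 (Xs i).
- by move=> i; exact: smooth_on_sub W21 (smooth_on_sub W1W (Ps i)).
- exact: smooth_on_sub W21 Us.
- move=> i j x W2x; have := congr1 (fun M : 'M[R]_n => M i j) (mulVmx (Ju (W21 W2x))).
  by rewrite !mxE => <-; apply: eq_bigr => a _; rewrite [J _ _ _]mxE.
- move=> i x W2x.
  transitivity (\sum_j (\sum_a G x i a * J x a j) * P j x).
    rewrite /frame_deriv; under eq_bigr => a _ do rewrite (DU _ (W21 W2x)) mulr_sumr.
    rewrite exchange_big /=; apply: eq_bigr => j _; rewrite mulr_suml.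
    by apply: eq_bigr => a _; rewrite mulrA.
  have GJ j : \sum_a G x i a * J x a j = (i == j)%:R.
    by have := congr1 (fun M : 'M[R]_n => M i j) (mulVmx (Ju (W21 W2x))); rewrite !mxE.
  rewrite (bigD1 i) //= GJ eqxx mul1r big1 ?addr0 // => j ji.
  by rewrite GJ eq_sym (negbTE ji) mul0r.
- by move=> x [].
- by move=> x /detH[].
move=> x W2x; have W1x := W21 W2x; have [dH E] := detH W2x.
have := sp_eq sp (W1W W1x); rewrite E uE //.
have cx := c0 W2x; have U0 : 0 < U x by case: W2x.
have r0 := sqr_radius1_gt0 X x.
rewrite lnM ?posrE ?exprn_gt0 ?invr_gt0 ?mulr_gt0 // lnV ?posrE ?mulr_gt0 //.
rewrite lnXn // lnM ?posrE // lnM ?posrE //.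
have := cc W1x; rewrite -[c x * c x]mulrNN => /(congr1 (@ln R)).
rewrite lnM ?posrE ?mulr_gt0 // lnM ?posrE // ln1 => lc.
set lr := ln (1 + _) in lc *; set lcx := ln (- c x) in lc *.
have -> : lr = - (lcx + lcx) by apply/eqP; rewrite -addr_eq0 addrC lc.
rewrite -mulr_natl => E'.
have -> : ln (\det (H x)) = n%:R * lcx + (lcx + lcx) - beta * (lcx + ln (U x)).
  by rewrite -E'; ring.
by field.
Qed.

Let T0 : T x0 = g x0 *m L^T.
Proof.
apply/matrixP => a i; rewrite !mxE /tau (patch_derive (row i L) Wx0) dotvC dotv_suml.
apply: eq_bigr => b _; rewrite [row i L 0 b]mxE [L^T _ _]mxE [g x0 _ _]mxE.
exact: (etrans (dotvZl _ _ _) (etrans (congr1 _ (dotvC _ _)) (mulrC _ _))).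
Qed.

Let LT0 : L *m T x0 = 1%:M. Proof. by rewrite T0 mulmxA. Qed.

Let Df0_0 v : 'D_v f0 x0 = 0.
Proof.
by rewrite derive_dotv ?dotvNr ?(sp_normal sp) ?oppr0 //; exact: fd.
Qed.

Let X00 i : X i x0 = 0.
Proof. by rewrite /X big1 ?oppr0 // => a _; rewrite Df0_0 mulr0. Qed.

Let W1x0 : W1 x0.
Proof.
split=> //; rewrite exprn_even_gt0 //=.
by have [_] := mulmx1_unit LT0; rewrite unitmxE unitfE.
Qed.

Let Ux0 : U x0 = - dotv (f x0) (eta x0).
Proof.
rewrite /U big1 ?addr0 => [|i _]; first by rewrite /f0 dotvNr.
by rewrite X00 mul0r.
Qed.

Let W2x0 : W2 x0.
Proof. by split; [exact: W1x0|rewrite Ux0; exact: (sp_support sp)]. Qed.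

Let c00 : c x0 = -1.
Proof. by rewrite /c dotvNr (sp_unit sp). Qed.

Let d0 i : 0 < d 0 i.
Proof.
have -> : d 0 i = (row i L *m h x0 *m (row i L)^T) 0 0.
  have := congr1 (fun M : 'M[R]_n => M i i) Lh; rewrite [RHS]mxE eqxx mulr1n => <-.
  by rewrite -row_mul !mxE; apply: eq_bigr => j _; rewrite !mxE.
apply: (sp_convex sp) => //; apply/eqP => r0.
have := congr1 (fun M : 'M[R]_n => M i i) LT0; rewrite [RHS]mxE eqxx.
have -> : (L *m T x0) i i = (row i L *m T x0) 0 i by rewrite -row_mul [RHS]mxE.
by rewrite r0 mul0mx => /eqP; rewrite mxE eq_sym oner_eq0.
Qed.

Let JH0 : J x0 = T x0 *m diag_mx d.
Proof.
have [Lu Tu0] := mulmx1_unit LT0.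
have LTt : (T x0)^T *m L^T = 1%:M by rewrite -trmx_mul LT0 trmx1.
have hJ : h x0 = J x0 *m (T x0)^T by rewrite (hE W1x0) c00 opprK scale1r.
have TL : T x0 *m L = 1%:M := mulmx1C LT0.
by rewrite -Lh hJ !mulmxA TL mul1mx -mulmxA LTt mulmx1.
Qed.

Lemma frame_hessian0 i j : H x0 i j = (i == j)%:R * (d 0 i)^-1.
Proof.
have E : diag_mx d *m H x0 = 1%:M.
  have := mulVmx (Ju W1x0); rewrite {2}JH0 mulmxA -HE // => HD.
  exact: mulmx1C.
have := congr1 (fun M : 'M[R]_n => M i j) E; rewrite mul_diag_mx !mxE => dH.
apply: (mulfI (lt0r_neq0 (d0 i))); rewrite dH mulrCA mulfV ?mulr1 //.
by rewrite gt_eqF.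
Qed.

Lemma frame_TJ0 v i : dotv ('D_v f x0) (tau i) = (d 0 i)^-1 * 'D_v (X i) x0.
Proof.
have Xd : differentiable (X i) x0 by exact: smooth_on_differentiable (Xs i) W1x0.
have TJ a : dotv ('D_(e_ a) f x0) (tau i) = (d 0 i)^-1 * 'D_(e_ a) (X i) x0.
  have := congr1 (fun M : 'M[R]_n => M a i) JH0; rewrite mul_mx_diag !mxE => ->.
  by rewrite mulrC mulfK // gt_eqF.
rewrite (patch_derive v Wx0) dotv_suml (derive_basis v Xd) mulr_sumr.
by apply: eq_bigr => a _; rewrite dotvZl TJ; exact: mulrCA.
Qed.

Lemma frame_barrier w q x :
  w + q / 2 * dotv (f x) (f x) = barrier X P U w q x.
Proof.
rewrite /barrier frame_parseval -/(f0 x) (_ : U x - _ = f0 x) //.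
by rewrite /U addrK.
Qed.

(** Expresses u^2 through the smooth functions [U] and [X]; this is how the support function becomes
    differentiable although [eta] has no assumed regularity. *)
Lemma frame_sqr_support x : gnomonic_dom x ->
  dotv (f x) (eta x) ^+ 2 * (1 + sqr_radius X x) = U x ^+ 2.
Proof.
move=> /W21 W1x; rewrite -sqrrN uE //.
transitivity (c x * c x * (1 + sqr_radius X x) * U x ^+ 2); last by rewrite cc // mul1r.
by move: (c x) (U x) (sqr_radius X x) => ? ? ?; ring.
Qed.

Definition curv_le w q x := forall v,
  - dotv (f x) (eta x) * dotv (v *m g x) v <=
  (w + q / 2 * dotv (f x) (f x)) * dotv (v *m h x) v.

Let Xr x : 'rV[R]_n := \row_i X i x.

Let XrE x : dotv (Xr x) (Xr x) = sqr_radius X x.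
Proof. by rewrite dotvE; apply: eq_bigr => i _; rewrite !mxE. Qed.

Let quad_g x y : W2 x ->
  dotv (y *m G x *m g x) (y *m G x) =
  dotv (y *m H x) (y *m H x) + dotv (y *m H x) (Xr x) * dotv (y *m H x) (Xr x).
Proof.
move=> /W21 W1x; rewrite gE // HE //.
set v := y *m G x.
have -> : v *m (T x *m (1%:M + (\row_i X i x)^T *m \row_i X i x) *m (T x)^T) =
   (v *m T x *m (1%:M + (Xr x)^T *m Xr x)) *m (T x)^T by rewrite !mulmxA.
rewrite dotv_mulmxl trmxK -/v.
have -> : y *m (G x *m T x) = v *m T x by rewrite mulmxA.
rewrite mulmxDr mulmx1 dotvDl; congr (_ + _).
rewrite mulmxA [v *m T x *m (Xr x)^T]mx11_scalar -dotv_mx mul_scalar_mx dotvZl.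
by congr (_ * _); exact: dotvC.
Qed.

Let quad_h x y : W2 x ->
  dotv (y *m G x *m h x) (y *m G x) = - c x * dotv y (y *m H x).
Proof.
move=> /W21 W1x; rewrite hE // HE // -scalemxAr dotvZl; congr (_ * _).
have GJ : y *m G x *m J x = y by exact: mulmxKV (Ju W1x) y.
have -> : y *m G x *m (J x *m (T x)^T) = y *m (T x)^T by rewrite [LHS]mulmxA GJ.
by rewrite dotv_mulmxl trmxK mulmxA.
Qed.

Lemma dotv_row_mx p (a a' : 'rV[R]_n) (b b' : 'rV[R]_p) :
  dotv (row_mx a b) (row_mx a' b') = dotv a a' + dotv b b'.
Proof. by rewrite !dotv_mx tr_row_mx mul_row_col mxE. Qed.

(** The Hessian [H] is inverse to the curvature, so the inequality between the forms has to be
    inverted. For [z = y *m H x] it bounds the form of [1 + X^T X] at [z] by [E <y, z> / U], and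
    Cauchy-Schwarz for that form bounds [<y, z>^2] by this quantity times the inverse form at [y];
    dividing by [<y, z>] concludes. *)
Lemma frame_curv_le w q x y : gnomonic_dom x -> curv_le w q x ->
  (1 + sqr_radius X x) * U x * dotv y (y *m H x) <=
  (w + q / 2 * dotv (f x) (f x)) * (dotv y y * (1 + sqr_radius X x)
     - dotv (Xr x) y * dotv (Xr x) y).
Proof.
move=> W2x cle; have W1x := W21 W2x.
have [->|y0] := eqVneq y 0; first by rewrite !(dotv0l, dotv0r) !(mul0r, mulr0) subrr mulr0.
have v0 : y *m G x != 0.
  apply/eqP => v0; case/negP: y0; apply/eqP.
  by rewrite -[y](mulmxKV (Ju W1x)) v0 mul0mx.
have cx := c0 W2x; have U0 : 0 < U x by case: W2x.
have := cle (y *m G x); rewrite quad_g // quad_h // uE //.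
set E := w + _; set z := y *m H x.
have yz : 0 < dotv y z.
  have := sp_convex sp (W1W W1x) v0; rewrite -dotv_mx quad_h // -/z.
  by rewrite pmulr_rgt0.
rewrite [E * _]mulrCA -mulrA ler_pM2l // => US.
set r2 := sqr_radius X x; set a := dotv (Xr x) y.
have r0 : 0 < 1 + r2 := sqr_radius1_gt0 X x.
(* [Y] is [1 + r2] times the image of [y] under the inverse of [1 + X^T X]. The extra coordinate
   realizes the form of [1 + X^T X] as a Euclidean norm; for [Y] it is [<X, Y> = a], with both signs
   reversed. *)
pose Y := (1 + r2) *: y - a *: Xr x.
have CS := cauchy_schwarz (row_mx z (- dotv z (Xr x))%:M : 'rV[R]_(n + 1)) (row_mx Y (- a)%:M).
rewrite !dotv_row_mx in CS.
have sc (s t : R) : dotv (s%:M : 'rV[R]_1) t%:M = s * t.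
  by rewrite dotv_mx tr_scalar_mx -scalar_mxM mxE eqxx.
have zY : dotv z Y + - dotv z (Xr x) * - a = (1 + r2) * dotv y z.
  by rewrite /Y dotvBr !dotvZr (dotvC z y); ring.
have YY : dotv Y Y + - a * - a = (1 + r2) * (dotv y y * (1 + r2) - a * a).
  rewrite /Y !(dotvBl, dotvBr, dotvZl, dotvZr) XrE -/r2 (dotvC y (Xr x)) -/a; ring.
rewrite !sc zY YY in CS.
set S := dotv z z + dotv z (Xr x) * dotv z (Xr x) in US.
set M := dotv y y * (1 + r2) - a * a in CS *.
have M0 : 0 <= M.
  rewrite -(pmulr_rge0 _ r0) -YY addr_ge0 ?dotvv_ge0 //.
  by rewrite mulrNN -expr2 sqr_ge0.
have CS' : (1 + r2) * (dotv y z * dotv y z) <= S * M.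
  rewrite -(ler_pM2l r0).
  move: CS; rewrite mulrNN -/S => CS; apply: le_trans (le_trans _ CS) _; rewrite le_eqVlt.
    by apply/orP; left; apply/eqP; ring.
  by apply/orP; left; apply/eqP; ring.
rewrite -(ler_pM2r yz).
apply: (@le_trans _ _ (U x * (S * M))).
  have -> : (1 + r2) * U x * dotv y z * dotv y z = U x * ((1 + r2) * (dotv y z * dotv y z)) by ring.
  by rewrite ler_pM2l.
have -> : E * M * dotv y z = E * dotv y z * M by ring.
by rewrite mulrA ler_wpM2r.
Qed.

Lemma frame_umbilic w q x i j : gnomonic_dom x ->
  - dotv (f x) (eta x) *: g x = (w + q / 2 * dotv (f x) (f x)) *: h x ->
  (1 + sqr_radius X x) * U x * H x i j =
  (w + q / 2 * dotv (f x) (f x)) * ((i == j)%:R * (1 + sqr_radius X x) - X i x * X j x).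
Proof.
move=> W2x; have W1x := W21 W2x; rewrite uE // gE // hE // -/(Xr x).
set E := w + _; set A := 1%:M + _ => EQ.
have cx := c0 W2x.
have TTu : (T x)^T \in unitmx by rewrite unitmx_tr Tu.
have {}EQ : U x *: (H x *m A) = E%:M.
  have : U x *: (T x *m A) = E *: J x.
    apply: (can_inj (mulmxK TTu)); rewrite -!scalemxAl.
    apply: (scalerI (lt0r_neq0 cx)).
    by rewrite scalerA EQ !scalerA [E * _]mulrC.
  move=> /(congr1 (mulmx (G x))); rewrite -!scalemxAr mulmxA -HE // mulVmx ?Ju // => ->.
  by rewrite scalemx1.
(* The inverse of [A], multiplied by [1 + |X|^2]. *)
pose B : 'M[R]_n := (1 + sqr_radius X x)%:M - (Xr x)^T *m Xr x.
have AB : A *m B = (1 + sqr_radius X x)%:M.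
  rewrite /A /B mulmxDl mul1mx mulmxBr mul_mx_scalar.
  have -> : (Xr x)^T *m Xr x *m ((Xr x)^T *m Xr x) = sqr_radius X x *: ((Xr x)^T *m Xr x).
    rewrite mulmxA -[(Xr x)^T *m Xr x *m _]mulmxA.
    by rewrite [Xr x *m (Xr x)^T]mx11_scalar -dotv_mx XrE mul_mx_scalar -scalemxAl.
  by rewrite scalerDl scale1r addrK subrK.
have := congr1 (fun M : 'M[R]_n => (M *m B) i j) EQ.
rewrite -scalemxAl -mulmxA AB mul_mx_scalar mul_scalar_mx !mxE => HB.
rewrite -mulrA mulrCA [LHS]HB big_ord_recl big_ord0 addr0 !mxE.
by congr (_ * (_ - _)); rewrite mulr_natl.
Qed.

Let DvU v : 'D_v U x0 = \sum_i 'D_v (X i) x0 * P i x0.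
Proof.
have Ud : differentiable U x0 by exact: smooth_on_differentiable Us W1x0.
rewrite (derive_basis v Ud).
under eq_bigr => a _ do rewrite (DU a W1x0) mulr_sumr.
rewrite exchange_big /=; apply: eq_bigr => i _.
have Xd : differentiable (X i) x0 by exact: smooth_on_differentiable (Xs i) W1x0.
rewrite (derive_basis v Xd) mulr_suml; apply: eq_bigr => a _.
by rewrite [J _ _ _]mxE mulrA.
Qed.

(** Differentiates u^2 = [U^2 / (1 + |X|^2)] at the centre, where the denominator has derivative 0;
    [DvU] and [frame_TJ0] convert derivatives of [X] into those of [f], weighted by the principal
    curvatures. *)
Lemma frame_derive_support v :
  is_derive x0 v (fun x => dotv (f x) (eta x) ^+ 2 : R)
    (2 * - dotv (f x0) (eta x0) *
      \sum_i d 0 i * (dotv ('D_v f x0) (tau i) * dotv (f x0) (tau i))) /\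
  differentiable (fun x => dotv (f x) (eta x) ^+ 2 : R) x0.
Proof.
have r1s : smooth_on W1 (fun x => 1 + sqr_radius X x).
  apply: (smooth_onD W1o); first exact: smooth_on_cst.
  by apply: (smooth_on_sum _ _ W1o) => i; exact: (smooth_onM W1o (Xs i) (Xs i)).
have r1V : smooth_on W1 (fun x => (1 + sqr_radius X x)^-1).
  by apply: (smooth_onV W1o _ r1s) => x _; rewrite gt_eqF // sqr_radius1_gt0.
have UUs := smooth_onM W1o Us Us.
have Qs := smooth_onM W1o UUs r1V.
have near_eq : \forall x \near x0,
    U x * U x * (1 + sqr_radius X x)^-1 = dotv (f x) (eta x) ^+ 2.
  apply: (open_nearP W2o W2x0) => x W2x.
  by rewrite -expr2 -(frame_sqr_support W2x) mulfK // gt_eqF // sqr_radius1_gt0.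
have Qd : differentiable (fun x => dotv (f x) (eta x) ^+ 2 : R) x0.
  apply: (near_eq_differentiable near_eq).
  exact: smooth_on_differentiable Qs W1x0.
split=> //; apply: DeriveDef; first exact: diff_derivable.
rewrite -(near_eq_derive _ near_eq).
rewrite (smooth_derivM v UUs r1V W1x0) (smooth_derivM v Us Us W1x0).
have r0 : sqr_radius X x0 = 0 by rewrite /sqr_radius big1 // => i _; rewrite X00 mulr0.
have Dr : 'D_v (fun x => (1 + sqr_radius X x)^-1) x0 = 0.
  rewrite (@deriveV _ _ (fun x => 1 + sqr_radius X x)).
  - rewrite (_ : 'D_v _ x0 = 0) ?scaler0 //.
    have cs : smooth_on W1 (fun=> 1 : R) by exact: smooth_on_cst.
    have XXs i := smooth_onM W1o (Xs i) (Xs i).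
    rewrite (smooth_derivD v cs (smooth_on_sum _ xpredT W1o XXs) W1x0) derive_cst add0r.
    rewrite (smooth_deriv_sum _ _ W1o XXs W1x0) big1 // => i _.
    by rewrite (smooth_derivM v (Xs i) (Xs i) W1x0) X00 mulr0 mul0r addr0.
  - by rewrite gt_eqF // sqr_radius1_gt0.
  - exact: smooth_on_derivable r1s W1x0.
rewrite Dr mulr0 addr0 r0 addr0 invr1 mulr1 DvU Ux0.
have -> : \sum_i 'D_v (X i) x0 * P i x0 =
    \sum_i d 0 i * (dotv ('D_v f x0) (tau i) * dotv (f x0) (tau i)).
  apply: eq_bigr => i _; rewrite frame_TJ0 mulrA [d 0 i * _]mulrA mulfV ?mul1r //.
  by rewrite gt_eqF.
by move: (\sum_i _) (dotv _ _) => ? ?; ring.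
Qed.

Lemma frame_position : (forall i, P i x0 = 0) ->
  f x0 = dotv (f x0) (eta x0) *: eta x0.
Proof.
move=> P0; apply/eqP; rewrite -subr_eq0 -dotvv_eq0 frame_parseval.
have z0 i : dotv (f x0 - dotv (f x0) (eta x0) *: eta x0) (tau i) = 0.
  rewrite dotvBl dotvZl (_ : dotv (f x0) (tau i) = P i x0) // P0 sub0r.
  by rewrite (dotvC _ (tau i)) (sp_normal sp) // mulr0 oppr0.
rewrite big1 => [|i _]; last by rewrite z0 mul0r.
have -> : dotv (f x0 - dotv (f x0) (eta x0) *: eta x0) N0 = 0; last by rewrite mul0r addr0.
by rewrite dotvNr dotvBl dotvZl (sp_unit sp) // mulr1 subrr oppr0.
Qed.

Lemma frame_radial x i : gnomonic_dom x -> f x = dotv (f x) (eta x) *: eta x ->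
  (1 + sqr_radius X x) * P i x = U x * X i x.
Proof.
move=> /W21 W1x fE.
have sE : dotv (f x) (eta x) = c x * U x.
  by apply: oppr_inj; rewrite (uE W1x) mulNr.
rewrite /P fE dotvZl eta_tau // sE.
transitivity (c x * c x * (1 + sqr_radius X x) * (U x * X i x)).
  by move: (c x) (U x) (X i x) (sqr_radius X x) => ? ? ? ?; ring.
by rewrite cc // mul1r.
Qed.

Lemma frame_bessel a : \sum_i dotv a (tau i) * dotv a (tau i) <= dotv a a.
Proof. by rewrite [leRHS]frame_parseval lerDl -expr2 sqr_ge0. Qed.

Lemma frame_dotv_derive v a : dotv a ('D_v f x0) =
  \sum_i dotv a (tau i) * dotv ('D_v f x0) (tau i).
Proof.
have D0 : dotv ('D_v f x0) N0 = 0 by rewrite dotvNr (sp_normal sp) // oppr0.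
by rewrite frame_parseval D0 mulr0 addr0.
Qed.

(** The support function is positive, hence the square root of its differentiable square. *)
Lemma frame_support_continuous : {for x0, continuous (fun x => - dotv (f x) (eta x) : R)}.
Proof.
have [_ sd] := frame_derive_support 0.
have sc := differentiable_continuous sd.
have sE x : W x -> Num.sqrt (dotv (f x) (eta x) ^+ 2) = - dotv (f x) (eta x).
  by move=> Wx; rewrite -sqrrN sqrtr_sqr ger0_norm // ltW // (sp_support sp).
have -> : {for x0, continuous (fun x => - dotv (f x) (eta x) : R)} =
  ((fun x => - dotv (f x) (eta x) : R) @ x0 --> - dotv (f x0) (eta x0)) by [].
rewrite -(sE _ Wx0).
have sq : {for x0, continuous (fun x => Num.sqrt (dotv (f x) (eta x) ^+ 2))}.
  by apply: (@continuous_comp _ _ _ (fun x => dotv (f x) (eta x) ^+ 2) (@Num.sqrt R)) => //;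
    exact: sqrt_continuous.
have ne : \forall x \near x0,
    Num.sqrt (dotv (f x) (eta x) ^+ 2) = - dotv (f x) (eta x).
  exact: (open_nearP Wo Wx0 sE).
by apply: cvg_trans sq; apply: near_eq_cvg; [exact: nbhs_filter|exact: ne].
Qed.

(** In [hE] the factor [- c], which involves the normal, is replaced by u / [U]; the other factors
    are smooth. *)
Lemma frame_second_form_continuous i j : {for x0, continuous (fun x => h x i j)}.
Proof.
have U0 : U x0 != 0 by rewrite gt_eqF // Ux0 (sp_support sp).
pose F x := - dotv (f x) (eta x) / U x * \sum_k J x i k * T x j k.
have FE x : W2 x -> F x = h x i j.
  move=> W2x; have W1x := W21 W2x; have Ux : 0 < U x by case: W2x.
  rewrite /F (uE W1x) mulfK ?gt_eqF // (hE W1x) !mxE; congr (_ * _).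
  by apply: eq_bigr => k _; rewrite [_^T _ _]mxE.
have -> : {for x0, continuous (fun x => h x i j)} =
  ((fun x => h x i j) @ x0 --> h x0 i j) by [].
rewrite -(FE _ W2x0).
have J1 k : smooth_on W1 (fun x => J x i k).
  apply: (smooth_on_eq W1o _ (smooth_on_derive (e_ i) (Xs k))) => x _; by rewrite mxE.
have JT : smooth_on W1 (fun x => \sum_k J x i k * T x j k).
  apply: (smooth_on_sum _ _ W1o) => k; apply: (smooth_onM W1o (J1 k)).
  exact: smooth_on_sub W1W (Ts j k).
have Fc : {for x0, continuous F}.
  apply: continuousM; last exact: smooth_on_continuous JT W1x0.
  apply: continuousM; first exact: frame_support_continuous.
  by apply: continuousV => //; exact: smooth_on_continuous Us W1x0.
have ne : \forall x \near x0, F x = h x i j by exact: (open_nearP W2o W2x0 FE).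
by apply: cvg_trans Fc; apply: near_eq_cvg; [exact: nbhs_filter|exact: ne].
Qed.

(** The properties of the gnomonic chart that the later arguments use, detached from its
    construction. *)
Record adapted_frame (tau' : 'I_n -> E_) (W' : set V) (G' : V -> 'M[R]_n)
    (X' P' : 'I_n -> V -> R) (U' : V -> R) : Prop := AdaptedFrame {
  af_gnomonic : gnomonic W' G' X' P' U' beta;
  af_sub : W' `<=` W;
  af_dom : W' x0;
  af_X0 : forall i, X' i x0 = 0;
  af_H0 : forall i j, gnomonic_hessian G' P' x0 i j = (i == j)%:R * (d 0 i)^-1;
  af_U0 : U' x0 = - dotv (f x0) (eta x0);
  af_d : forall i, 0 < d 0 i;
  af_barrier : forall w q x, w + q / 2 * dotv (f x) (f x) = barrier X' P' U' w q x;
  af_curv_le : forall w q x y, W' x -> curv_le w q x ->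
    (1 + sqr_radius X' x) * U' x * dotv y (y *m gnomonic_hessian G' P' x) <=
    (w + q / 2 * dotv (f x) (f x)) * (dotv y y * (1 + sqr_radius X' x)
     - dotv (\row_i X' i x) y * dotv (\row_i X' i x) y);
  af_umbilic : forall w q x i j, W' x ->
    - dotv (f x) (eta x) *: g x = (w + q / 2 * dotv (f x) (f x)) *: h x ->
    (1 + sqr_radius X' x) * U' x * gnomonic_hessian G' P' x i j =
    (w + q / 2 * dotv (f x) (f x)) *
      ((i == j)%:R * (1 + sqr_radius X' x) - X' i x * X' j x);
  af_position : (forall i, P' i x0 = 0) -> f x0 = dotv (f x0) (eta x0) *: eta x0;
  af_radial : forall x i, W' x -> f x = dotv (f x) (eta x) *: eta x ->
    (1 + sqr_radius X' x) * P' i x = U' x * X' i x;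
  af_bessel : forall a, \sum_i dotv a (tau' i) * dotv a (tau' i) <= dotv a a;
  af_dotv_derive : forall v a, dotv a ('D_v f x0) =
    \sum_i dotv a (tau' i) * dotv ('D_v f x0) (tau' i);
  af_derive_support : forall v,
    is_derive x0 v (fun x => dotv (f x) (eta x) ^+ 2 : R)
    (2 * - dotv (f x0) (eta x0) *
      \sum_i d 0 i * (dotv ('D_v f x0) (tau' i) * dotv (f x0) (tau' i)));
  af_differentiable : differentiable (fun x => dotv (f x) (eta x) ^+ 2 : R) x0
}.

Theorem adapted_frame_exists : exists tau' W' G' X' P' U', adapted_frame tau' W' G' X' P' U'.
Proof.
exists tau, W2, G, X, P, U; split.
- exact: patch_gnomonic.
- by move=> x /W21 /W1W.
- exact: W2x0.
- exact: X00.
- exact: frame_hessian0.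
- exact: Ux0.
- exact: d0.
- exact: frame_barrier.
- exact: frame_curv_le.
- exact: frame_umbilic.
- exact: frame_position.
- exact: frame_radial.
- exact: frame_bessel.
- exact: frame_dotv_derive.
- by move=> v; case: (frame_derive_support v).
- by case: (frame_derive_support 0).
Qed.

End Frame.
Lemma support_continuous x : W x -> {for x, continuous (fun y => - dotv (f y) (eta y) : R)}.
Proof.
move=> Wx; have [L [d [Lg Lh]]] := patch_diagonalization Wx.
exact: (frame_support_continuous Wx Lg Lh).
Qed.

Lemma second_form_continuous x i j : W x -> {for x, continuous (fun y => h y i j)}.
Proof.
move=> Wx; have [L [d [Lg Lh]]] := patch_diagonalization Wx.
exact: (frame_second_form_continuous Wx Lg Lh).
Qed.

End Patch.

Lemma ln_prod (R : realType) (I : Type) (r : seq I) (F : I -> R) :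
  (forall i, 0 < F i) -> ln (\prod_(i <- r) F i) = \sum_(i <- r) ln (F i).
Proof.
move=> F0; elim: r => [|i r IH]; first by rewrite !big_nil ln1.
by rewrite !big_cons lnM ?posrE ?IH ?prodr_gt0.
Qed.

(** * Contact points, pinching and the gradient of the defect *)

Section PatchTheorems.
Variables (R : realType) (n : nat) (beta q : R) (W : set 'rV[R]_n) (f eta : 'rV[R]_n -> 'rV[R]_n.+1).
Hypotheses (n2 : (2 <= n)%N) (beta0 : 0 < beta) (q0 : 0 < q) (q1 : q < 1)
  (nq : n%:R * (1 - q) = beta) (sp : soliton_patch beta W f eta).
Local Notation V := 'rV[R]_n.
Local Notation g := (metric f).
Local Notation h := (second_form f eta).
Local Notation u x := (- dotv (f x) (eta x)).
Local Notation E w x := (w + q / 2 * dotv (f x) (f x)).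
Let n0 : 0 < n%:R :> R.
Proof. by rewrite ltr0n (leq_trans _ n2). Qed.

Let mul_div_cancel (a b c : R) : 0 < b -> b * (a / b * c) = a * c.
Proof. by move=> b0; field; rewrite gt_eqF. Qed.

Lemma dotv_congruence (L A : 'M[R]_n) (z : 'rV[R]_n) :
  dotv (z *m L *m A) (z *m L) = dotv (z *m (L *m A *m L^T)) z.
Proof. by rewrite [RHS]dotvC [in RHS]mulmxA -[RHS]dotv_mulmxl dotvC !mulmxA. Qed.

Lemma dotv_diag (d z : 'rV[R]_n) : dotv (z *m diag_mx d) z = \sum_i d 0 i * (z 0 i * z 0 i).
Proof.
rewrite dotvE; apply: eq_bigr => i _.
rewrite mul_mx_diag !mxE; ring.
Qed.

Section AtPoint.
Variables (w : R) (x : V) (L : 'M[R]_n) (d : 'rV[R]_n).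
Hypotheses (Wx : W x) (Lg : L *m g x *m L^T = 1%:M) (Lh : L *m h x *m L^T = diag_mx d).

Lemma curv_le_diag i : curv_le f eta w q x -> u x <= E w x * d 0 i.
Proof.
move=> /(_ (basis_vec R i *m L)); rewrite !dotv_congruence Lg Lh mulmx1 dotv_basis dotv_diag.
rewrite [basis_vec R i 0 i]mxE !eqxx mulr1 (bigD1 i) //= big1 ?addr0.
  by rewrite [basis_vec R i 0 i]mxE !eqxx !mulr1.
by move=> j ji; rewrite [basis_vec R i 0 j]mxE (negbTE ji) andbF mulr0 mulr0.
Qed.

Lemma frame_d_gt0 i : 0 < d 0 i.
Proof.
have [? [? [? [? [? [? af]]]]]] := adapted_frame_exists sp Wx Lg Lh.
exact: af_d af i.
Qed.

Lemma curv_le_barrier_gt0 : curv_le f eta w q x -> 0 < E w x.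
Proof.
move=> cle; have i : 'I_n := Ordinal (leq_trans (isT : (0 < 2)%N) n2).
have := curv_le_diag i cle; have := sp_support sp Wx => ux h1.
by have := lt_le_trans ux h1; rewrite pmulr_lgt0 // frame_d_gt0.
Qed.

Lemma diag_eq_umbilic : (forall i, u x = E w x * d 0 i) -> u x *: g x = E w x *: h x.
Proof.
move=> ud.
have [Lu _] : L \in unitmx /\ (g x *m L^T) \in unitmx.
  by apply: mulmx1_unit; rewrite mulmxA.
have LTu : L^T \in unitmx by rewrite unitmx_tr.
apply: (can_inj (mulKmx Lu)); apply: (can_inj (mulmxK LTu)) => /=.
rewrite -!scalemxAr -!scalemxAl Lg Lh.
apply/matrixP => i j; rewrite !mxE (ud j).
by case: eqVneq => [->|_] /=; rewrite ?mulr1n ?mulr1 // !mulr0n !mulr0.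
Qed.

Lemma ln_curvature : \sum_i ln (d 0 i) = beta * ln (u x).
Proof.
rewrite -(sp_eq sp Wx).
have dL : \det L != 0.
  have [Lu _] : L \in unitmx /\ (g x *m L^T) \in unitmx.
    by apply: mulmx1_unit; rewrite mulmxA.
  by rewrite unitmxE unitfE in Lu.
have g0 : 0 < \det (g x).
  by apply: pos_def_det; [exact: metric_sym|exact: (metric_pos_def sp Wx)].
have := congr1 (fun M : 'M[R]_n => \det M) Lg; rewrite !det_mulmx det_tr det1 => dg.
have := congr1 (fun M : 'M[R]_n => \det M) Lh; rewrite !det_mulmx det_tr det_diag => dh.
have -> : \det (h x) / \det (g x) = \prod_i d 0 i.
  rewrite -dh; apply: (mulIf (lt0r_neq0 g0)); rewrite divfK ?gt_eqF //.
  transitivity (\det (h x) * (\det L * \det (g x) * \det L)); first by rewrite dg mulr1.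
  by move: (\det L) (\det (g x)) (\det (h x)) => ? ? ?; ring.
by rewrite ln_prod // => i; exact: frame_d_gt0.
Qed.

End AtPoint.

(* Strong form of the maximum principle: contact forces an umbilic point. *)
Theorem patch_touching w x0 v0 : (forall x, W x -> curv_le f eta w q x) -> W x0 ->
  v0 != 0 -> u x0 * dotv (v0 *m g x0) v0 = E w x0 * dotv (v0 *m h x0) v0 ->
  ln (E w x0) = q * ln (u x0).
Proof.
move=> cle Wx0 v00 touch.
have [L [d [Lg Lh]]] := patch_diagonalization sp Wx0.
have [Lu _] : L \in unitmx /\ (g x0 *m L^T) \in unitmx.
  by apply: mulmx1_unit; rewrite mulmxA.
have [tau [W' [G [X [P [U af]]]]]] := adapted_frame_exists sp Wx0 Lg Lh.
have d0 := af_d af; have u0 := sp_support sp Wx0.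
have E0 := curv_le_barrier_gt0 Wx0 Lg Lh (cle _ Wx0).
have ud i := curv_le_diag Lg Lh i (cle _ Wx0).
(* In the principal basis contact says that [\sum_i (E d_i - u) z_i^2 = 0] with nonnegative terms,
   so equality holds at any index where the direction has a nonzero coordinate. *)
have [k uk] : exists k, u x0 = E w x0 * d 0 k.
  have [z zL] : exists z, v0 = z *m L by exists (v0 *m invmx L); rewrite mulmxKV.
  have z0 : z != 0 by apply: contra_neq v00 => z0; rewrite zL z0 mul0mx.
  have [k zk] : exists k, z 0 k != 0.
    apply/existsP; apply: contraNT z0; rewrite negb_exists => /forallP zz.
    by apply/eqP/rowP => k; rewrite [RHS]mxE; apply/eqP; have := zz k; rewrite negbK.
  exists k; move: touch; rewrite zL !dotv_congruence Lg Lh mulmx1 dotv_diag (dotvE z z) [LHS]mulr_sumr [RHS]mulr_sumr.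
  move/eqP; rewrite eq_sym -subr_eq0 -sumrB psumr_eq0 => [/allP zz|i _]; last first.
    by rewrite [E w x0 * _]mulrA -mulrBl; apply: mulr_ge0; [rewrite subr_ge0; exact: ud|rewrite -expr2 sqr_ge0].
  have := zz k (mem_index_enum _); rewrite /= [E w x0 * _]mulrA -mulrBl !mulf_eq0 !(negbTE zk) !orbF.
  by rewrite subr_eq0 => /eqP ->.
have bE i : (d 0 i)^-1 = (d 0 k)^-1.
  apply: (gnomonic_umbilic (af_gnomonic af) (af_dom af) (af_X0 af) (af_H0 af) _ n2 beta0 q0 nq).
  - by move=> j; rewrite invr_gt0.
  - move=> j; rewrite lef_pV2 ?posrE // -(ler_pM2l E0) -uk; exact: ud.
  - by rewrite -(af_barrier af) (af_U0 af) uk mulfK // gt_eqF.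
  move=> x v W'x.
  have := af_curv_le af (\row_i v i) W'x (cle x (af_sub af W'x)).
  rewrite -(af_barrier af).
  have -> : dotv (\row_i v i) (\row_i v i *m gnomonic_hessian G P x) =
      \sum_i \sum_j v i * (v j * gnomonic_hessian G P x i j).
    rewrite dotvE exchange_big /=; apply: eq_bigr => j _.
    by rewrite !mxE mulr_sumr; apply: eq_bigr => i0 _; rewrite !mxE; ring.
  have -> : dotv (\row_i v i) (\row_i v i) = \sum_i v i * v i.
    by rewrite dotvE; apply: eq_bigr => j _; rewrite !mxE.
  have -> : dotv (\row_i X i x) (\row_i v i) = \sum_i X i x * v i.
    by rewrite dotvE; apply: eq_bigr => j _; rewrite !mxE.
  by [].
have := ln_curvature Wx0 Lg Lh.
have -> : \sum_i ln (d 0 i) = n%:R * ln (d 0 k).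
  transitivity (\sum_(i < n) ln (d 0 k)); last by rewrite sumr_const card_ord mulr_natl.
  by apply: eq_bigr => i _; congr ln; apply: invr_inj; exact: bE.
rewrite -nq => lnd'.
have lnd : ln (d 0 k) = (1 - q) * ln (u x0).
  by apply: (mulfI (lt0r_neq0 n0)); rewrite lnd' mulrA.
have := congr1 (@ln R) uk; rewrite lnM ?posrE // lnd => lnu.
have -> : ln (E w x0) = ln (u x0) - (1 - q) * ln (u x0) by rewrite {1}lnu addrK.
by ring.
Qed.

(** Equal to ln E_w - q ln u, written with u^2 because the gnomonic chart gives the
    differentiability of u^2. *)
Definition defect w x := ln (E w x) - q / 2 * ln (dotv (f x) (eta x) ^+ 2).

Lemma defectE w x : W x -> defect w x = ln (E w x) - q * ln (u x).
Proof.
move=> Wx; have u0 := sp_support sp Wx.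
rewrite /defect -sqrrN lnXn // mulr2n; congr (_ - _).
by move: (ln (u x)) => l; field.
Qed.

(** The inequality of forms makes every ratio E d_i / u at least 1, and the equation,
    [\sum_i ln (d 0 i) = n (1 - q) ln u], makes their product [expR (n * defect)]; hence each ratio
    is at most the product. *)
Lemma defect_pinching w (x : V) (L : 'M[R]_n) (d : 'rV[R]_n) : W x -> L *m g x *m L^T = 1%:M -> L *m h x *m L^T = diag_mx d ->
  curv_le f eta w q x -> forall i,
  1 <= E w x / u x * d 0 i <= expR (n%:R * defect w x).
Proof.
move=> Wx Lg Lh cle; have u0 := sp_support sp Wx.
have E0 := curv_le_barrier_gt0 Wx Lg Lh cle.
have d0 := frame_d_gt0 Wx Lg Lh.
have ge1 i : 1 <= E w x / u x * d 0 i.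
  rewrite -(ler_pM2l u0) mulr1 mul_div_cancel //.
  exact: (curv_le_diag Lg Lh i cle).
have pos i : 0 < E w x / u x * d 0 i by rewrite (lt_le_trans ltr01) // ge1.
have <- : \prod_i (E w x / u x * d 0 i) = expR (n%:R * defect w x).
  rewrite -[LHS]lnK ?posrE ?prodr_gt0 //; congr expR.
  rewrite ln_prod //.
  transitivity (\sum_i (ln (E w x) - ln (u x) + ln (d 0 i))).
    by apply: eq_bigr => i _; rewrite lnM ?posrE ?divr_gt0 // ln_div ?posrE.
  rewrite big_split /= (ln_curvature Wx Lg Lh) sumr_const card_ord defectE // -nq.
  by rewrite -mulr_natl; ring.
move=> i; rewrite ge1 /= (bigD1 i) //= ler_peMr ?(ltW (pos i)) //.
elim/big_ind: _ => // a b a1 b1.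
by rewrite -[1]mulr1 ler_pM.
Qed.

Lemma defect_ge0 w x : W x -> curv_le f eta w q x -> 0 <= defect w x.
Proof.
move=> Wx cle.
have [L [d [Lg Lh]]] := patch_diagonalization sp Wx.
have i : 'I_n := Ordinal (leq_trans (isT : (0 < 2)%N) n2).
have /andP[h1 h2] := defect_pinching Wx Lg Lh cle i.
by have := le_trans h1 h2; rewrite -[X in X <= _]expR0 ler_expR pmulr_rge0.
Qed.

Lemma defect0_umbilic w x : W x -> curv_le f eta w q x -> defect w x = 0 ->
  u x *: g x = E w x *: h x.
Proof.
move=> Wx cle dz.
have [L [d [Lg Lh]]] := patch_diagonalization sp Wx.
apply: (diag_eq_umbilic Lg Lh) => i.
have := defect_pinching Wx Lg Lh cle i; rewrite dz mulr0 expR0 => h1.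
have {}h1 : E w x / u x * d 0 i = 1 by apply/le_anti; rewrite andbC.
have u0 := sp_support sp Wx.
by have := mul_div_cancel (E w x) (d 0 i) u0; rewrite h1 mulr1.
Qed.

Lemma smooth_sqr_norm : smooth_on W (fun x => dotv (f x) (f x)).
Proof. exact: smooth_dotv_dotv (sp_open sp) (sp_smooth sp) (sp_smooth sp). Qed.

Lemma derive_sqr_norm x v : W x ->
  'D_v (fun x => dotv (f x) (f x)) x = 2 * dotv (f x) ('D_v f x).
Proof.
move=> Wx.
rewrite (smooth_derive_dotv (sp_open sp) (sp_smooth sp) (sp_smooth sp) v Wx).
by rewrite [X in X + _]dotvC; move: (dotv _ _) => t; ring.
Qed.

(** The derivative is q / E times the sum of [<f, tau i> <D_v f, tau i> (1 - E d_i / u)]. The last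
    factors are controlled by the pinching, the others by the Bessel inequality. *)
Lemma defect_derive w (x v : V) : W x -> curv_le f eta w q x ->
  differentiable (defect w) x /\
  `|'D_v (defect w) x| <= q / E w x * (expR (n%:R * defect w x) - 1) *
     ((dotv (f x) (f x) + dotv ('D_v f x) ('D_v f x)) / 2).
Proof.
move=> Wx cle; have u0 := sp_support sp Wx.
have [L [d [Lg Lh]]] := patch_diagonalization sp Wx.
have E0 := curv_le_barrier_gt0 Wx Lg Lh cle.
have [tau [W' [G [X [P [U af]]]]]] := adapted_frame_exists sp Wx Lg Lh.
have pinch := defect_pinching Wx Lg Lh cle.
have Wo := sp_open sp.
have Es : smooth_on W (fun x => E w x).
  apply: smooth_onD => //; first exact: smooth_on_cst.
  by apply: smooth_onM => //; [exact: smooth_on_cst|exact: smooth_sqr_norm].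
have Ed : differentiable (fun x => E w x) x by exact: smooth_on_differentiable Es Wx.
have lEd := @differentiable_ln R _ (fun y => E w y) x E0 Ed.
have s0 : 0 < dotv (f x) (eta x) ^+ 2 by rewrite -sqrrN exprn_gt0.
have sd := af_differentiable af.
have lsd := @differentiable_ln R _ (fun y => dotv (f y) (eta y) ^+ 2) x s0 sd.
have csd : differentiable (fun=> q / 2 : R) x by exact: differentiable_cst.
have cls : differentiable (fun y => q / 2 * ln (dotv (f y) (eta y) ^+ 2)) x.
  exact: (@differentiableM _ _ (fun=> q / 2) _ _ csd lsd).
split; first exact: (@differentiableB _ _ _ (fun y => ln (E w y)) _ _ lEd cls).
have DE : 'D_v (fun x => E w x) x = q * \sum_i dotv (f x) (tau i) * dotv ('D_v f x) (tau i).
  have nfs := smooth_sqr_norm.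
  have cs (a : R) : smooth_on W (fun=> a) by exact: smooth_on_cst.
  rewrite (smooth_derivD v (cs w) (smooth_onM Wo (cs (q / 2)) nfs) Wx).
  rewrite (smooth_derivM v (cs (q / 2)) nfs Wx) !derive_cst mul0r !add0r.
  rewrite derive_sqr_norm // (af_dotv_derive af).
  by rewrite mulrA divfK // pnatr_eq0.
have Ds := af_derive_support af v.
have -> : 'D_v (defect w) x = q / E w x * \sum_i
    (dotv (f x) (tau i) * dotv ('D_v f x) (tau i)) * (1 - E w x / u x * d 0 i).
  have dE : derivable (fun y => ln (E w y)) x v by exact: diff_derivable.
  have dS : derivable (fun y => q / 2 * ln (dotv (f y) (eta y) ^+ 2)) x v by exact: diff_derivable.
  have dc : derivable (fun=> q / 2 : R) x v by exact: diff_derivable.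
  have dl : derivable (fun y => ln (dotv (f y) (eta y) ^+ 2)) x v by exact: diff_derivable.
  rewrite (@deriveB _ _ _ (fun y => ln (E w y)) _ _ _ dE dS).
  rewrite (@derive_ln R _ (fun y => E w y) x v E0 Ed) DE.
  rewrite (@deriveM _ _ (fun=> q / 2) _ _ _ dc dl).
  rewrite (@derive_ln R _ (fun y => dotv (f y) (eta y) ^+ 2) x v s0 sd) derive_cst scaler0 addr0 (@derive_val _ _ _ _ _ _ _ Ds).
  transitivity (\sum_i (q / E w x * (dotv (f x) (tau i) * dotv ('D_v f x) (tau i))
     - q / u x * (d 0 i * (dotv ('D_v f x) (tau i) * dotv (f x) (tau i))))); last first.
    rewrite mulr_sumr; apply: eq_bigr => i _.
    move: (E w x) E0 (u x) u0 (dotv (f x) (tau i)) (dotv ('D_v f x) (tau i)).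
    by move=> e e0 uu uu0 ? ?; field; rewrite !gt_eqF.
  rewrite sumrB -!mulr_sumr; congr (_ - _); first by rewrite mulrAC.
  rewrite /GRing.scale /=; move: (\sum_i _) => S.
  have -> : dotv (f x) (eta x) ^+ 2 = u x ^+ 2 by rewrite sqrrN.
  move: (- dotv (f x) (eta x)) u0 => uu u0.
  by field; rewrite gt_eqF.
have qE : 0 <= q / E w x by rewrite ltW // divr_gt0.
rewrite normrM (ger0_norm qE) -[leRHS]mulrA ler_wpM2l //.
set e := expR _ - 1.
apply: (@le_trans _ _ (\sum_i (dotv (f x) (tau i) * dotv (f x) (tau i)
   + dotv ('D_v f x) (tau i) * dotv ('D_v f x) (tau i)) / 2 * e)).
  apply: le_trans (ler_norm_sum _ _ _) _; apply: ler_sum => i _.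
  rewrite normrM; apply: ler_pM => //.
    move: (dotv (f x) (tau i)) (dotv ('D_v f x) (tau i)) => a b.
    rewrite ler_norml; apply/andP; split.
      have := sqr_ge0 (a + b); rewrite expr2; nra.
    have := sqr_ge0 (a - b); rewrite expr2; nra.
  have /andP[h1 h2] := pinch i.
  by rewrite distrC ger0_norm ?subr_ge0 // /e lerB.
have e0 : 0 <= e.
  by rewrite subr_ge0 -[X in X <= _]expR0 ler_expR mulr_ge0 ?(ltW n0) // defect_ge0.
rewrite -!mulr_suml mulrC ler_wpM2l // ler_wpM2r ?invr_ge0 //.
by rewrite big_split /= lerD // (af_bessel af).
Qed.

End PatchTheorems.

(** * Positive definiteness is an open condition *)

Section PosDefOpen.
Variable R : realType.

Lemma pos_def_bound n (A : 'M[R]_n) : (0 < n)%N -> pos_def A ->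
  exists2 m : R, 0 < m & forall v : 'rV[R]_n, m * dotv v v <= dotv (v *m A) v.
Proof.
move=> n0 Ap.
have [|||v v1 vmin] := @EVT_min_rV R n (fun v => dotv (v *m A) v) [set v | dotv v v = 1].
- by exists (basis_vec R (Ordinal n0)) => /=; rewrite dotv_basis mxE !eqxx.
- exact: unit_sphere_compact.
- by apply: continuous_subspaceT; exact: dotv_quad_continuous.
have vv : dotv v v = 1 by rewrite inE in v1.
have v0 : v != 0 by apply: contra_eqN vv => /eqP->; rewrite dotv0l eq_sym oner_eq0.
exists (dotv (v *m A) v); first by rewrite dotv_mx; exact: Ap.
move=> w; have [->|w0] := eqVneq w 0; first by rewrite mul0mx !dotv0l mulr0.
have ww := dotvv_gt0 w0.
pose c := (Num.sqrt (dotv w w))^-1.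
have cc : c * c * dotv w w = 1.
  by rewrite -expr2 exprVn sqr_sqrtr ?ltW // mulVf //; exact: lt0r_neq0.
have := vmin (c *: w); rewrite inE /= dotvZl dotvZr mulrA cc => /(_ erefl).
rewrite -scalemxAl dotvZl dotvZr mulrA => le_m.
have c0 : 0 < c * c by rewrite mulr_gt0 // invr_gt0 sqrtr_gt0.
by rewrite -(ler_pM2l c0) mulrCA cc mulr1.
Qed.

Lemma dotv_entries_le n (A : 'M[R]_n) (e : R) : (forall i j, `|A i j| <= e) ->
  forall v : 'rV[R]_n, `|dotv (v *m A) v| <= n%:R * e * dotv v v.
Proof.
move=> Ae v.
have -> : dotv (v *m A) v = \sum_i \sum_j v 0 j * A j i * v 0 i.
  by rewrite dotvE; apply: eq_bigr => i _; rewrite mxE mulr_suml.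
apply: (@le_trans _ _ (\sum_i \sum_j e * ((v 0 j * v 0 j + v 0 i * v 0 i) / 2))).
  apply: le_trans (ler_norm_sum _ _ _) _; apply: ler_sum => i _.
  apply: le_trans (ler_norm_sum _ _ _) _; apply: ler_sum => j _.
  rewrite mulrAC normrM mulrC; apply: ler_pM => //.
  move: (v 0 j) (v 0 i) => a b; rewrite ler_norml; apply/andP; split.
    by have := sqr_ge0 (a + b); rewrite expr2; nra.
  by have := sqr_ge0 (a - b); rewrite expr2; nra.
rewrite le_eqVlt; apply/orP; left; apply/eqP.
under eq_bigr => i _ do rewrite -mulr_sumr -mulr_suml big_split /= -dotvE sumr_const card_ord.
rewrite -mulr_sumr -mulr_suml big_split /= sumr_const card_ord sumrMnl -dotvE.
by rewrite -![dotv v v *+ n]mulr_natl; field.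
Qed.

(** On unit vectors the form at [t0] is at least some [m > 0]; entries within [m / (2 n)] change it
    by at most [m / 2]. *)
Lemma pos_def_open (T : topologicalType) n (M : T -> 'M[R]_n) (t0 : T) : (0 < n)%N ->
  (forall i j, {for t0, continuous (fun t => M t i j)}) -> pos_def (M t0) ->
  \forall t \near t0, pos_def (M t).
Proof.
move=> n0 Mc Mp; have [m m0 mM] := pos_def_bound n0 Mp.
have nR : 0 < n%:R :> R by rewrite ltr0n.
pose e := m / (2 * n%:R).
have e0 : 0 < e by rewrite divr_gt0 // mulr_gt0.
have : \forall t \near t0, forall i j, `|M t0 i j - M t i j| < e.
  apply: filter_forall => i; apply: filter_forall => j.
  by have /cvgrPdist_lt /(_ _ e0) := Mc i j.
apply: filterS => t Me v v0; rewrite -dotv_mx.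
have h1 := mM v.
have h2 : `|dotv (v *m (M t0 - M t)) v| <= n%:R * e * dotv v v.
  by apply: dotv_entries_le => i j; rewrite !mxE ltW.
rewrite mulmxBr dotvBl in h2.
have vv := dotvv_gt0 v0.
have ne : n%:R * e = m / 2 by rewrite /e; field; rewrite gt_eqF.
rewrite ne in h2.
have := le_trans (ler_norm _) h2; move: (dotv (v *m M t0) v) (dotv (v *m M t) v) h1 => a b h1 h3.
have : 0 < m * dotv v v by rewrite mulr_gt0.
lra.
Qed.

End PosDefOpen.

(** * A Gronwall inequality with zero initial value *)

Section Gronwall.
Variable R : realType.

(** The function [k s * expR (- C * s)] has nonpositive derivative, starts at 0 and is
    nonnegative. *)
Lemma gronwall0 (k k' : R -> R) (C : R) :
  (forall s : R, 0 <= s <= 1 -> is_derive s 1 k (k' s)) ->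
  (forall s : R, 0 <= s <= 1 -> 0 <= k s) ->
  (forall s : R, 0 <= s <= 1 -> `|k' s| <= C * k s) -> k 0 = 0 -> k 1 = 0.
Proof.
move=> kd k0 kC kz.
pose m (s : R) := k s * expR (- C * s).
have md (s : R) : 0 <= s <= 1 -> is_derive s 1 m ((k' s - C * k s) * expR (- C * s)).
  move=> s01; have kds := kd s s01.
  have ed : is_derive s 1 (fun s : R => expR (- C * s)) (- C * expR (- C * s)).
    have Cd : is_derive s (1 : R) (fun s : R => - C * s) (- C).
      have Z : is_derive s (1 : R) ((- C) *: (@id R)) ((- C) *: (1 : R)) by exact: is_deriveZ.
      by apply: (is_derive_eq Z); rewrite /GRing.scale /= mulr1.
    apply: (is_derive_eq (is_derive1_comp (is_derive_expR _) Cd)).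
    by rewrite mulrC.
  apply: (is_derive_eq (is_deriveM kds ed)).
  by rewrite /GRing.scale /=; ring.
have [||c c01 E] := @MVT R m (fun s : R => (k' s - C * k s) * expR (- C * s)) 0 1 ltr01.
- by move=> s; rewrite in_itv /= => /andP[s0 s1]; apply: md; rewrite !ltW.
- apply: derivable_within_continuous => s; rewrite in_itv /= => s01.
  by case: (md s s01).
have c01' : 0 <= c <= 1 by move: c01; rewrite in_itv /= => /andP[/ltW-> /ltW->].
have : m 1 - m 0 <= 0.
  rewrite E subr0 mulr1; apply: mulr_le0_ge0; last exact: expR_ge0.
  by rewrite subr_le0; exact: le_trans (ler_norm _) (kC c c01').
have m0 : m 0 = 0 by rewrite /m kz mul0r.
rewrite m0 subr0 /m => h.
have k1 : 0 <= k 1 by apply: k0; rewrite ler01 lexx.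
apply/le_anti; rewrite k1 andbT.
by move: h; rewrite pmulr_lle0 // expR_gt0.
Qed.

(** Multiply [1 - y <= expR (- y)] by [expR y]. *)
Lemma expRB1_le (y : R) : expR y - 1 <= y * expR y.
Proof.
have h := expR_ge1Dx (- y).
have e0 := expR_gt0 y.
have : (1 + - y) * expR y <= expR (- y) * expR y by rewrite ler_pM2r.
rewrite -expRD addNr expR0 mulrDl mul1r mulNr => h'.
by move: h'; move: (y * expR y) (expR y) => a b; lra.
Qed.

End Gronwall.

(** * Umbilic patches *)

Section PatchGlobal.
Variables (R : realType) (n : nat) (beta q : R).
Hypotheses (n2 : (2 <= n)%N) (beta0 : 0 < beta) (q0 : 0 < q) (q1 : q < 1)
  (nq : n%:R * (1 - q) = beta).
Local Notation V := 'rV[R]_n.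
Implicit Types (W : set V) (f eta : V -> 'rV[R]_n.+1).

Lemma soliton_patch_sub W W' f eta : open W' -> W' `<=` W ->
  soliton_patch beta W f eta -> soliton_patch beta W' f eta.
Proof.
move=> Wo' sub sp; split => //.
- exact: smooth_on_sub sub (sp_smooth sp).
- by move=> x /sub; exact: (sp_unit sp).
- by move=> x v /sub; exact: (sp_normal sp).
- by move=> x v /sub; exact: (sp_immersion sp).
- by move=> x /sub; exact: (sp_convex sp).
- by move=> x /sub; exact: (sp_support sp).
- by move=> x /sub; exact: (sp_eq sp).
Qed.

(** A gnomonic chart centred at each point of [W] shows that the position is normal there. The
    resulting radial relation holds on an open set, so it can be differentiated at [x0]: all
    principal radii equal u, and the equation then gives u = 1. *)
Lemma umbilic_patch w W f eta x0 : soliton_patch beta W f eta -> W x0 ->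
  (forall x, W x -> - dotv (f x) (eta x) *: metric f x =
    (w + q / 2 * dotv (f x) (f x)) *: second_form f eta x) ->
  f x0 = - eta x0.
Proof.
move=> sp Wx0 umb.
have diag x (Wx : W x) := patch_diagonalization sp Wx.
have pos x : W x -> f x = dotv (f x) (eta x) *: eta x.
  move=> Wx; have [L [d [Lg Lh]]] := diag x Wx.
  have [tau [W' [G [X [P [U af]]]]]] := adapted_frame_exists sp Wx Lg Lh.
  have d0 i : 0 < (d 0 i)^-1 by rewrite invr_gt0 (af_d af).
  apply: (af_position af) => l.
  apply: (gnomonic_umbilic_gradient (w := w) (af_gnomonic af) (af_dom af) (af_X0 af)
    (af_H0 af) d0 n2 q1) => y i j W'y.
  rewrite -(af_barrier af); apply: (af_umbilic af) => //.
  exact: umb (af_sub af W'y).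
have [L [d [Lg Lh]]] := diag x0 Wx0.
have [tau [W' [G [X [P [U af]]]]]] := adapted_frame_exists sp Wx0 Lg Lh.
have bU := gnomonic_radial (af_gnomonic af) (af_dom af) (af_X0 af) (af_H0 af)
  (fun x i W'x => af_radial af i W'x (pos x (af_sub af W'x))).
have := gnomonic_eq0 (af_gnomonic af) (af_dom af) (af_X0 af) (af_H0 af) bU beta0.
rewrite (af_U0 af)
=> /(congr1 -%R); rewrite opprK => du.
exact: (etrans (pos x0 Wx0) (etrans (congr1 (fun a => a *: eta x0) du) (scaleN1r _))).
Qed.

End PatchGlobal.

Lemma near_continuous (T U : topologicalType) (f : T -> U) (A : set U) (x : T) :
  {for x, continuous f} -> open A -> A (f x) -> \forall y \near x, A (f y).
Proof. by move=> fc Ao Ax; apply: (fc A); apply: open_nbhs_nbhs. Qed.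

(** * Propagation from a contact point *)

Section PatchRigidity.
Variables (R : realType) (n : nat) (beta q w : R) (W : set 'rV[R]_n).
Variables (f eta : 'rV[R]_n -> 'rV[R]_n.+1).
Hypotheses (n2 : (2 <= n)%N) (beta0 : 0 < beta) (q0 : 0 < q) (q1 : q < 1)
  (nq : n%:R * (1 - q) = beta) (sp : soliton_patch beta W f eta)
  (cle : forall x, W x -> curv_le f eta w q x).
Local Notation V := 'rV[R]_n.
Local Notation E x := (w + q / 2 * dotv (f x) (f x)).

Lemma patch_barrier_gt0 x : W x -> 0 < E x.
Proof.
move=> Wx; have [L [d [Lg Lh]]] := patch_diagonalization sp Wx.
exact: (curv_le_barrier_gt0 n2 sp Wx Lg Lh (cle Wx)).
Qed.

Lemma patch_metric_continuous x i j : W x -> {for x, continuous (fun y => metric f y i j)}.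
Proof.
move=> Wx; have -> : (fun y => metric f y i j) = (fun y => \sum_k
    'D_(basis_vec R i) f y 0 k * 'D_(basis_vec R j) f y 0 k).
  by apply/funext => y; rewrite mxE dotvE.
have Ds v : smooth_on W ('D_v f) := smooth_on_derive v (sp_smooth sp).
have Dc v : {for x, continuous ('D_v f)} := smooth_on_continuous (Ds v) Wx.
apply: continuous_at_sum => k; apply: continuousM.
- by apply: (@continuous_comp _ _ _ ('D_(basis_vec R i) f) (fun u : 'rV[R]_n.+1 => u 0 k));
    [exact: Dc|exact: coord_continuous].
- by apply: (@continuous_comp _ _ _ ('D_(basis_vec R j) f) (fun u : 'rV[R]_n.+1 => u 0 k));
    [exact: Dc|exact: coord_continuous].
Qed.

(** Along each segment from [x0] inside a small ball the derivative of the defect is at most a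
    constant times the defect, so Gronwall carries its vanishing from [x0] to the endpoint. *)
Lemma patch_defect_near0 x0 : W x0 -> defect q f eta w x0 = 0 ->
  \forall x \near x0, W x /\ defect q f eta w x = 0.
Proof.
move=> Wx0 dz; set k := defect q f eta w.
have [kd _] := defect_derive n2 q0 nq sp 0 Wx0 (cle Wx0).
pose a0 := dotv (f x0) (f x0).
pose e := 1 + \sum_i \sum_j `|metric f x0 i j|.
have E00 := patch_barrier_gt0 Wx0.
have ffc := smooth_on_continuous (smooth_sqr_norm sp) Wx0.
have nW : \forall x \near x0, W x by apply: open_nbhs_nbhs; split=> //; exact: sp_open sp.
have nff : \forall x \near x0, dotv (f x) (f x) < a0 + 1.
  by apply: (near_continuous ffc (A := [set t | t < a0 + 1])); [exact: open_lt|rewrite /= ltrDl].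
have nE : \forall x \near x0, E x0 / 2 < E x.
  have Ec : {for x0, continuous (fun x => E x : R)}.
    apply: (@continuousD _ _ _ (fun=> w) (fun x => q / 2 * dotv (f x) (f x))).
      exact: cst_continuous.
    by apply: continuousM => //; exact: cst_continuous.
  apply: (near_continuous Ec (A := [set t | E x0 / 2 < t])); first exact: open_gt.
  by move: E00; rewrite /=; move: (E x0) => t; lra.
have nk : \forall x \near x0, k x < 1.
  have kc : {for x0, continuous k} := differentiable_continuous kd.
  have k1 : k x0 < (1 : R) by rewrite /k dz.
  exact: (near_continuous kc (@open_lt R (1 : R)) k1).
have ng : \forall x \near x0, forall i j, `|metric f x i j| <= e.
  suff H : forall i j, \forall x \near x0, `|metric f x i j| <= e.
    pose Q i j x := `|metric f x i j| <= e.
    exact: (@filter_forall V _ (fun i x => forall j, Q i j x) _ _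
      (fun i => @filter_forall V _ (Q i) _ _ (H i))).
  move=> i j.
  have := patch_metric_continuous (i := i) (j := j) Wx0.
  move=> /cvgrPdist_lt /(_ _ ltr01); apply: filterS => x dx.
  have le1 : `|metric f x0 i j| <= \sum_i \sum_j `|metric f x0 i j|.
    rewrite (bigD1 i) //= (bigD1 j) //= -addrA lerDl addr_ge0 //.
      by apply: sumr_ge0.
    by apply: sumr_ge0 => l _; apply: sumr_ge0.
  have gen (a b : R) : `|b| <= `|a| + `|a - b| by have := ler_normB a (a - b); rewrite subKr.
  have h1 := gen (metric f x0 i j) (metric f x i j).
  by apply: (le_trans h1); rewrite addrC /e; apply: lerD; [exact: ltW|exact: le1].
(* A ball on which every factor of the gradient bound is uniformly controlled; a defect below 1
   turns [expR (n k) - 1] into at most [n expR n * k]. *)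
have [r r0 br] : nbhs_ball x0 [set x | [/\ W x, dotv (f x) (f x) < a0 + 1, E x0 / 2 < E x,
     k x < 1 & forall i j, `|metric f x i j| <= e]].
  apply/nbhs_ballP; near=> x; split; near: x.
  - exact: nW.
  - exact: nff.
  - exact: nE.
  - exact: nk.
  - exact: ng.
apply/nbhs_ballP; exists r => // x bx.
have [Wx _ _ _ _] := br x bx; split=> //.
pose v := x - x0.
have bs (s : R) : 0 <= s <= 1 -> ball x0 r (s *: v + x0).
  move=> /andP[s0 s1]; move: bx; rewrite -!ball_normE /ball_ /= opprD addrCA subrr addr0.
  rewrite normrN normrZ ger0_norm //; apply: le_lt_trans.
  by rewrite distrC -/v; apply: ler_piMl.
have Es1 : k ((1 : R) *: v + x0) = k x by rewrite scale1r subrK.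
rewrite -Es1.
apply: (@gronwall0 R (fun s : R => k (s *: v + x0)) (fun s : R => 'D_v k (s *: v + x0))
  (q / (E x0 / 2) * (n%:R * expR n%:R) * ((a0 + 1 + n%:R * e * dotv v v) / 2))).
- move=> s s01; have [Wy _ _ _ _] := br _ (bs s s01).
  have [dd _] := defect_derive n2 q0 nq sp v Wy (cle Wy).
  by apply: is_derive_line; exact: diff_derivable.
- move=> s s01; have [Wy _ _ _ _] := br _ (bs s s01).
  exact: (defect_ge0 n2 nq sp Wy (cle Wy)).
- move=> s s01; have [Wy h1 h2 h3 h4] := br _ (bs s s01).
  have [_ dd] := defect_derive n2 q0 nq sp v Wy (cle Wy).
  have k0 : 0 <= k (s *: v + x0) := defect_ge0 n2 nq sp Wy (cle Wy).
  apply: (le_trans dd).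
  have hv : dotv ('D_v f (s *: v + x0)) ('D_v f (s *: v + x0)) <= n%:R * e * dotv v v.
    rewrite -(metricE sp) //; apply: le_trans (ler_norm _) _; exact: dotv_entries_le.
  have hE : q / E (s *: v + x0) <= q / (E x0 / 2).
    have E2 : 0 < E x0 / 2 by rewrite divr_gt0.
    have Ey := patch_barrier_gt0 Wy.
    by rewrite ler_pM2l // lef_pV2 ?posrE; [exact: ltW|exact: Ey|exact: E2].
  have hk : expR (n%:R * k (s *: v + x0)) - 1 <= n%:R * expR n%:R * k (s *: v + x0).
    apply: (le_trans (expRB1_le _)); rewrite -mulrA -[leRHS]mulrA ler_wpM2l //.
    rewrite mulrC ler_wpM2r // ler_expR ler_piMr //; exact: ltW.
  have hf : (dotv (f (s *: v + x0)) (f (s *: v + x0)) +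
      dotv ('D_v f (s *: v + x0)) ('D_v f (s *: v + x0))) / 2 <=
      (a0 + 1 + n%:R * e * dotv v v) / 2.
    by rewrite ler_pM2r ?invr_gt0 // lerD // ltW.
  have w0 : 0 <= E (s *: v + x0) by exact: ltW (patch_barrier_gt0 Wy).
  apply: (@le_trans _ _ (q / (E x0 / 2) * (n%:R * expR n%:R * k (s *: v + x0)) *
      ((a0 + 1 + n%:R * e * dotv v v) / 2))); last by rewrite le_eqVlt; apply/orP; left;
    apply/eqP; move: (k _) (dotv v v) (E x0 / 2)^-1 => t1 t2 t3; ring.
  apply: ler_pM => //.
  - apply: mulr_ge0; first by rewrite divr_ge0 // ltW.
    by rewrite subr_ge0 -[X in X <= _]expR0 ler_expR mulr_ge0.
  - by rewrite divr_ge0 // addr_ge0 // dotvv_ge0.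
  - apply: ler_pM => //; first by rewrite divr_ge0 // ltW.
    by rewrite subr_ge0 -[X in X <= _]expR0 ler_expR mulr_ge0.
- by rewrite scale0r add0r.
Unshelve. all: by end_near.
Qed.

(** A zero defect means equality of the forms in all directions. The interior of the zero set is
    taken as a new patch, since the umbilic identity has to be differentiated on it. *)
Theorem patch_rigidity x0 : W x0 -> ln (E x0) = q * ln (- dotv (f x0) (eta x0)) ->
  \forall x \near x0, f x = - eta x.
Proof.
move=> Wx0 eqE.
have dz : defect q f eta w x0 = 0 by rewrite (defectE _ sp w Wx0) eqE subrr.
have nz := patch_defect_near0 Wx0 dz.
near=> x.
have [Wx _] : W x /\ defect q f eta w x = 0 by near: x.
pose W' := interior [set y | W y /\ defect q f eta w y = 0].
have W'o : open W' by exact: open_interior.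
have W's y : W' y -> W y /\ defect q f eta w y = 0 by move=> /nbhs_singleton.
have sp' := soliton_patch_sub W'o (fun y h => (W's y h).1) sp.
have W'x : W' x by near: x; exact: nbhs_interior.
apply: (umbilic_patch n2 beta0 q1 (w := w) sp' W'x) => y /W's[Wy dy].
exact: (defect0_umbilic n2 nq sp Wy (cle Wy) dy).
Unshelve. all: by end_near.
Qed.

End PatchRigidity.

(** * Closed hypersurfaces *)

Lemma derive_comp_diff (R : realType) (U V W : normedModType R) (th : U -> V) (f : V -> W) (x v : U) :
  differentiable th x -> differentiable f (th x) ->
  'D_v (f \o th) x = 'D_('D_v th x) f (th x).
Proof.
move=> td fd; rewrite deriveE; last exact: differentiable_comp.
by rewrite (diff_comp td fd) /= (deriveE _ fd) (deriveE _ td).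
Qed.

(** The strict version is an open condition, both in the point and in [w]; compactness arguments
    need this, whereas [curv_le] is what survives at the least [w]. *)
Definition curv_lt (R : realType) (n : nat) (f eta : 'rV[R]_n -> 'rV[R]_n.+1) (w q : R)
    (x : 'rV[R]_n) : Prop :=
  forall v : 'rV[R]_n, v != 0 ->
    - dotv (f x) (eta x) * dotv (v *m metric f x) v <
    (w + q / 2 * dotv (f x) (f x)) * dotv (v *m second_form f eta x) v.

(** * The second fundamental form as a Hessian of height functions *)

Section SecondForm.
Variables (R : realType) (n : nat) (beta : R) (W : set 'rV[R]_n).
Variables (f eta : 'rV[R]_n -> 'rV[R]_n.+1).
Hypothesis sp : soliton_patch beta W f eta.
Local Notation V := 'rV[R]_n.
Local Notation phi x := (fun y : V => dotv (f y) (eta x)).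

Lemma patch_height_smooth x : smooth_on W (phi x).
Proof. exact: smooth_dotv (sp_open sp) (sp_smooth sp). Qed.

Lemma patch_height_derive x (v : V) : W x -> 'D_v (phi x) x = 0.
Proof.
move=> Wx; rewrite derive_dotv; first exact: (sp_normal sp v Wx).
exact: smooth_on_derivable (sp_smooth sp) Wx.
Qed.

Lemma second_form_derive2 x (v : V) : W x ->
  dotv (v *m second_form f eta x) v =
  \sum_a v 0 a * 'D_v ('D_(basis_vec R a) (phi x)) x.
Proof.
move=> Wx.
have hE i j : second_form f eta x i j = 'D_(basis_vec R i) ('D_(basis_vec R j) (phi x)) x.
  have Ds v' : smooth_on W ('D_v' f) := smooth_on_derive v' (sp_smooth sp).
  rewrite mxE -(derive_dotv _ (@smooth_on_derivable _ _ _ _ _ x (basis_vec R i) (Ds (basis_vec R j)) Wx)).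
  apply: (open_eq_derive _ (sp_open sp) _ Wx) => y Wy.
  by rewrite derive_dotv //; exact: smooth_on_derivable (sp_smooth sp) Wy.
rewrite dotvE; apply: eq_bigr => a _; rewrite mxE mulrC; congr (_ * _).
have Da : smooth_on W ('D_(basis_vec R a) (phi x)) := smooth_on_derive _ (patch_height_smooth x).
rewrite (derive_basis v (smooth_on_differentiable Da Wx)).
by apply: eq_bigr => b _; rewrite hE.
Qed.

End SecondForm.

(** * Invariance under change of coordinates *)

Section Reparametrization.
Variables (R : realType) (n : nat) (beta : R) (W W' U : set 'rV[R]_n).
Variables (f eta f' eta' : 'rV[R]_n -> 'rV[R]_n.+1) (th : 'rV[R]_n -> 'rV[R]_n).
Hypotheses (sp : soliton_patch beta W f eta) (sp' : soliton_patch beta W' f' eta').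
Hypotheses (Uo : open U) (UW : U `<=` W) (ths : smooth_on U th)
  (thU : forall x, U x -> W' (th x))
  (fth : forall x, U x -> f x = f' (th x)) (etath : forall x, U x -> eta x = eta' (th x)).
Local Notation V := 'rV[R]_n.

Let thd x : U x -> differentiable th x.
Proof. by move=> Ux; exact: smooth_on_differentiable ths Ux. Qed.

Lemma reparam_derive x (v : V) : U x -> 'D_v f x = 'D_('D_v th x) f' (th x).
Proof.
move=> Ux; rewrite -(derive_comp_diff v (thd Ux)); first exact: open_eq_derive Uo fth Ux.
exact: smooth_on_differentiable (sp_smooth sp') (thU Ux).
Qed.

Lemma reparam_derive_neq0 x (v : V) : U x -> v != 0 -> 'D_v th x != 0.
Proof.
move=> Ux v0; apply: contraNneq (sp_immersion sp (UW Ux) v0) => z.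
rewrite (reparam_derive v Ux) z; apply/eqP.
rewrite deriveE ?linear0 //.
exact: smooth_on_differentiable (sp_smooth sp') (thU Ux).
Qed.

Lemma reparam_metric x (v : V) : U x ->
  dotv (v *m metric f x) v = dotv ('D_v th x *m metric f' (th x)) ('D_v th x).
Proof.
move=> Ux; apply: (etrans (metricE sp v (UW Ux))).
exact: (etrans (congr1 (fun a => dotv a a) (reparam_derive v Ux))
  (esym (metricE sp' _ (thU Ux)))).
Qed.

(** The form is the Hessian of the height [y |-> <f y, eta x>] at its critical point [x], and a
    Hessian at a critical point transforms like a quadratic form. *)
Lemma reparam_second_form x (v : V) : U x ->
  dotv (v *m second_form f eta x) v =
  dotv ('D_v th x *m second_form f' eta' (th x)) ('D_v th x).
Proof.
move=> Ux; have Wx := UW Ux; have W'x := thU Ux.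
rewrite (second_form_derive2 sp v Wx) (second_form_derive2 sp' _ W'x).
pose phi' y := dotv (f' y) (eta' (th x)).
have ps' : smooth_on W' phi' := patch_height_smooth sp' (th x).
pose psi a := 'D_(basis_vec R a) phi'.
have psis a : smooth_on W' (psi a) := smooth_on_derive _ ps'.
have phiE y : U y -> dotv (f y) (eta x) = (phi' \o th) y.
  by move=> Uy; rewrite /= (fth Uy) (etath Ux).
pose D y := 'D_v th y.
have Ds : smooth_on U D := smooth_on_derive v ths.
have Da a : smooth_on U (fun y => D y 0 a).
  apply: (smooth_on_eq Uo _ (smooth_dotv (basis_vec R a) Uo Ds)) => y _.
  exact: dotv_basis.
have D1 y : U y -> 'D_v (fun z => dotv (f z) (eta x)) y =
    \sum_a D y 0 a * psi a (th y).
  move=> Uy; rewrite (open_eq_derive v Uo phiE Uy).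
  have pd := smooth_on_differentiable ps' (thU Uy).
  by rewrite (derive_comp_diff v (thd Uy) pd) (derive_basis _ pd).
have L : \sum_a v 0 a * 'D_v ('D_(basis_vec R a) (fun y => dotv (f y) (eta x))) x =
    'D_v ('D_v (fun y => dotv (f y) (eta x))) x.
  have hs := patch_height_smooth sp x.
  have hd a : derivable ('D_(basis_vec R a) (fun y => dotv (f y) (eta x))) x v.
    exact: smooth_on_derivable (smooth_on_derive _ hs) Wx.
  have Hs (y : V) : W y -> 'D_v (fun y => dotv (f y) (eta x)) y =
      (\sum_a v 0 a *: 'D_(basis_vec R a) (fun y => dotv (f y) (eta x))) y.
    move=> Wy; rewrite (derive_basis v (smooth_on_differentiable hs Wy)) fct_sumE.
    by [].
  rewrite (open_eq_derive v (sp_open sp) Hs Wx) derive_sum => [|a]; last exact: derivableZ.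
  by apply: eq_bigr => a _; rewrite deriveZ.
apply: (etrans L).
have D2 (y : V) : U y -> 'D_v (fun z => dotv (f z) (eta x)) y =
    (\sum_a ((fun y => D y 0 a : R) * (psi a \o th)%FUN)) y.
  by move=> Uy; rewrite (D1 y Uy) fct_sumE.
have d1 a : derivable (fun y => D y 0 a : R) x v.
  exact: smooth_on_derivable (Da a) Ux.
have pd a := smooth_on_differentiable (psis a) W'x.
have d2 a : derivable (psi a \o th) x v.
  by apply: diff_derivable; apply: differentiable_comp (thd Ux) (pd a).
rewrite (open_eq_derive v Uo D2 Ux) derive_sum => [|a]; last exact: derivableM.
apply: eq_bigr => a _; rewrite deriveM //.
(* The second derivatives of [th] are multiplied by first derivatives of the height, which vanish
   here. *)
have z : (psi a \o th) x = 0 by exact: (patch_height_derive sp' (basis_vec R a) W'x).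
by rewrite z scale0r addr0 (derive_comp_diff v (thd Ux) (pd a)).
Qed.

Lemma reparam_curv_le w q x : U x ->
  curv_le f' eta' w q (th x) -> curv_le f eta w q x.
Proof.
move=> Ux cle v; rewrite reparam_metric // reparam_second_form // (fth Ux) (etath Ux).
exact: cle.
Qed.

Lemma reparam_curv_lt w q x : U x ->
  curv_lt f' eta' w q (th x) -> curv_lt f eta w q x.
Proof.
move=> Ux cle v v0; rewrite reparam_metric // reparam_second_form // (fth Ux) (etath Ux).
exact/cle/reparam_derive_neq0.
Qed.

End Reparametrization.

(** The near-covering form of compactness, applied to the filter at infinity on the indices. *)
Lemma compact_exhaustion (T : topologicalType) (C : set T) (O : nat -> set T) :
  compact C -> (forall k, open (O k)) -> (forall k l, (k <= l)%N -> O k `<=` O l) ->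
  (forall p, C p -> exists k, O k p) -> exists k, C `<=` O k.
Proof.
move=> /compact_near_coveringP Cc Oo Omono Ocover.
have : \forall k \near \oo, C `<=` O k.
  apply: Cc => p Cp; have [k Okp] := Ocover p Cp.
  exists (O k, [set l | (k <= l)%N]) => /=.
    by split; [exact: open_nbhs_nbhs|exists k].
  by move=> [x l] [/= Okx kl]; exact: Omono kl _ Okx.
by case=> N _ h; exists N; apply: h => /=.
Qed.

Lemma enorm1 (R : realType) (m : nat) (u : 'rV[R]_m) : enorm u = 1 -> dotv u u = 1.
Proof. by move=> h; rewrite -[LHS]sqr_sqrtr ?dotvv_ge0 // -/(enorm u) h expr1n. Qed.

Lemma mx_lincomb (R : pzRingType) (m n : nat) (a b : R) (A B : 'M[R]_(m, n)) i j :
  (a *: A - b *: B) i j = a * A i j - b * B i j.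
Proof. by rewrite !mxE. Qed.

(** * The least barrier constant on a closed hypersurface *)

Section Hypersurface.
Variables (R : realType) (n : nat) (M : closed_manifold R n).
Variables (F nu : M -> 'rV[R]_n.+1) (alpha beta q : R).
Hypotheses (n2 : (2 <= n)%N) (alpha0 : 0 < alpha) (beta_def : beta = alpha^-1)
  (q_def : q = 1 - beta / n%:R) (q0 : 0 < q).
Hypotheses (Fc : strictly_convex_hypersurface F nu) (Fs : gauss_soliton alpha F nu).
Local Notation V := 'rV[R]_n.
Local Notation f_ c := (F \o chart_inv c).
Local Notation nu_ c := (nu \o chart_inv c).

Let beta0 : 0 < beta. Proof. by rewrite beta_def invr_gt0. Qed.
Let nR : 0 < n%:R :> R. Proof. by rewrite ltr0n; exact: ltn_trans n2. Qed.
Let nq : n%:R * (1 - q) = beta.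
Proof. by rewrite q_def opprB addrC subrK mulrC divfK // gt_eqF. Qed.
Let q1 : q < 1. Proof. by rewrite q_def gtrDl oppr_lt0 divr_gt0. Qed.

(** Strict convexity gives K > 0, so u = K^alpha is positive, and taking logarithms with
    [beta = alpha^-1] gives ln K = beta ln u, where K is the quotient of determinants. *)
Lemma chart_patch c : atlas c -> soliton_patch beta (chart_cod c) (f_ c) (nu_ c).
Proof.
move=> ac; case: Fc => smF imF nuF cvF.
have fs := smF c ac.
have gE p : chart_dom c p -> first_fundamental_form F c p = metric (f_ c) (chart_map c p).
  by move=> cp; apply/matrixP => i j; rewrite !mxE.
have hE p : chart_dom c p ->
    second_fundamental_form F nu c p = second_form (f_ c) (nu_ c) (chart_map c p).
  by move=> cp; apply/matrixP => i j; rewrite !mxE /= (chart_mapK cp).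
have nrm x (v : V) : chart_cod c x -> dotv ('D_v (f_ c) x) (nu_ c x) = 0.
  move=> [p cp <-]; rewrite /= (chart_mapK cp).
  by have [_ h _] := nuF p; exact: (h c ac cp v).
have imm x (v : V) : chart_cod c x -> v != 0 -> 'D_v (f_ c) x != 0.
  move=> [p cp <-]; apply: contra_neq => dv0; apply: (imF c p ac cp).
  rewrite linear0 -deriveE //.
  by apply: (smooth_on_differentiable fs); exists p.
have cvx x : chart_cod c x -> pos_def (second_form (f_ c) (nu_ c) x).
  by move=> [p cp <-]; rewrite -hE //; exact: cvF.
have Wo : open (chart_cod c) := @chart_cod_open _ _ _ c.
have gpos x (cx : chart_cod c x) : pos_def (metric (f_ c) x).
  by apply: (smooth_metric_pos_def fs cx) => v; exact: imm.
have hsym x (cx : chart_cod c x) : (second_form (f_ c) (nu_ c) x)^T = second_form (f_ c) (nu_ c) x.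
  exact: (smooth_second_form_sym (nu_ c) Wo fs cx).
have KE p : chart_dom c p -> gauss_curvature F nu c p =
    \det (second_form (f_ c) (nu_ c) (chart_map c p)) / \det (metric (f_ c) (chart_map c p)).
  move=> cp; rewrite -gE // -hE //.
  have cx : chart_cod c (chart_map c p) by exists p.
  apply: gauss_curvatureE; rewrite ?gE ?hE //.
  - exact: metric_sym.
  - exact: hsym.
  - exact: gpos.
have Kgt p : chart_dom c p -> 0 < gauss_curvature F nu c p.
  move=> cp; have cx : chart_cod c (chart_map c p) by exists p.
  rewrite KE // divr_gt0 // pos_def_det //.
  - exact: hsym.
  - exact: cvx.
  - exact: metric_sym.
  - exact: gpos.
have uK p : chart_dom c p -> - dotv (f_ c (chart_map c p)) (nu_ c (chart_map c p)) =
    gauss_curvature F nu c p `^ alpha.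
  by move=> cp; rewrite /= (chart_mapK cp) (Fs ac cp).
split => //.
- by move=> x [p cp <-]; rewrite /= (chart_mapK cp); apply: enorm1; case: (nuF p).
- by move=> x [p cp <-]; rewrite (uK p cp) powR_gt0 // Kgt.
- move=> x [p cp <-]; rewrite (uK p cp) -KE // ln_powR mulrA beta_def mulVf ?mul1r //.
  by rewrite gt_eqF.
Qed.

Lemma transition_open (c d : chart R n M) : open (chart_map c @` (chart_dom c `&` chart_dom d)).
Proof.
have -> : chart_map c @` (chart_dom c `&` chart_dom d) =
    [set x | chart_cod c x /\ chart_dom d (chart_inv c x)].
  apply/seteqP; split=> [x [p [cp dp] <-]|x [[p cp <-]]].
    by split; [exists p|rewrite chart_mapK].
  by rewrite chart_mapK // => dp; exists p.
rewrite openE => x [cx dx].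
have := near_continuous (chart_inv_continuous cx) (@chart_dom_open R n M d) dx.
have : \forall y \near x, chart_cod c y.
  by apply: open_nbhs_nbhs; split=> //; exact: chart_cod_open.
by apply: filterS2 => y.
Qed.

(** Stated with some chart, which is convenient for openness; by invariance under transition maps it
    then holds in every chart around [p]. *)
Definition curv_lt_at (w : R) (p : M) : Prop := exists c,
  [/\ atlas c, chart_dom c p & curv_lt (f_ c) (nu_ c) w q (chart_map c p)].

Definition curv_le_at (w : R) (p : M) : Prop := exists c,
  [/\ atlas c, chart_dom c p & curv_le (f_ c) (nu_ c) w q (chart_map c p)].

Section ChartChange.
Variables (c d : chart R n M) (p : M).
Hypotheses (ac : atlas c) (ad : atlas d) (cp : chart_dom c p) (dp : chart_dom d p).
Let U := chart_map c @` (chart_dom c `&` chart_dom d).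
Let th := chart_map d \o chart_inv c.
Let Up : U (chart_map c p). Proof. by exists p. Qed.
Let UW : U `<=` chart_cod c. Proof. by move=> x [r [cr _] <-]; exists r. Qed.
Let thU x : U x -> chart_cod d (th x).
Proof. by move=> [r [cr dr] <-]; exists r => //; rewrite /th /= chart_mapK. Qed.
Let fth x : U x -> f_ c x = f_ d (th x).
Proof. by move=> [r [cr dr] <-]; rewrite /th /= !chart_mapK. Qed.
Let nth x : U x -> nu_ c x = nu_ d (th x).
Proof. by move=> [r [cr dr] <-]; rewrite /th /= !chart_mapK. Qed.
Let thp : th (chart_map c p) = chart_map d p.
Proof. by rewrite /th /= chart_mapK. Qed.

Lemma chart_change_curv_lt w : curv_lt (f_ d) (nu_ d) w q (chart_map d p) ->
  curv_lt (f_ c) (nu_ c) w q (chart_map c p).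
Proof.
rewrite -thp => h.
exact: (reparam_curv_lt (chart_patch ac) (chart_patch ad) (@transition_open c d) UW
  (atlas_compatible ac ad) thU fth nth Up h).
Qed.

Lemma chart_change_curv_le w : curv_le (f_ d) (nu_ d) w q (chart_map d p) ->
  curv_le (f_ c) (nu_ c) w q (chart_map c p).
Proof.
rewrite -thp => h.
exact: (reparam_curv_le (chart_patch ac) (chart_patch ad) (@transition_open c d) UW
  (atlas_compatible ac ad) thU fth nth Up h).
Qed.

End ChartChange.

Lemma curv_lt_chart w p c : curv_lt_at w p -> atlas c -> chart_dom c p ->
  curv_lt (f_ c) (nu_ c) w q (chart_map c p).
Proof. by move=> [d [ad dp h]] ac cp; exact: (chart_change_curv_lt ac ad cp dp h). Qed.

Lemma curv_le_chart w p c : curv_le_at w p -> atlas c -> chart_dom c p ->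
  curv_le (f_ c) (nu_ c) w q (chart_map c p).
Proof. by move=> [d [ad dp h]] ac cp; exact: (chart_change_curv_le ac ad cp dp h). Qed.

Lemma near_chart (c : chart R n M) (p : M) (P : set V) : chart_dom c p ->
  (\forall x \near chart_map c p, P x) -> \forall r \near p, chart_dom c r /\ P (chart_map c r).
Proof.
move=> cp nP; have np := chart_map_continuous cp nP.
have nd : \forall r \near p, chart_dom c r.
  by apply: open_nbhs_nbhs; split=> //; exact: chart_dom_open.
by apply: filterS2 nd np.
Qed.

Lemma curv_ltE (f eta : V -> 'rV[R]_n.+1) w x : curv_lt f eta w q x <->
  pos_def ((w + q / 2 * dotv (f x) (f x)) *: second_form f eta x -
    - dotv (f x) (eta x) *: metric f x).
Proof.
by split=> h v v0; have := h v v0;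
  rewrite -dotv_mx mulmxBr dotvBl -!scalemxAr !dotvZl subr_gt0.
Qed.

Lemma curv_lt_open w : open (curv_lt_at w).
Proof.
rewrite openE => p [c [ac cp h]].
have sp := chart_patch ac.
have cx : chart_cod c (chart_map c p) by exists p.
have : \forall x \near chart_map c p, curv_lt (f_ c) (nu_ c) w q x.
  move/curv_ltE: h => h.
  have n0 : (0 < n)%N by exact: ltn_trans n2.
  pose A x := (w + q / 2 * dotv (f_ c x) (f_ c x)) *: second_form (f_ c) (nu_ c) x -
    - dotv (f_ c x) (nu_ c x) *: metric (f_ c) x.
  suff Ac i j : {for chart_map c p, continuous (fun x => A x i j)}.
    by have := pos_def_open n0 Ac h; apply: filterS => x /curv_ltE.
  have Ec : {for chart_map c p, continuous (fun x => w + q / 2 * dotv (f_ c x) (f_ c x) : R)}.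
    apply: (@continuousD _ _ _ (fun=> w)); first exact: cst_continuous.
    apply: continuousM; first exact: cst_continuous.
    exact: smooth_on_continuous (smooth_sqr_norm sp) cx.
  have uc := support_continuous sp cx.
  have hc := second_form_continuous sp (i := i) (j := j) cx.
  have gc := patch_metric_continuous sp (i := i) (j := j) cx.
  have -> : (fun x => A x i j) = (fun x => (w + q / 2 * dotv (f_ c x) (f_ c x)) *
      second_form (f_ c) (nu_ c) x i j - - dotv (f_ c x) (nu_ c x) * metric (f_ c) x i j).
    by apply/funext => x; exact: mx_lincomb.
  exact: continuousB (continuousM Ec hc) (continuousM uc gc).
move=> /(near_chart cp); apply: filterS => r [cr hr].
by exists c.
Qed.

Lemma curv_lt_mono w w' p : w <= w' -> curv_lt_at w p -> curv_lt_at w' p.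
Proof.
move=> ww' [c [ac cp h]]; exists c; split=> // v v0.
have cx : chart_cod c (chart_map c p) by exists p.
apply: (lt_le_trans (h v v0)); rewrite ler_pM2r ?lerD2r //.
by rewrite dotv_mx; apply: (sp_convex (chart_patch ac) cx).
Qed.

Lemma curv_lt_exists p : exists w, curv_lt_at w p.
Proof.
have [c ac cp] := atlas_cover p.
have cx : chart_cod c (chart_map c p) by exists p.
have n0 : (0 < n)%N by exact: ltn_trans n2.
have [m m0 hm] := pos_def_bound n0 (sp_convex (chart_patch ac) cx).
set x := chart_map c p; set f := f_ c; set eta := nu_ c.
pose e := \sum_i \sum_j `|metric f x i j|.
pose u := - dotv (f x) (eta x).
have u0 : 0 < u := sp_support (chart_patch ac) cx.
have e0 : 0 <= e by apply: sumr_ge0 => i _; apply: sumr_ge0.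
(* Chosen so that the barrier is [(u n e + 1) / m]: as [h] is at least [m |v|^2] and [g] at most
   [n e |v|^2], the [+ 1] makes the inequality strict. *)
exists ((u * (n%:R * e) + 1) / m - q / 2 * dotv (f x) (f x)), c; split=> // v v0.
rewrite subrK -/x -/f -/eta -/u.
have vv := dotvv_gt0 v0.
have ge : dotv (v *m metric f x) v <= n%:R * e * dotv v v.
  apply: le_trans (ler_norm _) _; apply: dotv_entries_le => i j.
  rewrite /e (bigD1 i) //= (bigD1 j) //= -addrA lerDl addr_ge0 //.
    by apply: sumr_ge0.
  by apply: sumr_ge0 => l _; apply: sumr_ge0.
apply: (@le_lt_trans _ _ (u * (n%:R * e * dotv v v))); first by rewrite ler_pM2l.
apply: (@lt_le_trans _ _ ((u * (n%:R * e) + 1) / m * (m * dotv v v))).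
  by rewrite [ltRHS]mulrA divfK ?gt_eqF // mulrDl mul1r !mulrA ltrDl.
rewrite ler_pM2l; first exact: hm.
by rewrite divr_gt0 // ltr_wpDl // !mulr_ge0 // ltW.
Qed.

Lemma curv_lt_left w p : curv_lt_at w p -> exists k, curv_lt_at (w - k.+1%:R^-1) p.
Proof.
move=> [c [ac cp /curv_ltE h]].
set x := chart_map c p in h *; set f := f_ c in h *; set eta := nu_ c in h *.
have n0 : (0 < n)%N by exact: ltn_trans n2.
pose A (t : R) := (t + q / 2 * dotv (f x) (f x)) *: second_form f eta x -
    - dotv (f x) (eta x) *: metric f x.
have Ac i j : {for w, continuous (fun t : R => A t i j)}.
  have -> : (fun t : R => A t i j) = (fun t : R => (t + q / 2 * dotv (f x) (f x)) *
      second_form f eta x i j - - dotv (f x) (eta x) * metric f x i j).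
    by apply/funext => t; exact: mx_lincomb.
    apply: continuousB; last exact: cst_continuous.
    apply: continuousM; last exact: cst_continuous.
    by apply: continuousD; last exact: cst_continuous.
have /nbhs_ballP[r /= r0 br] := pos_def_open n0 Ac h.
have [k kr] : exists k, k.+1%:R^-1 < r :> R.
  have [k _ hk] := near_infty_natSinv_lt (PosNum r0).
  by exists k; apply: hk => /=.
exists k, c; split=> //; apply/curv_ltE; apply: (br (w - k.+1%:R^-1)).
by rewrite /ball /= opprB addrCA subrr addr0 ger0_norm.
Qed.

(** The least constant [w0] on the compact set [C] is attained by contact. Contact gives F = - nu
    nearby, and this in turn identifies [w0]. *)
Lemma clopen_touching (C : set M) : open C -> closed C -> C !=set0 ->
  (exists2 p, C p & \forall r \near p, F r = - nu r) /\
  (forall p, C p -> curv_le_at (1 - q / 2) p).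
Proof.
move=> Co Ccl [p0 Cp0].
have Cc : compact C by exact: (subclosed_compact Ccl (@manifold_compact _ _ M)).
pose S := [set w : R | forall p, C p -> curv_lt_at w p].
have S0 : S !=set0.
  have [k|k l kl p|p Cp|k hk] := @compact_exhaustion M C (fun k => curv_lt_at k%:R) Cc.
  - exact: curv_lt_open.
  - by apply: curv_lt_mono; rewrite ler_nat.
  - have [w hw] := curv_lt_exists p; exists (Num.bound `|w|).
    apply: curv_lt_mono hw; apply: le_trans (ler_norm _) _.
    by apply: ltW; exact: archi_boundP.
  - by exists k%:R => p /hk.
have lowS p c (v : V) : C p -> atlas c -> chart_dom c p -> v != 0 ->
    let x := chart_map c p in
    lbound S ((- dotv (f_ c x) (nu_ c x) * dotv (v *m metric (f_ c) x) v) /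
      dotv (v *m second_form (f_ c) (nu_ c) x) v - q / 2 * dotv (f_ c x) (f_ c x)).
  move=> Cp ac cp v0 x w Sw.
  have cx : chart_cod c x by exists p.
  have h0 : 0 < dotv (v *m second_form (f_ c) (nu_ c) x) v.
    by rewrite dotv_mx; apply: (sp_convex (chart_patch ac) cx).
  have := curv_lt_chart (Sw p Cp) ac cp v0.
  by rewrite -/x -ltr_pdivrMr // lerBlDr => /ltW.
have e1 : basis_vec R (Ordinal (ltn_trans (isT : (0 < 1)%N) n2)) != 0 :> V.
  apply/negP => /eqP /(congr1 (fun v : V => dotv v v)); rewrite dotv0l dotv_basis mxE !eqxx.
  by move/eqP; rewrite oner_eq0.
have hasS : has_inf S.
  split=> //; have [c ac cp] := atlas_cover p0.
  by eexists; exact: (lowS p0 c _ Cp0 ac cp e1).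
pose w0 := inf S.
have w0_le p : C p -> curv_le_at w0 p.
  move=> Cp; have [c ac cp] := atlas_cover p; exists c; split=> // v.
  have [->|v0] := eqVneq v 0; first by rewrite !mul0mx !dotv0l !mulr0.
  have cx : chart_cod c (chart_map c p) by exists p.
  have h0 : 0 < dotv (v *m second_form (f_ c) (nu_ c) (chart_map c p)) v.
    by rewrite dotv_mx; apply: (sp_convex (chart_patch ac) cx).
  have := lb_le_inf S0 (lowS p c v Cp ac cp v0).
  by rewrite -/w0 lerBlDr ler_pdivrMr.
(* If the inequality were strict on all of [C], each point would allow some [w0 - 1/(k+1)], and by
   compactness one [k] would serve for all points, below the infimum. *)
have [p Cp np] : exists2 p, C p & ~ curv_lt_at w0 p.
  apply: contrapT => no.
  have all p : C p -> curv_lt_at w0 p.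
    by move=> Cp; apply: contrapT => np; apply: no; exists p.
  have [k|k l kl p|p Cp|k hk] :=
    @compact_exhaustion M C (fun k => curv_lt_at (w0 - k.+1%:R^-1)) Cc.
  - exact: curv_lt_open.
  - apply: curv_lt_mono; rewrite lerB // lef_pV2 ?posrE // ler_nat ltnS //.
  - exact: curv_lt_left (all p Cp).
  - have := ge_inf hasS.2 (hk : S (w0 - k.+1%:R^-1)).
    by rewrite -/w0 lerBrDr gerDl leNgt invr_gt0 ltr0n.
have [c ac cp] := atlas_cover p.
set x0 := chart_map c p.
have [v [v0 nlt]] : exists v : V, v != 0 /\
    ~ - dotv (f_ c x0) (nu_ c x0) * dotv (v *m metric (f_ c) x0) v <
    (w0 + q / 2 * dotv (f_ c x0) (f_ c x0)) * dotv (v *m second_form (f_ c) (nu_ c) x0) v.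
  apply: contrapT => no; apply: np; exists c; split=> // v v0.
  by apply: contrapT => nlt; apply: no; exists v.
have eqv := curv_le_chart (w0_le p Cp) ac cp v; rewrite -/x0 in eqv.
have {}eqv : - dotv (f_ c x0) (nu_ c x0) * dotv (v *m metric (f_ c) x0) v =
    (w0 + q / 2 * dotv (f_ c x0) (f_ c x0)) * dotv (v *m second_form (f_ c) (nu_ c) x0) v.
  by apply/le_anti; rewrite eqv /= leNgt; apply/negP.
(* The inequality with [w0] is known on [C] only; as [C] is open, the part of the chart over it is
   still a patch. *)
pose W := [set x | chart_cod c x /\ C (chart_inv c x)].
have Wo : open W.
  rewrite openE => x [cx Cx].
  have := near_continuous (chart_inv_continuous cx) Co Cx.
  have : \forall y \near x, chart_cod c y.
    by apply: open_nbhs_nbhs; split=> //; exact: chart_cod_open.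
  by apply: filterS2 => y.
have Wc : W `<=` chart_cod c by move=> x [].
have sp := soliton_patch_sub Wo Wc (chart_patch ac).
have cle x : W x -> curv_le (f_ c) (nu_ c) w0 q x.
  move=> [[r cr <-]]; rewrite chart_mapK // => Cr.
  exact: curv_le_chart (w0_le r Cr) ac cr.
have Wx0 : W x0 by split; [exists p|rewrite chart_mapK].
have lnE := patch_touching n2 beta0 q0 nq sp cle Wx0 v0 eqv.
have nx := patch_rigidity n2 beta0 q0 q1 nq sp cle Wx0 lnE.
have np' : \forall r \near p, F r = - nu r.
  have := near_chart cp nx; apply: filterS => r [cr].
  by rewrite /= chart_mapK.
have Fp : F p = - nu p := nbhs_singleton np'.
have nn : dotv (nu p) (nu p) = 1.
  by apply: enorm1; case: Fc => _ _ h _; case: (h p).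
have ux : dotv (f_ c x0) (nu_ c x0) = -1 by rewrite /= chart_mapK // Fp dotvNl nn.
have ffx : dotv (f_ c x0) (f_ c x0) = 1.
  by rewrite /= chart_mapK // Fp dotvNl dotvNr opprK nn.
have E0 := patch_barrier_gt0 n2 sp cle Wx0.
move: lnE E0; rewrite ux ffx opprK ln1 mulr0 mulr1 => /eqP lnE E0.
(* With u = 1 and |F| = 1 the relation ln E = q ln u reads E = [w0 + q / 2] = 1. *)
have w0E : w0 = 1 - q / 2 by move: lnE; rewrite ln_eq0 // => /eqP h; apply: (addIr (q / 2)); rewrite subrK.
by split=> [|r Cr]; [exists p|rewrite -w0E; exact: w0_le].
Qed.

Lemma soliton_position p : F p = - nu p.
Proof.
pose G := [set p : M | \forall r \near p, F r = - nu r].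
suff GT : G = setT by have : G p by [rewrite GT]; exact: nbhs_singleton.
have [_ hle] := clopen_touching (@openT M) (@closedT M) (@manifold_nonempty _ _ M).
have Go : open G by rewrite openE => r Gr; exact: near_join Gr.
(* No continuity of [nu] is at hand, so F = - nu cannot be passed to the limit directly. The
   continuous quantities |F|^2 and u equal 1 on [G], hence at a limit point; there the defect for
   [1 - q / 2] vanishes and [patch_rigidity] applies again. *)
have Gc : closed G.
  move=> r clr; have [c ac cr] := atlas_cover r.
  have sp := chart_patch ac; have cx : chart_cod c (chart_map c r) by exists r.
  have cle x : chart_cod c x -> curv_le (f_ c) (nu_ c) (1 - q / 2) q x.
    by move=> [t ct <-]; exact: curv_le_chart (hle t I) ac ct.
  have GE t : G t -> dotv (F t) (F t) = 1 /\ - dotv (F t) (nu t) = 1.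
    move=> /nbhs_singleton ->; rewrite !dotvNl !dotvNr !opprK.
    by split; apply: enorm1; case: Fc => _ _ h _; case: (h t).
  have lim (k : V -> R) : {for chart_map c r, continuous k} ->
      (forall t, G t -> chart_dom c t -> k (chart_map c t) = 1) -> k (chart_map c r) = 1.
    move=> kc k1; apply: contrapT => ne.
    have ne' : [set t : R | t != 1] (k (chart_map c r)) by apply/eqP.
    have o1 : open [set t : R | t != 1] by exact: open_neq.
    have := near_chart cr (near_continuous kc o1 ne').
    move=> /clr[t [Gt [ct /=]]]; by rewrite k1 // eqxx.
  have ff := lim _ (smooth_on_continuous (smooth_sqr_norm sp) cx).
  have uu := lim _ (support_continuous sp cx).
  have {}ff : dotv (f_ c (chart_map c r)) (f_ c (chart_map c r)) = 1.
    by apply: ff => t Gt ct; rewrite /= chart_mapK //; case: (GE t Gt).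
  have {}uu : - dotv (f_ c (chart_map c r)) (nu_ c (chart_map c r)) = 1.
    by apply: uu => t Gt ct; rewrite /= chart_mapK //; case: (GE t Gt).
  have lnE : ln (1 - q / 2 + q / 2 * dotv (f_ c (chart_map c r)) (f_ c (chart_map c r))) =
      q * ln (- dotv (f_ c (chart_map c r)) (nu_ c (chart_map c r))).
    by rewrite ff uu mulr1 subrK ln1 mulr0.
  have := near_chart cr (patch_rigidity n2 beta0 q0 q1 nq sp cle cx lnE).
  by apply: filterS => t [ct]; rewrite /= chart_mapK.
apply: contrapT => GT.
have [|||[t nGt Gt] _] := clopen_touching (C := ~` G).
- exact: closed_openC.
- exact: open_closedC.
- apply: contrapT => no; apply: GT; apply/seteqP; split=> // t _.
  by apply: contrapT => nGt; apply: no; exists t.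
- exact: nGt Gt.
Qed.

End Hypersurface.

(** * Surjectivity onto the sphere *)

Section Range.
Variables (R : realType) (n : nat) (M : closed_manifold R n).
Variables (F nu : M -> 'rV[R]_n.+1) (beta : R).
Hypotheses (n2 : (2 <= n)%N) (F_patch : forall c, atlas c ->
    soliton_patch beta (chart_cod c) (F \o chart_inv c) (nu \o chart_inv c))
  (F_position : forall p, F p = - nu p).
Local Notation f_ c := (F \o chart_inv c).
Local Notation nu_ c := (nu \o chart_inv c).

Let FF p : dotv (F p) (F p) = 1.
Proof.
have [c ac cp] := atlas_cover p.
have cx : chart_cod c (chart_map c p) by exists p.
have := sp_unit (F_patch ac) cx.
by rewrite /= chart_mapK // F_position dotvNl dotvNr opprK.
Qed.

Let height_continuous (y : 'rV[R]_n.+1) : continuous (fun p => dotv (F p) y : R).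
Proof.
move=> p; have [c ac cp] := atlas_cover p.
have cx : chart_cod c (chart_map c p) by exists p.
have kc := smooth_on_continuous
  (smooth_dotv y (sp_open (F_patch ac)) (sp_smooth (F_patch ac))) cx.
have h := @continuous_comp _ _ _ (chart_map c) (fun x => dotv (f_ c x) y) p
  (chart_map_continuous cp) kc.
have ne : \forall r \near p, dotv (f_ c (chart_map c r)) y = dotv (F r) y.
  have : \forall r \near p, chart_dom c r.
    by apply: open_nbhs_nbhs; split=> //; exact: chart_dom_open.
  by apply: filterS => r cr; rewrite /= chart_mapK.
have h' : (fun r => dotv (f_ c (chart_map c r)) y) @ p --> (dotv (F p) y : R).
  have e : dotv (f_ c (chart_map c p)) y = dotv (F p) y by rewrite /comp chart_mapK.
  by rewrite -e; exact: h.
by apply: cvg_trans h'; apply: near_eq_cvg; exact: ne.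
Qed.

(** For a unit vector [y] the height [<F, y>] attains its maximum. There [y] is orthogonal to the
    tangent space, hence a multiple [t] of the unit normal vector F p, with [t = 1] or [t = -1]. *)
Theorem range_unit_sphere : range F = unit_sphere R n.+1.
Proof.
apply/seteqP; split=> [x [p _ <-]|y /= /enorm1 yy].
  by rewrite /unit_sphere /= /enorm FF sqrtr1.
have [p _ pmax] := @compact_EVT_max M R (fun p => dotv (F p) y) setT
  (@manifold_nonempty _ _ M) (@manifold_compact _ _ M)
  (continuous_subspaceT (height_continuous (y := y))).
have {}pmax r : dotv (F r) y <= dotv (F p) y by apply: pmax; rewrite inE.
have [c ac cp] := atlas_cover p.
have sp := F_patch ac; set x0 := chart_map c p.
have cx : chart_cod c x0 by exists p.
have fx0 : f_ c x0 = F p by rewrite /x0 /comp chart_mapK.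
have nx0 : nu_ c x0 = nu p by rewrite /x0 /comp chart_mapK.
have Dy v : dotv ('D_v (f_ c) x0) y = 0.
  have hs := smooth_dotv (- y) (sp_open sp) (sp_smooth sp).
  have hmin : \forall x \near x0, dotv (f_ c x0) (- y) <= dotv (f_ c x) (- y).
    by near=> x; rewrite !dotvNr lerN2 fx0; exact: pmax.
  have := derive_local_min v (sp_open sp) hs cx hmin.
  rewrite derive_dotv; last exact: smooth_on_derivable (sp_smooth sp) cx.
  by rewrite dotvNr => /eqP; rewrite oppr_eq0 => /eqP.
pose t := dotv (F p) y.
have [L [d [Lg Lh]]] := patch_diagonalization sp cx.
have Ft v : dotv (F p) ('D_v (f_ c) x0) = 0.
  rewrite F_position dotvNl dotvC.
  have := sp_normal sp v cx; rewrite nx0 => ->.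
  by rewrite oppr0.
have yE : y = t *: F p.
  apply/eqP; rewrite -subr_eq0 -dotvv_eq0 (frame_parseval sp cx Lg).
  rewrite big1 => [|i _]; last first.
    by rewrite dotvBl dotvZl Ft mulr0 subr0 dotvC Dy mul0r.
  have -> : dotv (y - t *: F p) (- (nu_ c) x0) = 0; last by rewrite mul0r addr0.
  rewrite nx0 -F_position dotvBl dotvZl FF mulr1 dotvC.
  by rewrite subrr.
have t2 : t * t = 1 by move: yy; rewrite {1 2}yE dotvZl dotvZr FF mulr1.
have /orP[/eqP t1|/eqP t1] : (t == 1) || (t == -1).
  rewrite -subr_eq0 -[X in _ || X]subr_eq0 opprK -mulf_eq0.
  have -> : (t - 1) * (t + 1) = t * t - 1 by ring.
  by rewrite t2 subrr.
by exists p => //; rewrite yE t1 scale1r.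
(* A maximal height of -1 forces [|F r + y|^2 = 2 + 2 <F r, y>] to be at most 0, so F would be
   constant, against the immersion property. *)
have Fcst r : F r = - y.
  apply/eqP; rewrite -subr_eq0 opprK -dotvv_eq0 eq_le dotvv_ge0 andbT.
  rewrite dotvDl !dotvDr FF yy (dotvC y).
  by have := pmax r; rewrite -/t t1; move: (dotv (F r) y) => s; lra.
have e1 : basis_vec R (Ordinal (ltn_trans (isT : (0 < 1)%N) n2)) != 0 :> 'rV[R]_n.
  apply/negP => /eqP /(congr1 (fun v : 'rV[R]_n => dotv v v)).
  rewrite dotv0l dotv_basis mxE !eqxx.
  by move/eqP; rewrite oner_eq0.
have := sp_immersion sp cx e1; rewrite (_ : f_ c = cst (- y)); last first.
  by apply/funext => x; exact: Fcst.
by rewrite derive_cst eqxx.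
Unshelve. all: by end_near.
Qed.

End Range.

(** * The unit sphere *)

Section RowCalculus.
Variables (R : realType) (V : normedModType R) (m : nat).

Definition scale_vec (u : 'rV[R]_m) (c : R) : 'rV[R]_m := c *: u.

Lemma scale_vec_linear u : linear_for *:%R (scale_vec u : R^o -> 'rV[R]_m).
Proof. by move=> a b c; rewrite /scale_vec scalerDl scalerA. Qed.

HB.instance Definition _ u := GRing.isLinear.Build R R^o 'rV[R]_m _ (scale_vec u)
  (scale_vec_linear u).

Lemma smooth_on_row (U : set V) (g : 'I_m -> V -> R) : open U ->
  (forall i, smooth_on U (g i)) -> smooth_on U (fun x => \row_i g i x).
Proof.
move=> Uo gs.
have gu i : smooth_on U (fun x => g i x *: basis_vec R i).
  have c : continuous (scale_vec (basis_vec R i) : R^o -> 'rV[R]_m).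
    by move=> a; apply: scalel_continuous.
  exact: (@smooth_on_linear R V R^o _ (scale_vec (basis_vec R i)) U (g i) Uo c (gs i)).
apply: (smooth_on_eq Uo _ (smooth_on_sum (index_enum 'I_m) xpredT Uo gu)) => x _.
by rewrite [RHS]rV_basis; apply: eq_bigr => i _; rewrite mxE.
Qed.

Lemma smooth_on_id (U : set V) : open U -> smooth_on U (@id V).
Proof.
move=> Uo [|k] /=; first by move=> x _; exact: cvg_id.
split=> [x _|v]; first by apply: (@linear_differentiable R V V idfun) => y; exact: cvg_id.
apply: (Ck_on_eq Uo (f := fun=> v)); last exact: smooth_on_cst.
by move=> x _; rewrite derive_id.
Qed.

End RowCalculus.

(** * Stereographic projection from either pole *)

Section Stereographic.
Variables (R : realType) (n : nat) (s : R).
Hypothesis ss : s * s = 1.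
Local Notation V := 'rV[R]_n.
Local Notation E := 'rV[R]_n.+1.
Implicit Types (x : E) (y : V).

(* Stereographic projection from the pole [s *: basis_vec R ord0]. *)
Definition stereo_proj x : V := \row_j (x 0 (lift ord0 j) * (1 - s * x 0 ord0)^-1).

Definition stereo_inv y : E :=
  \row_k ((if unlift ord0 k is Some j then 2 * y 0 j else s * (dotv y y - 1)) * (dotv y y + 1)^-1).

Lemma dotv_recl x x' : dotv x x' =
  x 0 ord0 * x' 0 ord0 + \sum_(j < n) x 0 (lift ord0 j) * x' 0 (lift ord0 j).
Proof. by rewrite dotvE big_ord_recl. Qed.

Lemma sqr1_gt0 y : 0 < dotv y y + 1.
Proof. by rewrite ltr_wpDl // dotvv_ge0. Qed.

Lemma stereo_inv0 y : stereo_inv y 0 ord0 = s * (dotv y y - 1) * (dotv y y + 1)^-1.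
Proof. by rewrite mxE unlift_none. Qed.

Lemma stereo_invS y j : stereo_inv y 0 (lift ord0 j) = 2 * y 0 j * (dotv y y + 1)^-1.
Proof. by rewrite mxE liftK. Qed.

Lemma stereo_inv_unit y : dotv (stereo_inv y) (stereo_inv y) = 1.
Proof.
have r0 := sqr1_gt0 y; rewrite dotv_recl stereo_inv0.
under eq_bigr => j _ do rewrite stereo_invS.
have -> : \sum_(j < n) 2 * y 0 j * (dotv y y + 1)^-1 * (2 * y 0 j * (dotv y y + 1)^-1) =
    4 * (dotv y y + 1)^-1 * (dotv y y + 1)^-1 * dotv y y.
  by rewrite [X in _ = _ * X]dotvE mulr_sumr; apply: eq_bigr => j _; ring.
move: r0; move: (dotv y y) => r r0.
transitivity (((s * s) * (r - 1) ^+ 2 + 4 * r) * (r + 1)^-1 ^+ 2); first by ring.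
by rewrite ss; field; rewrite gt_eqF.
Qed.

(** The right side is positive, so the inverse map misses the pole and each chart has the whole
    coordinate space as codomain. *)
Lemma stereo_inv_den y : 1 - s * stereo_inv y 0 ord0 = 2 * (dotv y y + 1)^-1.
Proof.
have r0 := sqr1_gt0 y; rewrite stereo_inv0 !mulrA ss mul1r.
by move: r0; move: (dotv y y) => r r0; field; rewrite gt_eqF.
Qed.

Lemma stereo_invK : cancel stereo_inv stereo_proj.
Proof.
move=> y; apply/rowP => j; rewrite mxE stereo_inv_den stereo_invS.
have r0 := sqr1_gt0 y; move: r0; move: (dotv y y) => r r0; field; rewrite gt_eqF //.
Qed.

Lemma stereo_projK x : dotv x x = 1 -> 1 - s * x 0 ord0 != 0 -> stereo_inv (stereo_proj x) = x.
Proof.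
move=> xx d0; set a := x 0 ord0 in d0 *.
have rE : dotv (stereo_proj x) (stereo_proj x) = (1 + s * a) / (1 - s * a).
  rewrite dotvE; under eq_bigr => j _ do rewrite !mxE -/a.
  have -> : \sum_(j < n) x 0 (lift ord0 j) / (1 - s * a) * (x 0 (lift ord0 j) / (1 - s * a)) =
    (1 - a * a) / (1 - s * a) / (1 - s * a).
    have -> : 1 - a * a = \sum_(j < n) x 0 (lift ord0 j) * x 0 (lift ord0 j).
      by rewrite -xx dotv_recl -/a addrAC subrr add0r.
    rewrite !mulr_suml; apply: eq_bigr => j _; ring.
  have -> : 1 - a * a = (1 + s * a) * (1 - s * a).
    by transitivity (1 - (s * s) * (a * a)); [rewrite ss; ring|ring].
  by rewrite mulfK.
have r1 : dotv (stereo_proj x) (stereo_proj x) + 1 = 2 / (1 - s * a) by rewrite rE; field.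
apply/rowP => k; case: (unliftP ord0 k) => [j|] ->.
  by rewrite stereo_invS r1 mxE -/a; field.
rewrite stereo_inv0 r1 rE -/a.
transitivity ((s * s) * a); last by rewrite ss mul1r.
by field.
Qed.

Lemma smooth_coord (m : nat) (U : set 'rV[R]_m) j : open U -> smooth_on U (fun y : 'rV[R]_m => y 0 j).
Proof.
move=> Uo; apply: (smooth_on_eq Uo _ (smooth_dotv (basis_vec R j) Uo (smooth_on_id Uo))) => y _.
exact: dotv_basis.
Qed.

Lemma smooth_sqr : smooth_on [set: V] (fun y : V => dotv y y).
Proof.
have cs j := smooth_coord j (@openT V).
apply: (smooth_on_eq openT _
  (smooth_on_sum (index_enum 'I_n) xpredT openT (fun j => smooth_onM openT (cs j) (cs j)))) => y _.
by rewrite dotvE.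
Qed.

Lemma stereo_inv_smooth : smooth_on [set: V] stereo_inv.
Proof.
have c1 (c : R) : smooth_on [set: V] (fun=> c) := smooth_on_cst _ openT.
have iv : smooth_on [set: V] (fun y : V => (dotv y y + 1)^-1).
  apply: smooth_onV => //; first exact: openT.
    by move=> y _; rewrite gt_eqF // sqr1_gt0.
  exact: smooth_onD openT smooth_sqr (c1 1).
apply: (smooth_on_row openT) => k; apply: (smooth_onM openT _ iv).
case: (unlift ord0 k) => [j|].
  exact: smooth_onM openT (c1 2) (smooth_coord j openT).
exact: smooth_onM openT (c1 s) (smooth_onD openT smooth_sqr (c1 (- 1))).
Qed.

Lemma stereo_proj_smooth (U : set E) : open U ->
  (forall x, U x -> 1 - s * x 0 ord0 != 0) -> smooth_on U stereo_proj.
Proof.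
move=> Uo U0; have c1 (c : R) : smooth_on U (fun=> c) := smooth_on_cst _ Uo.
apply: (smooth_on_row Uo) => j; apply: (smooth_onM Uo (smooth_coord _ Uo)).
apply: (smooth_onV Uo U0); apply: (smooth_onD Uo (c1 1)).
apply: (smooth_on_eq Uo _ (smooth_onM Uo (c1 (- s)) (smooth_coord ord0 Uo))) => x _.
by rewrite mulNr.
Qed.

End Stereographic.

(** * Subspace topology on the type of points of a set *)

Section SetType.
Variables (X : topologicalType) (A : set X).

Lemma nbhs_set_type (p : A) (U : set A) : nbhs p U ->
  exists2 B : set X, nbhs (val p) B & val @^-1` B `<=` U.
Proof.
move=> [_ /= [[B Bo <-] Bp BU]]; exists B => //.
by apply: open_nbhs_nbhs; split.
Qed.

Lemma set_type_val_continuous : continuous (val : A -> X).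
Proof. exact: initial_continuous. Qed.

Lemma set_type_hausdorff : hausdorff_space X -> hausdorff_space A.
Proof.
move=> Xh p r pr; apply/val_inj/Xh => B C nB nC.
have [t [tB tC]] := pr _ _ (set_type_val_continuous nB) (set_type_val_continuous nC).
by exists (val t).
Qed.

(** A property of points of the subtype becomes one of ambient points by quantifying over membership
    proofs; near-covering then transfers from [A]. *)
Lemma set_type_compact : compact A -> compact [set: A].
Proof.
move=> /compact_near_coveringP Ac; apply/compact_near_coveringP => I F P FF cover.
have : \forall i \near F, A `<=` [set x | forall h : x \in A, P i (exist _ x h)].
  apply: Ac => x Ax.
  have [[B C] /= [nB FC] BC] := cover (exist _ x (mem_set Ax)) Logic.I.
  have [B' nB' B'B] := nbhs_set_type nB.
  exists (B', C) => // -[y i] [/= B'y Ci] h.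
  by apply: (BC (exist _ y h, i)); split=> //; exact: B'B.
by apply: filterS => i AP [x h] _; apply: AP; exact: set_mem.
Qed.

End SetType.

Lemma continuous_den (R : realType) (T : topologicalType) (k : T -> R) (s : R) (x : T) :
  {for x, continuous k} -> {for x, continuous (fun y => 1 - s * k y)}.
Proof.
move=> kc; rewrite /continuous_at.
have c1 : (fun=> 1 : R) @ x --> (1 : R) by exact: cvg_cst.
have c2 : (fun=> s : R) @ x --> (s : R) by exact: cvg_cst.
exact: (cvgB c1 (cvgM c2 kc)).
Qed.

(** * The sphere as a closed manifold *)

Section Sphere.
Variables (R : realType) (n : nat).
Local Notation V := 'rV[R]_n.
Local Notation E := 'rV[R]_n.+1.
Local Notation S := (unit_sphere R n.+1).

Lemma unit_sphereE (x : E) : S x <-> dotv x x = 1.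
Proof.
split; first exact: enorm1.
by move=> xx; rewrite /unit_sphere /= /enorm xx sqrtr1.
Qed.

Section Chart.
Variables (s : R) (ss : s * s = 1).

Definition stereo_dom : set S := [set p : S | 1 - s * (val p : E) 0 ord0 != 0].

Definition stereo_point (y : V) : S :=
  exist _ (stereo_inv s y) (mem_set ((unit_sphereE _).2 (stereo_inv_unit ss y))).

Definition stereo_map (p : S) : V := stereo_proj s (val p).

Lemma stereo_pointK : cancel stereo_point stereo_map.
Proof. by move=> y; exact: stereo_invK. Qed.

Lemma stereo_point_dom y : stereo_dom (stereo_point y).
Proof.
by rewrite /stereo_dom /= stereo_inv_den // mulf_neq0 // invr_eq0 gt_eqF // sqr1_gt0.
Qed.

Lemma stereo_cod : stereo_map @` stereo_dom = setT.
Proof.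
by apply/seteqP; split=> // y _; exists (stereo_point y);
  [exact: stereo_point_dom|exact: stereo_pointK].
Qed.

Lemma stereo_den_open : open [set x : E | 1 - s * x 0 ord0 != 0].
Proof.
have c : continuous (fun x : E => 1 - s * x 0 ord0).
  by move=> x; apply: continuous_den; exact: coord_continuous.
rewrite openE => x; exact: (near_continuous (c x) (@open_neq R 0)).
Qed.

Lemma stereo_dom_open : open stereo_dom.
Proof. by exists [set x : E | 1 - s * x 0 ord0 != 0]; first exact: stereo_den_open. Qed.

Lemma stereo_cod_open : open (stereo_map @` stereo_dom).
Proof. by rewrite stereo_cod; exact: openT. Qed.

Lemma stereo_mapK p : stereo_dom p -> stereo_point (stereo_map p) = p.
Proof.
move=> dp; apply: val_inj; apply: stereo_projK => //.
by apply/unit_sphereE; exact: set_valP.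
Qed.

Lemma stereo_map_continuous p : stereo_dom p -> {for p, continuous stereo_map}.
Proof.
move=> dp; apply: continuous_comp; first exact: set_type_val_continuous.
exact: (smooth_on_continuous (stereo_proj_smooth stereo_den_open (fun _ => id)) dp).
Qed.

Lemma stereo_point_continuous y : (stereo_map @` stereo_dom) y ->
  {for y, continuous stereo_point}.
Proof.
move=> _; apply: continuous_comp_initial => {}y.
exact: (smooth_on_continuous (stereo_inv_smooth _ s)).
Qed.

Definition stereo_chart : chart R n S :=
  Chart stereo_dom_open stereo_cod_open stereo_mapK stereo_map_continuous stereo_point_continuous.

End Chart.

(** The condition [s * s = 1] leaves the projections from the two opposite poles. *)
Definition stereo_atlas : set (chart R n S) :=
  [set c | exists s (ss : s * s = 1), c = stereo_chart ss].

Lemma stereo_atlas_cover (p : S) : exists2 c, stereo_atlas c & chart_dom c p.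
Proof.
have s1 : (1 : R) * 1 = 1 by rewrite mulr1.
have s2 : (- 1 : R) * - 1 = 1 by rewrite mulrNN mulr1.
have [e|ne] := eqVneq (1 - 1 * (val p : E) 0 ord0) 0.
  exists (stereo_chart s2); first by exists (-1), s2.
  rewrite /= /stereo_dom /=; move/eqP: e; rewrite subr_eq0 mul1r => /eqP <-.
  by rewrite mulr1 opprK gt_eqF.
by exists (stereo_chart s1); first by exists 1, s1.
Qed.

Lemma stereo_atlas_compatible c d : stereo_atlas c -> stereo_atlas d ->
  smooth_on (chart_map c @` (chart_dom c `&` chart_dom d)) (chart_map d \o chart_inv c).
Proof.
move=> [s [ss ->]] [t [tt ->]].
pose U := [set y : V | 1 - t * stereo_inv s y 0 ord0 != 0].
have ps := stereo_inv_smooth n s.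
have cs k : smooth_on [set: V] (fun y => stereo_inv s y 0 k).
  apply: (smooth_on_eq openT _ (smooth_dotv (basis_vec R k) openT ps)) => y _.
  exact: dotv_basis.
have Uo : open U.
  have kc : continuous (fun y : V => 1 - t * stereo_inv s y 0 ord0).
    by move=> x; apply: continuous_den; exact: smooth_on_continuous (cs ord0) _.
  rewrite openE => x; exact: (near_continuous (kc x) (@open_neq R 0)).
have US : U `<=` setT by [].
have c1 (a : R) : smooth_on U (fun=> a) := smooth_on_cst _ Uo.
have csU k := smooth_on_sub US (cs k).
apply: (@smooth_on_sub _ _ _ U).
  by move=> _ [p [dp dp'] <-]; rewrite /U /=; have := stereo_mapK ss dp => /(congr1 val) /= ->.
apply: (smooth_on_row Uo) => j; apply: (smooth_onM Uo (csU _)).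
apply: (smooth_onV Uo); first by [].
apply: (smooth_onD Uo (c1 1)).
apply: (smooth_on_eq Uo _ (smooth_onM Uo (c1 (- t)) (csU ord0))) => x _.
by rewrite mulNr.
Qed.

Lemma sphere_nonempty : [set: S] !=set0.
Proof.
have s1 : (1 : R) * 1 = 1 by rewrite mulr1.
by exists (stereo_point s1 0).
Qed.

Lemma sphere_compact : compact [set: S].
Proof.
apply: set_type_compact; rewrite (_ : S = [set x | dotv x x = 1]).
  exact: unit_sphere_compact.
by apply/seteqP; split=> x /unit_sphereE.
Qed.

Lemma sphere_hausdorff : hausdorff_space S.
Proof. by apply: set_type_hausdorff; exact: norm_hausdorff. Qed.

Definition sphere_manifold : closed_manifold R n :=
  ClosedManifold stereo_atlas_cover stereo_atlas_compatible sphere_hausdorff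
    sphere_compact sphere_nonempty.

End Sphere.

Section InnerBall.
Variables (R : realType) (m : nat).
Local Notation E := 'rV[R]_m.

(* [dotv x x] avoids the value 1 off the sphere, so it stays below 1 on a
   connected set that meets the open ball. *)
Lemma enclosed_by_sphere (z : E) : dotv z z < 1 -> enclosed_by (unit_sphere R m) z.
Proof.
move=> z1; split.
  by move=> /enorm1 zz; move: z1; rewrite zz ltxx.
have ball1 x : connected_component (~` unit_sphere R m) z x -> dotv x x < 1.
  move=> [C [Cz CS Cc] Cx]; rewrite ltNge; apply/negP => x1.
  have /connected_intervalP h : connected ((fun x : E => dotv x x : R) @` C).
    by apply: connected_continuous_connected => //; apply: continuous_subspaceT;
      exact: dotv_sqr_continuous.
  have [y Cy y1] : ((fun x : E => dotv x x : R) @` C) 1.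
    by apply: (h (dotv z z) (dotv x x)); [exists z|exists x|rewrite (ltW z1) x1].
  by apply: (CS y Cy); rewrite /unit_sphere /= /enorm y1 sqrtr1.
exists 1; split=> // a a1 x /ball1 x1.
by apply: le_trans (ltW a1); apply: dotv_le1_norm; exact: ltW.
Qed.

End InnerBall.

(** * The sphere as a solution *)

Section SphereSolution.
Variables (R : realType) (n : nat).
Local Notation V := 'rV[R]_n.
Local Notation E := 'rV[R]_n.+1.
Local Notation S := (unit_sphere R n.+1).
Local Notation M := (sphere_manifold R n).

Definition sphere_incl (p : M) : E := val (p : S).
Definition sphere_normal (p : M) : E := - sphere_incl p.

Lemma sphere_incl_unit p : dotv (sphere_incl p) (sphere_incl p) = 1.
Proof. by apply/unit_sphereE; exact: set_valP. Qed.

Lemma sphere_incl_range : range sphere_incl = S.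
Proof.
apply/seteqP; split=> [_ [p _ <-]|x Sx]; first exact: set_valP.
by exists (exist _ x (mem_set Sx)).
Qed.

Section Chart.
Variables (s : R) (ss : s * s = 1).
Local Notation phi := (stereo_inv s : V -> E).

(** The projection is a differentiable left inverse of [phi], so the derivative of [phi] is
    injective by the chain rule. *)
Lemma stereo_inv_derive_neq0 y (v : V) : v != 0 -> 'D_v phi y != 0.
Proof.
apply: contra_neq => dv0.
pose U := [set x : E | 1 - s * x 0 ord0 != 0].
have Uy : U (phi y) by exact: (stereo_point_dom ss y).
have Uo : open U by exact: stereo_den_open.
have pd := smooth_on_differentiable (stereo_proj_smooth Uo (fun _ => id)) Uy.
have fd := smooth_on_differentiable (stereo_inv_smooth n s) (Logic.I : setT y).
have := derive_comp_diff v fd pd; rewrite dv0.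
have -> : stereo_proj s \o phi = id by apply/funext => z; exact: stereo_invK.
by rewrite derive_id deriveE // linear0.
Qed.

Lemma stereo_inv_normal y (v : V) : dotv ('D_v phi y) (phi y) = 0.
Proof.
have ps := stereo_inv_smooth n s.
have := smooth_derive_dotv openT ps ps v (Logic.I : setT y).
rewrite (open_eq_derive v openT (fun z _ => stereo_inv_unit ss z) (Logic.I : setT y)).
rewrite derive_cst [X in _ = _ + X]dotvC => h.
by move: h; move: (dotv _ _) => t; lra.
Qed.

(** Differentiate the orthogonality of [phi] and its derivatives once more. *)
Lemma stereo_second_form y : second_form phi (fun z => - phi z) y = metric phi y.
Proof.
have ps := stereo_inv_smooth n s.
apply/matrixP => i j; rewrite !mxE.
have Ds : smooth_on setT ('D_(basis_vec R j) phi) := smooth_on_derive _ ps.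
have := smooth_derive_dotv openT Ds ps (basis_vec R i) (Logic.I : setT y).
rewrite (open_eq_derive _ openT (fun z _ => stereo_inv_normal z (basis_vec R j)) (Logic.I : setT y)).
rewrite derive_cst dotvNr [X in _ = _ + X]dotvC => h.
by move: h; move: (dotv _ _) (dotv _ _) => a b; lra.
Qed.

End Chart.

Lemma sphere_chart (c : chart R n M) : atlas c -> exists2 s, s * s = 1 &
  sphere_incl \o chart_inv c = stereo_inv s.
Proof. by move=> [s [ss ->]]; exists s. Qed.

Lemma sphere_second_form c p : atlas c -> chart_dom c p ->
  second_fundamental_form sphere_incl sphere_normal c p = first_fundamental_form sphere_incl c p.
Proof.
move=> ac cp; have [s ss fE] := sphere_chart ac.
have := stereo_second_form ss (chart_map c p).
move=> /matrixP h; apply/matrixP => i j; have := h i j; rewrite !mxE -fE /comp.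
by rewrite chart_mapK.
Qed.

Lemma sphere_first_form_pos_def c p : atlas c -> pos_def (first_fundamental_form sphere_incl c p).
Proof.
move=> ac; have [s ss fE] := sphere_chart ac.
have -> : first_fundamental_form sphere_incl c p = metric (stereo_inv s) (chart_map c p).
  by apply/matrixP => i j; rewrite !mxE fE.
apply: (smooth_metric_pos_def (stereo_inv_smooth n s)) => // v.
exact: stereo_inv_derive_neq0.
Qed.

Lemma sphere_strictly_convex : strictly_convex_hypersurface sphere_incl sphere_normal.
Proof.
split.
- move=> c ac; have [s ss ->] := sphere_chart ac.
  exact: smooth_on_sub (stereo_inv_smooth n s).
- move=> c p ac cp a b; have [s ss ->] := sphere_chart ac => ab.
  apply/eqP; rewrite -subr_eq0; apply: contraT => ne.
  have := stereo_inv_derive_neq0 ss (chart_map c p) ne.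
  rewrite deriveE; last exact: smooth_on_differentiable (stereo_inv_smooth n s) _.
  by rewrite linearB /= ab subrr eqxx.
- move=> p; split.
  + by rewrite /enorm dotvNl dotvNr opprK sphere_incl_unit sqrtr1.
  + move=> c ac cp v; have [s ss fE] := sphere_chart ac.
    have := stereo_inv_normal ss (chart_map c p) v; rewrite -fE /comp chart_mapK //.
    by rewrite dotvNr => ->; rewrite oppr0.
  + rewrite sphere_incl_range; near=> t; apply: enclosed_by_sphere.
    have t0 : 0 < t by near: t; exact: nbhs_right_gt.
    have t1 : t < 1 by near: t; exact: nbhs_right_lt.
    (* The point is [1 - t] times the position, inside the open ball for [0 < t < 1]. *)
    rewrite scalerN -scaleNr -[X in X + _]scale1r -scalerDl dotvZl dotvZr sphere_incl_unit.
    by nra.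
- by move=> c p ac cp; rewrite sphere_second_form //; exact: sphere_first_form_pos_def.
Unshelve. all: by end_near.
Qed.

Lemma sphere_gauss_soliton alpha : gauss_soliton alpha sphere_incl sphere_normal.
Proof.
move=> c p ac cp; have gp := sphere_first_form_pos_def p ac.
have gs : (first_fundamental_form sphere_incl c p)^T = first_fundamental_form sphere_incl c p.
  by apply/matrixP => i j; rewrite !mxE; exact: dotvC.
rewrite gauss_curvatureE ?sphere_second_form // divff ?gt_eqF ?pos_def_det //.
by rewrite powR1 /sphere_normal dotvNr opprK sphere_incl_unit.
Qed.

End SphereSolution.

Theorem theorem1p1 (R : realType) (n : nat) (alpha : R)
    (n_ge2 : (2 <= n)%N)
    (alpha_gt : n%:R^-1 < alpha) (alpha_lt : alpha < 1 + n%:R^-1) :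
  (forall (M : closed_manifold R n) (F nu : M -> 'rV[R]_n.+1),
      strictly_convex_hypersurface F nu ->
      gauss_soliton alpha F nu ->
      range F = unit_sphere R n.+1) /\
  (exists (M : closed_manifold R n) (F nu : M -> 'rV[R]_n.+1),
      [/\ strictly_convex_hypersurface F nu,
          range F = unit_sphere R n.+1
        & gauss_soliton alpha F nu]).
Proof.
have nR : 0 < n%:R :> R by rewrite ltr0n (ltn_trans _ n_ge2).
have a0 : 0 < alpha by apply: lt_trans alpha_gt; rewrite invr_gt0.
(* Positivity of q is the condition [alpha^-1 < n], equivalent to [n^-1 < alpha]. *)
have q0 : 0 < 1 - alpha^-1 / n%:R.
  rewrite subr_gt0 ltr_pdivrMr // mul1r -[ltRHS]invrK ltf_pV2 ?posrE ?invr_gt0 //.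
split=> [M F nu Fc Fs|].
  have pos := soliton_position n_ge2 a0 erefl erefl q0 Fc Fs.
  by apply: (range_unit_sphere n_ge2 _ pos) => c ac; exact: (chart_patch a0 erefl Fc Fs ac).
exists (sphere_manifold R n), (@sphere_incl R n), (@sphere_normal R n); split.
- exact: sphere_strictly_convex.
- exact: sphere_incl_range.
- exact: sphere_gauss_soliton.
Qed.
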